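(* Let $T=T_N\to\infty$ as $N\to\infty$ with $\log T\sim N^{\zeta}$ for some $0<\zeta<1$, and let $\epsilon>0$. Let $X^n_t\sim{\rm N}(\mu^n_t,1)$ be independent, $1\le t\le T$, $1\le n\le N$. Consider the sparse likelihood algorithm (defined in the context) with integers $1\le h_1<h_2<\cdots$ and $1\le d_1<d_2<\cdots$, $h_i\ge d_i$, and critical values $c_T$ satisfying $$\tfrac{h_{i+1}}{h_i}\to1\ \text{ and }\ d_i=o(h_i)\ \text{ as }i\to\infty,\qquad \log\Big(\sum_{i=1}^{i_T}\tfrac{h_i}{d_i}\Big)=o(\log T)\ \text{ as }T\to\infty,$$ $$c_T=o(\log T)\ \text{ and }\ c_T-\log\Big(\sum_{i=1}^{i_T}\tfrac{h_i}{d_i}\Big)\to\infty\ \text{ as }T\to\infty,$$ where $i_T=\max\{i:h_i+d_i\le T\}$, and with score parameters $\lambda_1>0$ (fixed) and $\lambda_2=\sqrt{\tfrac{\log T}{\log\log T}}$. Then, as a test of $H_0:\boldsymbol{\mu}\in\Omega_0$ versus $H_1:\boldsymbol{\mu}\in\Omega_1(\Delta,V,h)$, it achieves, as $N\to\infty$, $$\sup_{\boldsymbol{\mu}\in\Omega_0}P_{\boldsymbol{\mu}}(\text{Type I error})+\sup_{\boldsymbol{\mu}\in\Omega_1(\Delta,V,h)}P_{\boldsymbol{\mu}}(\text{Type II error})\to0$$ under any one of the following conditions. (a) $\Delta>0$ is fixed, and either (i) $V=o\big(\tfrac{\log T}{\log N}\big)$ and $h=4(1+\epsilon)\big(\tfrac{\log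 T}{\Delta^2V}\big)$; or (ii) $V\sim N^{1-\beta}$ for some $\tfrac{1-\zeta}{2}<\beta<1-\zeta$ and $h=4(1+\epsilon)\rho_Z(\beta,\zeta)\big(\tfrac{\log N}{\Delta^2}\big)$. (b) $\Delta=T^{-\eta}$ for some $0<\eta<\tfrac12$, and either (i) $V=o\big(\tfrac{N^{\zeta}}{\log N}\big)$ and $h=4(1-2\eta)(1+\epsilon)\big(\tfrac{\log T}{\Delta^2V}\big)$; or (ii) $V\sim N^{1-\beta}$ for some $\tfrac{1-\zeta}{2}<\beta<1-\zeta$ and $h=4(1+\epsilon)\rho_Z(\beta,\zeta)\big(\tfrac{\log N}{\Delta^2}\big)$.
   Context: Model classes. $\boldsymbol{\mu}=(\mu^n_t:1\le t\le T,1\le n\le N)$ and $P_{\boldsymbol{\mu}}$ is the corresponding probability. The set of change-points is $\boldsymbol{\tau}=\{t:\mu^n_t\ne\mu^n_{t+1}\text{ for some }n\}=\{\tau_1<\cdots<\tau_J\}$, $J=\#\boldsymbol{\tau}$, with $\tau_0=0$, $\tau_{J+1}=T$. $V=V_N$ is a positive integer (a number of sequences). Let $m_{j\Delta}=\#\{n:|\mu^n_{\tau_j+1}-\mu^n_{\tau_j}|\ge\Delta\}$, $\Omega_0=\{\boldsymbol{\mu}:J=0\}$, and $$\Omega_1(\Delta,V,h)=\{\boldsymbol{\mu}:\text{there exists }1\le j\le J\text{ such that }\min(\tau_j-\tau_{j-1},\tau_{j+1}-\tau_j)\ge h\text{ and }m_{j\Delta}\ge V\}.$$ $$\rho_Z(\beta,\zeta)=\begin{cases}\beta-\tfrac{1-\zeta}{2}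 & \text{if }\tfrac{1-\zeta}{2}<\beta\le\tfrac{3(1-\zeta)}{4},\\ (\sqrt{1-\zeta}-\sqrt{1-\zeta-\beta})^2 & \text{if }\tfrac{3(1-\zeta)}{4}<\beta<1-\zeta.\end{cases}$$ A Type I error is concluding $H_1$ when $H_0$ is true; a Type II error is concluding $H_0$ when $H_1$ is true. Scores. For $p\in(0,1]$ let $f_1(p)=\frac{1}{p(2-\log p)^2}-\frac12$, $f_2(p)=\frac1{\sqrt p}-2$, $$\ell_N(p)=\log\Big(1+\tfrac{\lambda_1\log N}{N}f_1(p)+\tfrac{\lambda_2}{\sqrt{N\log N}}f_2(p)\Big),\qquad \ell_N({\bf p})=\sum_{n=1}^N\ell_N(p^n)$$ (well defined for $N$ large). For integers $0\le s<t<u\le T$ let $\bar X^n_{st}=(t-s)^{-1}\sum_{v=s+1}^tX^n_v$, $$Z^n_{stu}=\frac{\bar X^n_{tu}-\bar X^n_{st}}{\sqrt{(u-t)^{-1}+(t-s)^{-1}}},\qquad p^n_{stu}=2\Phi(-|Z^n_{stu}|),\qquad {\bf p}_{stu}=(p^1_{stu},\ldots,p^N_{stu}),$$ with $\Phi$ the standard normal distribution function, and let the penalized score be $$\ell^{\rm pen}_N({\bf p}_{stu})=\ell_N({\bf p}_{stu})-\log\Big(\tfrac T4\big(\tfrac1{t-s}+\tfrac1{u-t}\big)\Big).$$ Algorithm. For $i\ge1$ and $1\le k\le K_i(T)=\lfloor\frac{T-1}{d_i}\rfloor$ let $s(ik)=\max(0,kd_i-h_i)$, $t(ik)=kd_i$,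 $u(ik)=\min(kd_i+h_i,T)$. The sparse likelihood algorithm, run on the full dataset with critical value $c_T$, declares that there is at least one change-point (concludes $H_1$) if and only if $\ell^{\rm pen}_N({\bf p}_{s(ik),t(ik),u(ik)})\ge c_T$ for some $1\le i\le i_T$ and $1\le k\le K_i(T)$; otherwise it concludes $H_0$. $a_N\sim b_N$ means $a_N/b_N\to1$. *)

(* Defs.v *)
From HB Require Import structures.
From mathcomp Require Export all_boot all_order all_algebra.
From mathcomp Require Export all_classical all_reals all_analysis.

Set Implicit Arguments.
Unset Strict Implicit.
Unset Printing Implicit Defensive.

Export Order.TTheory GRing.Theory Num.Theory.
Export numFieldNormedType.Exports.

#[export] Set Implicit Arguments.
#[export] Unset Strict Implicit.
#[export] Unset Printing Implicit Defensive.

Local Open Scope classical_set_scope.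
Local Open Scope ring_scope.

Section Arrays.
Context {R : realType}.

(* Rows are the sequences, columns the times.  Times are numbered 1, ..., T as
   natural numbers, so time t is column t.-1; only 1 <= t <= T is meaningful. *)
Definition entry (N T : nat) (A : 'M[R]_(N, T)) (n : 'I_N) (t : nat) : R :=
  if insub t.-1 is Some i then A n i else 0.

Definition change_points (N T : nat) (mu : 'M[R]_(N, T)) : seq nat :=
  [seq t <- iota 1 T.-1 | [exists n, entry mu n t != entry mu n t.+1]].

Definition nb_changes (N T : nat) (mu : 'M[R]_(N, T)) : nat :=
  size (change_points mu).

(* tau mu 0 = 0 and, through the default value of nth,
   tau mu (nb_changes mu).+1 = T. *)
Definition tau (N T : nat) (mu : 'M[R]_(N, T)) (j : nat) : nat :=
  nth T (0%N :: change_points mu) j.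

Definition nb_jumps (N T : nat) (mu : 'M[R]_(N, T)) (Delta : R) (j : nat) : nat :=
  #|[set n : 'I_N |
      Delta <= `|entry mu n (tau mu j).+1 - entry mu n (tau mu j)| ]%SET|.

Definition Omega0 (N T : nat) : set 'M[R]_(N, T) :=
  [set mu | nb_changes mu = 0%N].

Definition Omega1 (N T : nat) (Delta : R) (V : nat) (h : R) : set 'M[R]_(N, T) :=
  [set mu | exists j : nat,
    [/\ (1 <= j <= nb_changes mu)%N,
        h <= (minn (tau mu j - tau mu j.-1) (tau mu j.+1 - tau mu j))%:R
      & (V <= nb_jumps mu Delta j)%N]].

End Arrays.

Arguments Omega0 {R} N T.

Section Model.
Context {R : realType} {disp : measure_display} {Om : measurableType disp}.

Definition mutually_independent (I : finType) (P : probability Om R)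
    (X : I -> {mfun Om >-> measurableTypeR R}) : Prop :=
  forall (J : {set I}) (A : I -> set (measurableTypeR R)),
    (forall i, measurable (A i)) ->
    P (\bigcap_(i in [set i | i \in J]) (X i @^-1` A i)) =
    (\prod_(i in J) P (X i @^-1` A i))%E.

Definition gaussian_model (N T : nat) (P : 'M[R]_(N, T) -> probability Om R)
    (X : 'I_N -> 'I_T -> {mfun Om >-> measurableTypeR R}) : Prop :=
  forall mu : 'M[R]_(N, T),
    (forall (n : 'I_N) (t : 'I_T) (A : set (measurableTypeR R)), measurable A ->
       distribution (P mu) (X n t) A = normal_prob (mu n t) 1 A) /\
    mutually_independent (P mu) (fun nt : 'I_N * 'I_T => X nt.1 nt.2).

Definition data (N T : nat) (X : 'I_N -> 'I_T -> {mfun Om >-> measurableTypeR R})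
    (w : Om) : 'M[R]_(N, T) :=
  \matrix_(n, t) X n t w.

End Model.

Section Scores.
Context {R : realType}.

Definition Phi (x : R) : R := fine (normal_prob (0 : R) 1 `]-oo, x]).

Definition f1 (p : R) : R := (p * (2 - ln p) ^+ 2)^-1 - 2^-1.

Definition f2 (p : R) : R := (Num.sqrt p)^-1 - 2.

Definition score (N : nat) (lambda1 lambda2 p : R) : R :=
  ln (1 + lambda1 * ln N%:R / N%:R * f1 p
        + lambda2 / Num.sqrt (N%:R * ln N%:R) * f2 p).

Definition segment_mean (N T : nat) (x : 'M[R]_(N, T)) (n : 'I_N) (s t : nat) : R :=
  (\sum_(s.+1 <= v < t.+1) entry x n v) / (t - s)%:R.

Definition zstat (N T : nat) (x : 'M[R]_(N, T)) (n : 'I_N) (s t u : nat) : R :=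
  (segment_mean x n t u - segment_mean x n s t) /
  Num.sqrt ((u - t)%:R^-1 + (t - s)%:R^-1).

Definition pvalue (N T : nat) (x : 'M[R]_(N, T)) (n : 'I_N) (s t u : nat) : R :=
  2 * Phi (- `|zstat x n s t u|).

Definition penalized_score (N T : nat) (lambda1 lambda2 : R) (x : 'M[R]_(N, T))
    (s t u : nat) : R :=
  \sum_(n < N) score N lambda1 lambda2 (pvalue x n s t u)
  - ln (T%:R / 4 * ((t - s)%:R^-1 + (u - t)%:R^-1)).

End Scores.

Section Algorithm.
Context {R : realType}.
(* Only the values at i >= 1 of the window lengths h and spacings d are used. *)
Variables h d : nat -> nat.

(* As h is positive and increasing, h i + d i <= T forces i <= T. *)
Definition last_scale (T : nat) : nat :=
  (\max_(1 <= i < T.+1 | h i + d i <= T) i)%N.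

Definition scale_sum (T : nat) : R :=
  \sum_(1 <= i < (last_scale T).+1) (h i)%:R / (d i)%:R.

(* The truncated subtraction k * d i - h i is max(0, k d_i - h_i). *)
Definition declares_change (N T : nat) (lambda1 lambda2 c : R)
    (x : 'M[R]_(N, T)) : Prop :=
  exists i k : nat,
    [/\ (1 <= i <= last_scale T)%N,
        (1 <= k <= (T - 1) %/ d i)%N
      & c <= penalized_score lambda1 lambda2 x
               (k * d i - h i) (k * d i) (minn (k * d i + h i) T)].

End Algorithm.

Section Risk.
Context {R : realType}.

Definition rhoZ (beta zeta : R) : R :=
  if beta <= 3 * (1 - zeta) / 4 then beta - (1 - zeta) / 2
  else (Num.sqrt (1 - zeta) - Num.sqrt (1 - zeta - beta)) ^+ 2.

(* In the reals the supremum of the empty set is 0, the least value of a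
   probability. *)
Definition sup_prob (disp : measure_display) (Om : measurableType disp)
    (M : Type) (P : M -> probability Om R) (A : set M) (E : set Om) : R :=
  sup [set fine (P mu E) | mu in A].

(* a_N ~ b_N *)
Definition asymp_equiv (a b : nat -> R) : Prop :=
  a N / b N @[N --> \oo] --> (1 : R).

End Risk.

(* Main.v *)
From HB Require Import structures.
Require Import Defs.
From mathcomp Require Import measurable_realfun ring lra zify.

(** The likelihood ratio of a row, $1+af_1(p)+bf_2(p)$ with $a=\lambda_1\log N/N$ and
    $b=\lambda_2/\sqrt{N\log N}$, is a density in $p$: both $f_1$ and $f_2$ integrate to $0$ over
    $(0,1]$. All estimates are exponential Markov inequalities for sums of its logarithm. They
    reduce to Gaussian integrals over one row, because the window statistic is a linear form with
    unit weights and the rows are independent ([gaussian_model_expectation], [window_chernoff]).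

    Type I. Without change-points every window statistic is standard normal, its p-value is
    uniform, and the exponential of the total score has mean $1$ ([integral_likratio]). The penalty
    keeps the union bound over all windows below $2e^{-c_T}\sum_ih_i/d_i\to0$
    ([type1_error_le]).

    Type II. If a change-point is at distance at least $h$ from its neighbours, some window of the
    algorithm has half-width almost $h$, lies inside the adjacent segments and is almost centred
    ([exists_scale], [window_of_Omega1]); at least $V$ rows then have statistics with mean $m_n$,
    $m_n^2\ge m_0^2\approx h\Delta^2/2$. It remains to bound the probability
    that the score of this one window is too small ([type2_error_le]).

    - Nothing is known about the means of the other rows, but by Chebyshev's association inequality
      a nonzero mean only helps ([normal_shift_le]). They cost a factor $e^{N\nu}$ with
      $N\nu=o(\log T)$ ([null_moment], [near_null_excess]): the contributions of order $b$ cancel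
      exactly, and those of order $b^2$ are what $\lambda_2$ is calibrated for.
    - If $V=o(\log T/\log N)$, the $f_1$ term is used: the score of a row is about
      $m_n^2/2-\log N$, and $V m_0^2/2\approx\kappa(1+\varepsilon)\log T$ exceeds the penalty of
      the window, where $\Delta^2$ is of order $T^{-(1-\kappa)}$ ([strong_signal_moment],
      [near_type2_sparse]).
    - If $V\sim N^{1-\beta}$, the $f_2$ term is used, truncated at the level $s\sqrt{2\log N}$:
      when $m_0=q\sqrt{2\log N}$ a row gains about $bN^{s^2/2-(s-q)^2}$, and
      optimizing over $s\le\sqrt{1-\zeta}$ yields the two branches of $\rho_Z$
      ([moderate_signal_moment], [exists_truncation], [near_type2_dense]). *)

Local Open Scope classical_set_scope.
Local Open Scope ring_scope.

(** * Normal laws *)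

Section lebesgue_affine.
Context {R : realType}.
Local Notation mu := (@lebesgue_measure R).

Lemma lebesgue_measure_affine (w b : R) (A : set (measurableTypeR R)) : w != 0 -> measurable A ->
  mu A = (`|w|%:E * mu ((fun x => (w * x + b)%R) @^-1` A))%E.
Proof.
move=> w0 mA.
pose f (x : measurableTypeR R) : measurableTypeR R := w * x + b.
have mf : measurable_fun setT f by apply: measurable_funD.
pose nu := mscale (NngNum (normr_ge0 w)) (pushforward mu f).
suff : forall A, measurable A -> mu A = nu mf A by move=> /(_ A mA) ->.
apply: lebesgue_measure_unique => X [[x y] _ <-].
change (mu `]x, y]%classic = `|w|%:E * mu (f @^-1` `]x, y]%classic))%E.
case: (ltrgtP w 0) => [wlt0|wgt0|/eqP]; last by rewrite (negbTE w0).
- (* the image of an interval open on the left is open on the right *)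
  rewrite (_ : f @^-1` `]x, y] = `[(y - b)/w, (x - b)/w[%classic); last first.
    apply/seteqP; split => z /=; rewrite /f !in_itv /= ltr_ndivlMr// ler_ndivrMr// ltrBlDr lerBrDr mulrC andbC //.
  rewrite !lebesgue_measure_itv /= !lte_fin ltr_nM2r ?invr_lt0// ltrD2r.
  case: ifPn => _; last by rewrite mule0.
  rewrite -!EFinD -EFinM (ltr0_norm wlt0). congr EFin. by field.
- rewrite (_ : f @^-1` `]x, y] = `](x - b)/w, (y - b)/w]%classic); last first.
    apply/seteqP; split => z /=; rewrite /f !in_itv /= ltr_pdivrMr// ler_pdivlMr// ltrBlDr lerBrDr mulrC //.
  rewrite !lebesgue_measure_itv /= !lte_fin ltr_pM2r ?invr_gt0// ltrD2r.
  case: ifPn => _; last by rewrite mule0.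
  rewrite -!EFinD -EFinM (gtr0_norm wgt0). congr EFin. by field.
Qed.

Lemma ge0_integral_affine (w b : R) (f : R -> \bar R) : w != 0 ->
  measurable_fun setT f -> (forall x, 0 <= f x)%E ->
  (\int[mu]_x f x = `|w|%:E * \int[mu]_x f (w * x + b)%R)%E.
Proof.
move=> w0 mf f0.
pose g (x : measurableTypeR R) : measurableTypeR R := w * x + b.
have mg : measurable_fun setT g by apply: measurable_funD.
pose nu := mscale (NngNum (normr_ge0 w)) (pushforward mu g).
rewrite (@eq_measure_integral _ _ _ _ (nu mg)); last first.
  by move=> A mA _; exact: (lebesgue_measure_affine b w0 mA).
rewrite /nu ge0_integral_mscale//=; congr (_ * _)%E.
by rewrite (ge0_integral_pushforward mg).
Qed.
End lebesgue_affine.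

Section normal_law.
Context {R : realType}.
Local Notation mu := (@lebesgue_measure R).
Implicit Types (m s w a b x y : R) (f : R -> \bar R).

Lemma measurable_EFin_normal_pdf m s : measurable_fun setT (fun x => (normal_pdf m s x)%:E).
Proof. by apply/measurable_EFinP; exact: measurable_normal_pdf. Qed.

Lemma ge0_integral_normal_prob m s f :
  measurable_fun setT f -> (forall x, 0 <= f x)%E ->
  (\int[normal_prob m s]_x f x = \int[mu]_x (f x * (normal_pdf m s x)%:E))%E.
Proof.
move=> mf f0.
have dom := @normal_prob_dominates R m s.
rewrite -(Radon_Nikodym_SigmaFinite.change_of_variables dom)//.
apply: ae_eq_integral => //.
- apply: emeasurable_funM => //.
  exact: measurable_int (Radon_Nikodym_SigmaFinite.f_integrable dom).
- by apply: emeasurable_funM => //; exact: measurable_EFin_normal_pdf.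
- apply: ae_eqe_mul2l; apply: integral_ae_eq => //.
  + exact: Radon_Nikodym_SigmaFinite.f_integrable.
  + exact: measurable_EFin_normal_pdf.
  + by move=> E _ mE; rewrite -Radon_Nikodym_SigmaFinite.f_integral.
Qed.

Lemma normal_probE m s (A : set R) : measurable A ->
  normal_prob m s A = (\int[mu]_x ((\1_A x)%:E * (normal_pdf m s x)%:E))%E.
Proof.
move=> mA; rewrite /normal_prob integral_mkcond; apply: eq_integral => x _.
by rewrite patchE indicE; case: (x \in A); rewrite ?mul1e ?mul0e.
Qed.

Lemma normal_pdf_affine m s w b x : s != 0 -> w != 0 ->
  `|w| * normal_pdf (w * m + b) (`|w| * s) (w * x + b) = normal_pdf m s x.
Proof.
move=> s0 w0; have ws0 : `|w| * s != 0 by rewrite mulf_neq0 ?normr_eq0.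
rewrite !normal_pdfE// /normal_peak /normal_fun mulrA; congr (_ * expR _).
  rewrite exprMn -normrX (ger0_norm (sqr_ge0 w)) -mulrnAr -mulrA sqrtrM ?sqr_ge0//.
  rewrite sqrtr_sqr invfM mulrA divff ?normr_eq0// mul1r mulrnAr//.
rewrite exprMn -normrX (ger0_norm (sqr_ge0 w)).
by field; rewrite s0 w0.
Qed.

Lemma normal_prob_affine m s w b (A : set R) : s != 0 -> w != 0 -> measurable A ->
  normal_prob m s ((fun x => w * x + b) @^-1` A) =
  normal_prob (w * m + b) (`|w| * s) A.
Proof.
move=> s0 w0 mA.
have mg : measurable_fun setT (fun x : R => w * x + b) by apply: measurable_funD.
have mA' : measurable ((fun x : R => w * x + b) @^-1` A).
  by rewrite -[X in measurable X]setTI; exact: mg.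
rewrite (normal_probE m s mA') (normal_probE (w * m + b) (`|w| * s) mA).
apply: esym; apply: etrans (ge0_integral_affine b w0 _ _) _.
- apply: emeasurable_funM; last exact: measurable_EFin_normal_pdf.
  exact/measurable_EFinP.
- by move=> x; rewrite -EFinM lee_fin mulr_ge0 ?normal_pdf_ge0.
rewrite -ge0_integralZl//=; first last.
- by move=> x _; rewrite -EFinM lee_fin mulr_ge0 ?normal_pdf_ge0.
- apply: emeasurable_funM; apply/measurable_EFinP; last first.
    exact: (measurableT_comp (measurable_normal_pdf _ _) mg).
  exact: (measurableT_comp (measurable_indic _) mg).
apply: eq_integral => x _; rewrite -!EFinM; congr EFin.
by rewrite -(normal_pdf_affine m b x s0 w0) mulrCA indicE.
Qed.

(** Completing the square: the joint density of $(x, y)$ with $x\sim N(m,1)$ and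
    $y\sim N(a+wx,s^2)$, factored through the marginal of $y$. *)
Lemma normal_pdf_mix m s w a x y : s != 0 ->
  let v := Num.sqrt (s ^+ 2 + w ^+ 2) in
  normal_pdf (a + w * x) s y * normal_pdf m 1 x =
  normal_pdf (a + w * m) v y *
  normal_pdf ((s ^+ 2 * m + w * (y - a)) / (s ^+ 2 + w ^+ 2)) (s / v) x.
Proof.
move=> s0 v.
have v2 : v ^+ 2 = s ^+ 2 + w ^+ 2 by rewrite sqr_sqrtr// addr_ge0 ?sqr_ge0.
have s2 : 0 < s ^+ 2 by rewrite exprn_even_gt0.
have v20 : 0 < s ^+ 2 + w ^+ 2 by rewrite ltr_pwDl ?sqr_ge0.
have v0 : v != 0 by rewrite gt_eqF// sqrtr_gt0.
have sv0 : s / v != 0 by rewrite mulf_neq0 ?invr_eq0.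
rewrite !normal_pdfE ?oner_eq0// /normal_peak /normal_fun.
rewrite mulrACA [RHS]mulrACA -!expRD; congr (_ * expR _).
  have q0 (z : R) : 0 <= z ^+ 2 * pi *+ 2 by rewrite mulrn_wge0// mulr_ge0 ?sqr_ge0 ?pi_ge0.
  rewrite -!invfM -!sqrtrM//.
  congr (GRing.inv (_ _)); by field.
rewrite expr_div_n v2 (expr1n _ 2).
by field; rewrite s0 gt_eqF.
Qed.

Lemma normal_pdf_center m s x : s != 0 -> normal_pdf m s x = normal_pdf 0 s (x - m).
Proof. by move=> s0; rewrite !normal_pdfE// /normal_fun subr0. Qed.

(** Adding an independent normal variable, in the conditional form that an induction over the
    summands produces: after completing the square, the inner integral is the total mass of
    a normal density. *)
Lemma normal_prob_mix m s w a (A : set R) : s != 0 -> measurable A ->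
  (\int[normal_prob m 1]_x normal_prob (a + w * x) s A =
   normal_prob (a + w * m) (Num.sqrt (s ^+ 2 + w ^+ 2)) A)%E.
Proof.
move=> s0 mA; pose v := Num.sqrt (s ^+ 2 + w ^+ 2).
have sv0 : s / v != 0.
  by rewrite mulf_neq0 ?invr_eq0// gt_eqF// sqrtr_gt0 ltr_pwDl ?sqr_ge0// exprn_even_gt0.
pose k (z : measurableTypeR R * measurableTypeR R) :=
  ((\1_A z.2)%:E * (normal_pdf (a + w * z.1) s z.2)%:E * (normal_pdf m 1 z.1)%:E)%E.
have mA1 : measurable_fun setT (fun z : measurableTypeR R * measurableTypeR R => (\1_A z.2 : R)%:E).
  apply/measurable_EFinP.
  exact: (measurableT_comp (measurable_indic mA) (measurable_snd)).
have mpdf2 : measurable_fun setT (fun z : measurableTypeR R * measurableTypeR R =>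
    (normal_pdf (a + w * z.1) s z.2)%:E).
  apply/measurable_EFinP.
  rewrite (_ : (fun _ => _) = normal_pdf 0 s \o (fun z : measurableTypeR R * measurableTypeR R => z.2 - (a + w * z.1)));
    last by apply/funext => z /=; rewrite normal_pdf_center.
  apply: (measurableT_comp (measurable_normal_pdf _ _)).
  apply: measurable_funB; first exact: measurable_snd.
  by apply: measurable_funD => //; apply: measurable_funM => //; exact: measurable_fst.
have mk : measurable_fun setT k.
  apply: emeasurable_funM; first exact: emeasurable_funM.
  apply/measurable_EFinP.
  exact: (measurableT_comp (measurable_normal_pdf _ _) (measurable_fst)).
have k0 z : (0 <= k z)%E.
  by rewrite /k -!EFinM lee_fin !mulr_ge0 ?normal_pdf_ge0.
have inner x : (normal_prob (a + w * x) s A * (normal_pdf m 1 x)%:E =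
    \int[mu]_y k (x, y))%E.
  rewrite normal_probE// -ge0_integralZr//=.
  - by apply: emeasurable_funM; [exact/measurable_EFinP|exact: measurable_EFin_normal_pdf].
  - by move=> y _; rewrite -EFinM lee_fin mulr_ge0 ?normal_pdf_ge0.
  - by rewrite lee_fin normal_pdf_ge0.
have mP : measurable_fun setT (fun x => normal_prob (a + w * x) s A).
  pose k1 (z : measurableTypeR R * measurableTypeR R) :=
    ((\1_A z.2)%:E * (normal_pdf (a + w * z.1) s z.2)%:E)%E.
  rewrite (_ : (fun _ => _) = fubini_F mu k1).
    apply: measurable_fun_fubini_tonelli_F => [|z].
      exact: emeasurable_funM.
    by rewrite /k1 -EFinM lee_fin mulr_ge0 ?normal_pdf_ge0.
  by apply/funext => x; rewrite normal_probE.
rewrite ge0_integral_normal_prob//.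
under eq_integral do rewrite inner.
rewrite (fubini_tonelli (m1 := mu) (m2 := mu) k mk k0) (normal_probE _ _ mA).
apply: eq_integral => y _; rewrite /k /=.
under eq_integral => x _ do rewrite -muleA -[X in (_ * X)%E]EFinM (normal_pdf_mix m w a x y s0) [X in (_ * X)%E]EFinM muleA.
rewrite ge0_integralZl//=.
- by rewrite integral_normal_pdf mule1.
- exact: measurable_EFin_normal_pdf.
- by move=> x _; rewrite lee_fin normal_pdf_ge0.
- by rewrite -EFinM lee_fin mulr_ge0 ?normal_pdf_ge0.
Qed.
End normal_law.

(** * The law of the p-values *)

Section pvalue_law.
Context {R : realType}.
Local Notation mu := (@lebesgue_measure R).
Local Notation phi := (normal_pdf (0 : R) 1).
Implicit Types (m z x p : R) (g F : R -> R).

Lemma normal_pdf_gt0 m x : 0 < normal_pdf m 1 x :> R.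
Proof. by rewrite normal_pdfE ?oner_eq0// mulr_gt0 ?expR_gt0// normal_peak_gt0 ?oner_eq0. Qed.

Lemma normal_pdfN m x : normal_pdf m 1 (- x) = normal_pdf (- m) 1 x :> R.
Proof.
rewrite !normal_pdfE ?oner_eq0// /normal_fun; congr (_ * expR _); by field.
Qed.

Lemma is_derive_Phi x : is_derive x 1 (Phi : R -> R) (phi x).
Proof.
have x1 : x < x + 1 by rewrite ltrDl.
have int : mu.-integrable [set` Interval -oo%O (BRight (x + 1))] (EFin \o phi).
  by apply: integrableS (integrable_normal_pdf 0 1).
have := continuous_FTC1 x1 int (ltNyr _) (@continuous_normal_pdf _ 0 1 (oner_neq0 _) x).
rewrite -[X in derivable X _ _]/(Phi : R -> R) -[X in X^`()%classic]/(Phi : R -> R) derive1E.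
by move=> [d e]; exact: DeriveDef.
Qed.

Lemma Phi_ge0 x : 0 <= Phi x.
Proof. by rewrite fine_ge0. Qed.

Lemma Phi_le1 x : Phi x <= 1.
Proof. by rewrite -lee_fin fineK ?fin_num_measure// probability_le1. Qed.

Lemma continuous_Phi : continuous (Phi : R -> R).
Proof.
move=> x; apply: differentiable_continuous; apply/derivable1_diffP.
exact: (@ex_derive _ _ _ _ _ _ _ (is_derive_Phi x)).
Qed.

Lemma Phi_lt x y : x < y -> Phi x < Phi y.
Proof.
move=> xy; apply: (gtr0_derive1_incr _ _ _ (lexx x) xy (lexx y)) => [z _|z _|].
- exact: (@ex_derive _ _ _ _ _ _ _ (is_derive_Phi z)).
- by rewrite derive1E (@derive_val _ _ _ _ _ _ _ (is_derive_Phi z)) normal_pdf_gt0.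
- by apply: continuous_subspaceT; exact: continuous_Phi.
Qed.

Lemma Phi_gt0 x : 0 < Phi x.
Proof. by apply: le_lt_trans (Phi_ge0 (x - 1)) _; rewrite Phi_lt// ltrBlDr ltrDl. Qed.

Lemma Phi_lt1 x : Phi x < 1.
Proof. by apply: lt_le_trans (Phi_le1 (x + 1)); rewrite Phi_lt// ltrDl. Qed.

Lemma Phi_le x y : x <= y -> Phi x <= Phi y.
Proof. by rewrite le_eqVlt => /predU1P[->//|/Phi_lt/ltW]. Qed.

(** The reflection $x\mapsto -x$ preserves $N(0,1)$, so half of the mass lies on each side. *)
Lemma Phi0 : Phi 0 = 2^-1 :> R.
Proof.
pose A := [set x : R | 0 <= x].
have mA : measurable A by rewrite /A -set_itvcy.
have e1 : (2%:E * normal_prob 0 1 A = 1)%E.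
  rewrite -(integral_normal_pdf 0 1) /normal_prob ge0_symfun_integralT//.
  - exact: normal_pdf_ge0.
  - exact: (@continuous_normal_pdf _ 0 1 (oner_neq0 _)).
  - by move=> x /=; rewrite normal_pdfN oppr0.
have e2 : normal_prob (0 : R) 1 `]-oo, 0] = normal_prob (0 : R) 1 A.
  have N0 : -1 != 0 :> R by rewrite oppr_eq0 oner_eq0.
  have := normal_prob_affine 0 0 (oner_neq0 R) N0 mA.
  rewrite mulr0 addr0 normrN1 mul1r => <-; congr (normal_prob _ _ _).
  by apply/seteqP; split => x; rewrite /A /= in_itv /= addr0 mulN1r oppr_ge0.
rewrite /Phi e2; move: e1; rewrite -[normal_prob _ _ _]fineK ?fin_num_measure// -EFinM => -[e1].
by apply: (@mulfI _ 2); rewrite ?e1 ?mulfV.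
Qed.

(** For $x\le-z$ the standard density is at most $e^{-z^2/2}$ times the density of $N(-z,1)$. *)
Lemma Phi_tail z : 0 <= z -> Phi (- z) <= expR (- z ^+ 2 / 2).
Proof.
move=> z0; rewrite -lee_fin fineK ?fin_num_measure// /normal_prob.
apply: (@le_trans _ _ (\int[mu]_(x in `]-oo, (- z)%R]) ((expR (- z ^+ 2 / 2))%:E * (normal_pdf (- z) 1 x)%:E))%E).
  apply: ge0_le_integral => //=.
  - by move=> x _; rewrite lee_fin normal_pdf_ge0.
  - by apply: measurable_funTS; exact: measurable_EFin_normal_pdf.
  - by apply: measurable_funTS; apply: emeasurable_funM => //; exact: measurable_EFin_normal_pdf.
  - move=> x; rewrite in_itv /= => xz; rewrite -EFinM lee_fin !normal_pdfE ?oner_eq0//.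
    rewrite mulrCA ler_wpM2l ?normal_peak_ge0// /normal_fun -expRD ler_expR.
    nra.
rewrite ge0_integralZl//=; last 2 first.
- by apply: measurable_funTS; exact: measurable_EFin_normal_pdf.
- by move=> x _; rewrite lee_fin normal_pdf_ge0.
rewrite -[leRHS]mule1 lee_pmul2l// ?lte_fin ?expR_gt0//.
exact: (@probability_le1 _ _ _ (normal_prob (- z) 1)).
Qed.

Let q x := 2 * Phi (- x).

Let q_gt0 x : 0 < q x. Proof. by rewrite mulr_gt0 ?Phi_gt0. Qed.

Let q_lt2 x : q x < 2. Proof. by rewrite gtr_pMr ?Phi_lt1. Qed.

Let is_derive_q x : is_derive x 1 q (- (2 * phi x)).
Proof.
rewrite (_ : - (2 * phi x) = 2 *: (phi (- x) * -1)); last first.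
  by rewrite normal_pdfN oppr0 mulrN1 scalerN.
rewrite (_ : q = 2 *: ((Phi : R -> R) \o -%R)); last by apply/funext.
apply: is_deriveZ; apply: is_derive1_comp; exact: is_derive_Phi.
Qed.

Let continuous_q : continuous q.
Proof.
move=> x; apply: differentiable_continuous; apply/derivable1_diffP.
exact: (@ex_derive _ _ _ _ _ _ _ (is_derive_q x)).
Qed.

Let q_cvg0 : q x @[x --> +oo%R] --> 0.
Proof.
apply: (@squeeze_cvgr _ _ _ _ (fun=> 0) (fun x => 2 * expR (- x))).
- near=> x; rewrite (ltW (q_gt0 _))/= ler_wpM2l//.
  have x2 : 2 <= x by near: x; apply: nbhs_pinfty_ge; exact: num_real.
  apply: le_trans (Phi_tail _) _; first lra.
  by rewrite ler_expR; nra.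
- exact: cvg_cst.
- by rewrite -[X in _ --> X](mulr0 2); apply: cvgM; [exact: cvg_cst|exact: cvgr_expR].
Unshelve. all: by end_near. Qed.

(** The two-sided p-value $p=2\Phi(-|z|)$ is uniform for $z\sim N(0,1)$. This form of the
    fact works with an antiderivative $F$ of $g$ along the curve $p=2\Phi(-x)$; the range
    $0<p<2$ leaves room on both sides of the starting point $p=1$, where $x=0$. *)
Lemma integral_pvalue g F (l : R) :
  (forall p, 0 < p < 2 -> 0 <= g p) ->
  (forall p, 0 < p < 2 -> {for p, continuous g}) ->
  (forall p, 0 < p < 2 -> is_derive p 1 F (g p)) ->
  F p @[p --> 0^'+] --> l ->
  (\int[mu]_x (g (2 * Phi (- `|x|)) * phi x)%:E = (F 1 - l)%:E)%E.
Proof.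
move=> g0 cg dF Fl.
have q02 x : 0 < q x < 2 by rewrite q_gt0 q_lt2.
have gq0 x : 0 <= g (q x) * phi x by rewrite mulr_ge0 ?normal_pdf_ge0// g0.
have cgq : continuous (fun x => g (q x)).
  by move=> x; apply: continuous_comp; [exact: continuous_q|exact: cg].
have cphi : continuous phi := @continuous_normal_pdf _ 0 1 (oner_neq0 _).
rewrite (@ge0_symfun_integralT R (fun x => g (2 * Phi (- `|x|)) * phi x)).
- rewrite (_ : (\int[mu]_(x in _) _)%E = (\int[mu]_(x in `[0%R, +oo[) (g (q x) * phi x)%:E)%E); last first.
    rewrite set_itvcy; apply: eq_integral => x; rewrite inE /= => x0.
    by rewrite /q ger0_norm.
  pose G x := - (F (q x) / 2).
  have dG x : is_derive x 1 G (g (q x) * phi x).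
    rewrite (_ : g (q x) * phi x = - (2^-1 *: (g (q x) * - (2 * phi x)))); last first.
      by rewrite /GRing.scale /=; field.
    rewrite (_ : G = - (2^-1 *: (F \o q))); last by apply/funext => t; rewrite /G /= mulrC.
    by apply: is_deriveN; apply: is_deriveZ; exact: is_derive1_comp (dF _ (q02 x)) (is_derive_q x).
  rewrite (@ge0_continuous_FTC2y R (fun x => g (q x) * phi x) G 0 (- (l / 2))).
  + rewrite /G /q oppr0 Phi0 mulfV// -EFinB -EFinM; congr EFin; by field.
  + by move=> x _.
  + by apply: continuous_subspaceT => x; apply: cvgM; [exact: cgq|exact: cphi].
  + apply: cvgN; apply: cvgM; last exact: cvg_cst.
    move=> A /Fl HA; have : nbhs 0 (fun p : R => 0 < p -> A (F p)) by [].
    move=> HB; have HA' : \forall x \near +oo%R, 0 < q x -> A (F (q x)) := q_cvg0 HB.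
    by change (\forall x \near +oo%R, A (F (q x))); apply: filterS HA' => x; apply.
  + move=> x _; exact: (@ex_derive _ _ _ _ _ _ _ (dG x)).
  + apply: cvg_at_right_filter.
    apply: differentiable_continuous; apply/derivable1_diffP.
    exact: (@ex_derive _ _ _ _ _ _ _ (dG 0)).
  + by move=> x _; rewrite derive1E (@derive_val _ _ _ _ _ _ _ (dG x)).
- by move=> x; rewrite mulr_ge0 ?normal_pdf_ge0// g0// -/(q `|x|).
- move=> x; apply: cvgM; last exact: cphi.
  exact: (continuous_comp (@norm_continuous _ _ x) (cgq _)).
- by move=> x /=; rewrite normrN normal_pdfN oppr0.
Qed.
End pvalue_law.

Section pvalue_integrals.
Context {R : realType}.
Local Notation mu := (@lebesgue_measure R).
Implicit Types (a b m z x p : R).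

Definition pval z : R := 2 * Phi (- `|z|).

Lemma pval_gt0 z : 0 < pval z.
Proof. by rewrite mulr_gt0 ?Phi_gt0. Qed.

Lemma pval_le1 z : pval z <= 1.
Proof.
rewrite -[leRHS](mulfV (_ : 2 != 0 :> R))// ler_wpM2l//.
by rewrite -Phi0 Phi_le// oppr_le0.
Qed.

Lemma pval_lt2 z : pval z < 2.
Proof. by apply: le_lt_trans (pval_le1 z) _; rewrite ltr1n. Qed.

Lemma pvalN z : pval (- z) = pval z.
Proof. by rewrite /pval normrN. Qed.

Lemma le_pval x z : `|x| <= `|z| -> pval z <= pval x.
Proof. by move=> xz; rewrite ler_wpM2l// Phi_le// lerN2. Qed.

Lemma pval_tail z : pval z <= 2 * expR (- z ^+ 2 / 2).
Proof. by rewrite ler_wpM2l//; have := Phi_tail (normr_ge0 z); rewrite -normrX (ger0_norm (sqr_ge0 z)). Qed.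

Lemma continuous_pval : continuous pval.
Proof.
move=> z; apply: cvgM; first exact: cvg_cst.
apply: (continuous_comp (f := fun x : R => - `|x|) (g := Phi)); last exact: continuous_Phi.
by apply: cvgN; exact: norm_continuous.
Qed.

Definition likratio a b p : R := 1 + a * f1 p + b * f2 p.

Lemma ln_lt2 p : 0 < p < 2 -> 0 < 2 - ln p.
Proof.
move=> /andP[p0 p2]; rewrite subr_gt0.
by apply: lt_trans (ln_sublinear p0) _.
Qed.

Lemma likratioE a b p :
  likratio a b p = (1 - a / 2 - 2 * b) + a * (p * (2 - ln p) ^+ 2)^-1 + b * (Num.sqrt p)^-1.
Proof. by rewrite /likratio /f1 /f2; ring. Qed.

Section antiderivatives.
Variables (a b : R).

Let F1 p := (1 - a / 2 - 2 * b) * p + a * (2 - ln p)^-1 + (2 * b) * Num.sqrt p.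

Let is_derive_F1 p : 0 < p < 2 -> is_derive p 1 F1 (likratio a b p).
Proof.
move=> p02; have p0 : 0 < p by case/andP: p02.
have l2 := ln_lt2 p02.
rewrite (_ : F1 = (1 - a / 2 - 2 * b) *: id + a *: (fun x => ((cst 2 - (@ln R) : R -> R) x)^-1) + (2 * b) *: (Num.sqrt : R -> R)); last by apply/funext.
have h0 : is_derive p 1 (cst 2 - (@ln R) : R -> R) (0 - p^-1).
  by apply: is_deriveB; exact: is_derive1_ln.
have h1 : (cst 2 - (@ln R) : R -> R) p != 0 by rewrite gt_eqF.
have H := is_deriveD (is_deriveD (is_deriveZ (1 - a / 2 - 2 * b) (is_derive_id p 1))
  (is_deriveZ a (is_deriveV h1 h0))) (is_deriveZ (2 * b) (is_derive1_sqrt p0)).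
apply: (is_derive_eq H).
rewrite likratioE /GRing.scale /= !fctE.
have s0 : Num.sqrt p != 0 by rewrite gt_eqF// sqrtr_gt0.
by field; rewrite s0 !gt_eqF.
Qed.

Let cvg_F1 : F1 p @[p --> 0^'+] --> 0.
Proof.
rewrite -[X in _ --> X]addr0 -[X in _ --> X + _]addr0.
apply: cvgD; first apply: cvgD.
- rewrite -[X in _ --> X](mulr0 (1 - a / 2 - 2 * b)).
  by apply: cvgM; [exact: cvg_cst|apply: cvg_at_right_filter; exact: cvg_id].
- rewrite -[X in _ --> X](mulr0 a); apply: cvgM; first exact: cvg_cst.
  apply/gtr0_cvgV0.
    near=> p; apply: ln_lt2; apply/andP; split; first by near: p; exact: nbhs_right_gt.
    by near: p; apply: nbhs_right_lt.
  apply/cvgryPge => A; near=> p; rewrite lerBrDl -lerBrDr.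
  by near: p; have /cvgrNyPle/(_ (2 - A)) := @lnNy R.
- rewrite -[X in _ --> X](mulr0 (2 * b)); apply: cvgM; first exact: cvg_cst.
  rewrite -[X in _ --> X]sqrtr0; apply: cvg_at_right_filter; exact: sqrt_continuous.
Unshelve. all: by end_near. Qed.

Lemma continuous_likratio p : 0 < p < 2 -> {for p, continuous (likratio a b)}.
Proof.
move=> p02; have p0 : 0 < p by case/andP: p02.
have -> : likratio a b = (fun p => (1 - a / 2 - 2 * b) + a * (p * (2 - ln p) ^+ 2)^-1 + b * (Num.sqrt p)^-1).
  by apply/funext => x; rewrite likratioE.
apply: cvgD; first apply: cvgD; first exact: cvg_cst.
- apply: cvgM; first exact: cvg_cst.
  apply: cvgV; first by rewrite mulf_neq0 ?gt_eqF// exprn_gt0// ln_lt2.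
  apply: cvgM; first exact: cvg_id.
  apply: (continuous_comp (f := fun x : R => 2 - ln x) (g := fun x => x ^+ 2)); last exact: exprn_continuous.
  by apply: cvgB; [exact: cvg_cst|exact: continuous_ln].
- apply: cvgM; first exact: cvg_cst.
  by apply: cvgV; [rewrite gt_eqF// sqrtr_gt0|exact: sqrt_continuous].
Qed.

Hypotheses (a0 : 0 <= a) (b0 : 0 <= b) (ab1 : a / 2 + 2 * b <= 1).

Lemma likratio_ge p : 0 < p < 2 ->
  (1 - a / 2 - 2 * b) + b * (Num.sqrt p)^-1 <= likratio a b p.
Proof.
move=> p02; have p0 : 0 < p by case/andP: p02.
rewrite likratioE lerD2r lerDl mulr_ge0// invr_ge0 mulr_ge0 ?sqr_ge0//.
exact: ltW.
Qed.

Lemma likratio_ge0 p : 0 < p < 2 -> 0 <= likratio a b p.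
Proof.
move=> p02; apply: le_trans (likratio_ge p02).
by rewrite addr_ge0 ?mulr_ge0 ?invr_ge0 ?sqrtr_ge0//; move: ab1; lra.
Qed.

(** Both $f_1$ and $f_2$ have mean $0$ under the uniform law, so that the exponential of a score
    has mean exactly $1$ when there is no signal. *)
Lemma integral_likratio :
  (\int[mu]_z (likratio a b (pval z) * normal_pdf 0 1 z)%:E = 1)%E.
Proof.
rewrite (integral_pvalue likratio_ge0 continuous_likratio is_derive_F1 cvg_F1).
by congr EFin; rewrite /F1 ln1 sqrtr1; field.
Qed.
End antiderivatives.

Section reciprocal.
Variables (v b : R).
Hypotheses (v0 : 0 < v) (b0 : 0 < b).

Let g p := (v + b * (Num.sqrt p)^-1)^-1.
Let F p := v^-1 * p - (2 * b / v ^+ 2) * Num.sqrt p + (2 * b ^+ 2 / v ^+ 3) * ln (v * Num.sqrt p + b).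

Let l0 p : 0 < v * Num.sqrt p + b.
Proof. by rewrite ltr_wpDl// mulr_ge0 ?sqrtr_ge0// ltW. Qed.

Let is_derive_F p : 0 < p < 2 -> is_derive p 1 F (g p).
Proof.
move=> /andP[p0 _].
have s0 : 0 < Num.sqrt p by rewrite sqrtr_gt0.
pose k (x : R) : R := v * Num.sqrt x + b.
rewrite (_ : F = v^-1 *: id - (2 * b / v ^+ 2) *: (Num.sqrt : R -> R) +
  (2 * b ^+ 2 / v ^+ 3) *: ((@ln R) \o k)); last by apply/funext.
have ds := is_derive1_sqrt p0.
have dk : is_derive p 1 k _ := is_deriveD (is_deriveZ v ds) (is_derive_cst b p 1).
have dl : is_derive (k p) 1 (@ln R) (k p)^-1 := is_derive1_ln (l0 p).
have H := is_deriveD (is_deriveB (is_deriveZ v^-1 (is_derive_id p 1))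
  (is_deriveZ (2 * b / v ^+ 2) ds))
  (is_deriveZ (2 * b ^+ 2 / v ^+ 3) (is_derive1_comp dl dk)).
apply: (is_derive_eq H).
rewrite /GRing.scale /= /k /g addr0.
have := l0 p; move: s0 v0 => /gt_eqF s1 /gt_eqF v1 /gt_eqF l1.
by field; rewrite s1 v1 /= ?andbT -?[b + _]addrC ?l1.
Qed.

Let cvg_F : F p @[p --> 0^'+] --> (2 * b ^+ 2 / v ^+ 3) * ln b.
Proof.
have cs : Num.sqrt p @[p --> (0:R)^'+] --> (0 : R).
  rewrite -[X in _ --> X]sqrtr0; apply: cvg_at_right_filter; exact: sqrt_continuous.
rewrite -[X in _ --> X]add0r.
apply: cvgD.
  rewrite [X in _ --> X](_ : 0 = v^-1 * 0 - 2 * b / v ^+ 2 * 0); last by rewrite !mulr0 subr0.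
  apply: cvgB; apply: cvgM; [exact: cvg_cst| |exact: cvg_cst|exact: cs].
  by apply: cvg_at_right_filter; exact: cvg_id.
apply: cvgM; first exact: cvg_cst.
apply: (cvg_comp (fun p => v * Num.sqrt p + b) (@ln R)); last exact: continuous_ln.
suff : (v * Num.sqrt p + b) @[p --> (0:R)^'+] --> v * 0 + b by rewrite mulr0 add0r.
by apply: cvgD; [apply: cvgM => //; exact: cvg_cst|exact: cvg_cst].
Qed.

(** Without its $f_1$ term, the reciprocal of the likelihood ratio becomes rational under the
    substitution $r=\sqrt p$, hence the closed form. *)
Lemma integral_reciprocal :
  (\int[mu]_z (g (pval z) * normal_pdf 0 1 z)%:E =
   (v^-1 - 2 * b / v ^+ 2 + (2 * b ^+ 2 / v ^+ 3) * ln (1 + v / b))%:E)%E.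
Proof.
rewrite (integral_pvalue _ _ is_derive_F cvg_F).
- congr EFin; rewrite /F sqrtr1 !mulr1.
  rewrite (_ : 1 + v / b = (v + b) / b) ?ln_div ?posrE//; [|exact: addr_gt0|by field; rewrite gt_eqF].
  by ring.
- move=> p /andP[p0 _]; rewrite invr_ge0 addr_ge0 ?mulr_ge0 ?invr_ge0 ?sqrtr_ge0// ltW//.
- move=> p /andP[p0 _].
  apply: cvgV; first by rewrite gt_eqF// addr_gt0// mulr_gt0// invr_gt0 sqrtr_gt0.
  apply: cvgD; first exact: cvg_cst.
  apply: cvgM; first exact: cvg_cst.
  by apply: cvgV; [rewrite gt_eqF// sqrtr_gt0|exact: sqrt_continuous].
Qed.
End reciprocal.

End pvalue_integrals.

(** * Integrals of even functions against a shifted normal law *)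

Section shifted_normal.
Context {R : realType}.
Local Notation mu := (@lebesgue_measure R).
Implicit Types (m x y z : R) (g : R -> R).

Lemma measurable_mul_normal_pdf g m : measurable_fun setT g ->
  measurable_fun setT (fun x : measurableTypeR R => (g x * normal_pdf m 1 x)%:E).
Proof.
by move=> mg; apply/measurable_EFinP/measurable_funM => //; exact: measurable_normal_pdf.
Qed.

Lemma integral_normal_reflect g m : measurable_fun setT g -> (forall x, 0 <= g x) ->
  (forall x, g (- x) = g x) ->
  (\int[mu]_x (g x * normal_pdf m 1 x)%:E = \int[mu]_x (g x * normal_pdf (- m) 1 x)%:E)%E.
Proof.
move=> mg g0 ge; have N0 : -1 != 0 :> R by rewrite oppr_eq0 oner_eq0.
apply: etrans (ge0_integral_affine 0 N0 _ _) _.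
- exact: measurable_mul_normal_pdf.
- by move=> x; rewrite lee_fin mulr_ge0 ?normal_pdf_ge0.
rewrite normrN1 mul1e; apply: eq_integral => x _.
by rewrite addr0 mulN1r ge normal_pdfN.
Qed.

Lemma normal_pdf_shift m x :
  normal_pdf m 1 x = normal_pdf 0 1 x * expR (m * x - m ^+ 2 / 2) :> R.
Proof.
rewrite !normal_pdfE ?oner_eq0// -mulrA; congr (_ * _).
by rewrite /normal_fun -expRD; congr expR; field.
Qed.

Lemma ler_normal_pdf m x y : (y - m) ^+ 2 <= (x - m) ^+ 2 ->
  normal_pdf m 1 x <= normal_pdf m 1 y :> R.
Proof.
move=> xy; rewrite !normal_pdfE ?oner_eq0// ler_wpM2l ?normal_peak_ge0//.
by rewrite ler_expR; nra.
Qed.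

(** Chebyshev's association inequality: after averaging over the signs of $m$, the density ratio
    of $N(\pm m,1)$ to $N(0,1)$ is $e^{-m^2/2}\cosh(mx)$, which grows with $|x|$, while $g$
    decreases with $|x|$. *)
Lemma normal_shift_le g m : measurable_fun setT g -> (forall x, 0 <= g x) ->
  (forall x y, `|x| <= `|y| -> g y <= g x) ->
  (\int[mu]_x (g x * normal_pdf m 1 x)%:E <= \int[mu]_x (g x * normal_pdf 0 1 x)%:E)%E.
Proof.
move=> mg g0 gd.
have ge x : g (- x) = g x by apply/eqP; rewrite eq_le !gd// normrN.
pose w x := 2^-1 * (normal_pdf m 1 x + normal_pdf (- m) 1 x).
have w0 x : 0 <= w x by rewrite mulr_ge0// addr_ge0 ?normal_pdf_ge0.
have mw : measurable_fun setT (fun x : measurableTypeR R => w x).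
  apply: measurable_funM => //; apply: measurable_funD; exact: measurable_normal_pdf.
have int_w (f : R -> R) : measurable_fun setT f -> (forall x, 0 <= f x) -> (forall x, f (- x) = f x) ->
    (\int[mu]_x (f x * w x)%:E = \int[mu]_x (f x * normal_pdf m 1 x)%:E)%E.
  move=> mf f0 fe.
  transitivity ((2^-1)%:E * \int[mu]_x ((f x * normal_pdf m 1 x)%:E + (f x * normal_pdf (- m) 1 x)%:E))%E.
    rewrite -ge0_integralZl//=.
    - by apply: eq_integral => x _; rewrite -EFinD -EFinM; congr EFin; rewrite /w; ring.
    - by apply: emeasurable_funD; exact: measurable_mul_normal_pdf.
    - by move=> x _; rewrite -EFinD lee_fin addr_ge0// mulr_ge0 ?normal_pdf_ge0.
  rewrite ge0_integralD//=; first last.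
  - exact: measurable_mul_normal_pdf.
  - by move=> x _; rewrite lee_fin mulr_ge0 ?normal_pdf_ge0.
  - exact: measurable_mul_normal_pdf.
  - by move=> x _; rewrite lee_fin mulr_ge0 ?normal_pdf_ge0.
  rewrite -(integral_normal_reflect m mf f0 fe) -mule2n -mule_natl muleA -EFinM mulVf// mul1e//.
pose S := [set x : R | normal_pdf 0 1 x <= w x].
have wE x : w x = normal_pdf 0 1 x * (2^-1 * expR (- m ^+ 2 / 2) * (expR (m * x) + expR (- (m * x)))).
  rewrite /w !(normal_pdf_shift m) !(normal_pdf_shift (- m)) -mulrDr mulrCA.
  congr (_ * _); rewrite -mulrA; congr (_ * _); rewrite mulrDr -!expRD.
  by congr (expR _ + expR _); field.
have chE x : expR (m * x) + expR (- (m * x)) = expR `|m * x| + expR (- `|m * x|).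
  by case: (ger0P (m * x)) => // _; rewrite opprK addrC.
have S_up x y : `|x| <= `|y| -> S x -> S y.
  have SE t : S t <-> 1 <= 2^-1 * expR (- m ^+ 2 / 2) * (expR `|m * t| + expR (- `|m * t|)).
    by rewrite /S /= wE chE -[leLHS]mulr1 ler_pM2l ?normal_pdf_gt0.
  move=> xy; rewrite !SE => h; apply: le_trans h _.
  rewrite ler_wpM2l ?mulr_ge0 ?expR_ge0// !expRN.
  have : expR `|m * x| <= expR `|m * y| by rewrite ler_expR !normrM ler_wpM2l.
  have : 1 <= expR `|m * x| by rewrite -expR0 ler_expR.
  set s := expR _; set t := expR `|m * y| => s1 st.
  have s0 : 0 < s by lra.
  have t0 : 0 < t by lra.
  rewrite -subr_ge0 (_ : _ - _ = (t - s) * (s * t - 1) / (s * t)); last by field; rewrite !gt_eqF.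
  by rewrite divr_ge0 ?mulr_ge0 ?subr_ge0//; nra.
(* On $S$, where $w\ge\varphi$, the function $g$ is at most $c$, and outside of $S$ it is at
   least $c$: hence $(g-c)(w-\varphi)\le0$, and both densities integrate $c$ to $c$. *)
pose c := sup [set g x | x in S].
have ub : has_ubound [set g x | x in S].
  by exists (g 0) => _ [x _ <-]; apply: gd; rewrite normr0.
have c0 : 0 <= c.
  have [E|/set0P[_ [x Sx _]]] := eqVneq [set g x | x in S] set0; first by rewrite /c E sup0.
  by apply: le_trans (g0 x) _; apply: ub_le_sup => //; exists x.
have key x : g x * w x + c * normal_pdf 0 1 x <= g x * normal_pdf 0 1 x + c * w x.
  have [Sx|Sx] := leP (normal_pdf 0 1 x) (w x).
    have : g x <= c by apply: ub_le_sup => //; exists x.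
    by nra.
  have : c <= g x.
    have [E|/set0P ne] := eqVneq [set g x | x in S] set0; first by rewrite /c E sup0.
    apply: ge_sup => // _ [y Sy <-]; apply: gd.
    by rewrite leNgt; apply/negP => /ltW yx; have := S_up _ _ yx Sy; rewrite /S /= leNgt Sx.
  by nra.
have intc (d : R -> R) : (\int[mu]_x (1 * d x)%:E = 1)%E -> (forall x, 0 <= d x) ->
    measurable_fun setT (fun x : measurableTypeR R => d x) ->
    (\int[mu]_x (c * d x)%:E = c%:E)%E.
  move=> d1 d0 md; rewrite -[RHS]mule1 -d1 -ge0_integralZl//=.
  - by apply: eq_integral => x _; rewrite -EFinM mul1r.
  - by apply/measurable_EFinP; apply: measurable_funM.
  - by move=> x _; rewrite lee_fin mul1r.
have int1 k : (\int[mu]_x (1 * normal_pdf k 1 x)%:E = 1)%E.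
  by under eq_integral do rewrite mul1r; exact: integral_normal_pdf.
have mphi k : measurable_fun setT (fun x : measurableTypeR R => normal_pdf k 1 x).
  exact: measurable_normal_pdf.
have sum (d e : R -> R) : (forall x, 0 <= d x) -> (forall x, 0 <= e x) ->
    measurable_fun setT (fun x : measurableTypeR R => d x) ->
    measurable_fun setT (fun x : measurableTypeR R => e x) ->
    (\int[mu]_x (g x * d x + c * e x)%:E = \int[mu]_x (g x * d x)%:E + \int[mu]_x (c * e x)%:E)%E.
  move=> d0 e0 md me; under eq_integral do rewrite EFinD.
  rewrite ge0_integralD//=.
  - by move=> x _; rewrite lee_fin mulr_ge0.
  - by apply/measurable_EFinP; apply: measurable_funM.
  - by move=> x _; rewrite lee_fin mulr_ge0.
  - by apply/measurable_EFinP; apply: measurable_funM.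
have pdf0 k x : 0 <= normal_pdf k 1 x := normal_pdf_ge0 k 1 x.
have : (\int[mu]_x (g x * w x)%:E + c%:E <= \int[mu]_x (g x * normal_pdf 0 1 x)%:E + c%:E)%E.
  rewrite -[in leLHS](intc (normal_pdf 0 1))// -[in leRHS](intc w)//; last first.
    by rewrite (int_w (cst 1)).
  rewrite -!sum//; apply: ge0_le_integral => //=.
  - by move=> x _; rewrite lee_fin addr_ge0// mulr_ge0.
  - by apply/measurable_EFinP; apply: measurable_funD; apply: measurable_funM.
  - by apply/measurable_EFinP; apply: measurable_funD; apply: measurable_funM.
  - by move=> x _; rewrite lee_fin.
by rewrite leeD2rE// (int_w g mg g0 ge).
Qed.

(** Some interval of length $1$ beyond $z$ has mass at least $\varphi(z-m_0+1)$ under $N(m,1)$,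
    and there $g$ gains $A-B$ over its bound $A$. *)
Lemma normal_shift_tail_gain g m m0 z A B : measurable_fun setT g -> (forall x, 0 <= g x) ->
  (forall x, g (- x) = g x) -> (forall x, g x <= A) -> (forall x, z <= `|x| -> g x <= B) ->
  B <= A -> 0 <= m0 <= z -> m0 <= `|m| ->
  (\int[mu]_x (g x * normal_pdf m 1 x)%:E <= (A - (A - B) * normal_pdf 0 1 (z - m0 + 1))%:E)%E.
Proof.
move=> mg g0 ge gA gB BA /andP[m00 m0z].
wlog m_ge0 : m / 0 <= m.
  move=> H mm; have [/H|/ltW m_le0] := leP 0 m; first exact.
  by rewrite integral_normal_reflect//; apply: H; rewrite ?oppr_ge0// normrN.
rewrite ger0_norm// => m0m.
set q := normal_pdf 0 1 _.
(* For $m>z$ the interval has to start at $m$: the density at $z$ may be negligible. *)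
pose y := Num.max z m.
pose I := `[y, y + 1]%classic : set (measurableTypeR R).
have mI : measurable I by exact: measurable_itv.
have y0 : 0 <= y by rewrite le_max (le_trans m00 m0z).
have key x : g x * normal_pdf m 1 x + (A - B) * (q * \1_I x) <= A * normal_pdf m 1 x.
  have p0 := normal_pdf_ge0 m 1 x.
  rewrite indicE; case: (boolP (x \in I)) => [|_]; last first.
    by rewrite !mulr0 addr0; have := gA x; nra.
  rewrite inE /I /= in_itv /= => /andP[yx xy].
  have zx : z <= `|x|.
    by rewrite ger0_norm; [apply: le_trans yx; rewrite le_max lexx|exact: le_trans yx].
  have mx : m <= x by apply: le_trans yx; rewrite le_max lexx orbT.
  have := gB x zx.
  have : q <= normal_pdf m 1 x.
    rewrite normal_pdf_center ?oner_eq0//; apply: ler_normal_pdf; rewrite !subr0.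
    rewrite ler_sqr ?nnegrE; [|lra..].
    move: xy; rewrite /y maxEle; case: ifP => [zm|_]; lra.
  by rewrite mulr1; nra.
have A0 : 0 <= A by apply: le_trans (g0 0) (gA 0).
have q0 : 0 <= q := normal_pdf_ge0 _ _ _.
have lI : (\int[mu]_x ((A - B) * (q * \1_I x))%:E = ((A - B) * q)%:E)%E.
  under eq_integral do rewrite mulrA EFinM.
  rewrite ge0_integralZl//=; last first.
  - by rewrite lee_fin mulr_ge0// subr_ge0.
  - exact/measurable_EFinP.
  have I1 : (mu I = 1)%E.
    apply: etrans (lebesgue_measure_itv _) _; rewrite /= lte_fin ltrDl ltr01.
    by rewrite -EFinD addrAC subrr add0r.
  rewrite [X in (_ * X)%E](_ : _ = 1%E) ?mule1//.
  by apply: etrans (integral_indic _ _ _) _ => //; rewrite setIT; exact: I1.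
have iA : (\int[mu]_x (A * normal_pdf m 1 x)%:E = A%:E)%E.
  under eq_integral do rewrite EFinM.
  rewrite ge0_integralZl//=; first by rewrite integral_normal_pdf mule1.
  - exact: measurable_EFin_normal_pdf.
  - by move=> x _; rewrite lee_fin normal_pdf_ge0.
rewrite EFinB leeBrDr// -iA -lI -ge0_integralD//=.
- apply: ge0_le_integral => //=.
  + by move=> x _; rewrite -EFinD lee_fin addr_ge0// mulr_ge0 ?normal_pdf_ge0 ?subr_ge0// mulr_ge0.
  + apply: emeasurable_funD; first exact: measurable_mul_normal_pdf.
    by apply/measurable_EFinP/measurable_funM => //; apply: measurable_funM => //.
  + by apply/measurable_EFinP/measurable_funM => //; exact: measurable_normal_pdf.
  + by move=> x _; rewrite -EFinD lee_fin.
- by move=> x _; rewrite lee_fin mulr_ge0 ?normal_pdf_ge0.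
- exact: measurable_mul_normal_pdf.
- by move=> x _; rewrite lee_fin mulr_ge0 ?subr_ge0// mulr_ge0.
- by apply/measurable_EFinP/measurable_funM => //; apply: measurable_funM => //.
Qed.

(** For $x\le y\le m$ the density of $N(m,1)$ is at most $e^{-(m-y)^2/2}$ times that of
    $N(y,1)$. *)
Lemma normal_shift_tail_split g m m0 y A B : measurable_fun setT g -> (forall x, 0 <= g x) ->
  (forall x, g (- x) = g x) -> (forall x, g x <= A) -> (forall x, y <= `|x| -> g x <= B) ->
  0 <= B -> 0 <= y <= m0 -> m0 <= `|m| ->
  (\int[mu]_x (g x * normal_pdf m 1 x)%:E <= (B + A * expR (- (m0 - y) ^+ 2 / 2))%:E)%E.
Proof.
move=> mg g0 ge gA gB B0 /andP[y0 ym0].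
wlog m_ge0 : m / 0 <= m.
  move=> H mm; have [/H|/ltW m_le0] := leP 0 m; first exact.
  by rewrite integral_normal_reflect//; apply: H; rewrite ?oppr_ge0// normrN.
rewrite ger0_norm// => m0m.
set e := expR _; have e0 : 0 <= e := expR_ge0 _.
have A0 : 0 <= A by apply: le_trans (g0 0) (gA 0).
have key x : g x * normal_pdf m 1 x <= B * normal_pdf m 1 x + (A * e) * normal_pdf y 1 x.
  have p0 := normal_pdf_ge0 m 1 x; have p1 := normal_pdf_ge0 y 1 x.
  have [/gB|] := leP y `|x|; first by have := mulr_ge0 (mulr_ge0 A0 e0) p1; nra.
  rewrite ltr_norml => /andP[_ xy].
  have : normal_pdf m 1 x <= e * normal_pdf y 1 x.
    rewrite !normal_pdfE ?oner_eq0// mulrCA ler_wpM2l ?normal_peak_ge0// /normal_fun -expRD ler_expR.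
    by nra.
  have := mulr_ge0 e0 p1; have := gA x; have := g0 x; have := mulr_ge0 B0 p0; nra.
have iA k C : 0 <= C -> (\int[mu]_x (C * normal_pdf k 1 x)%:E = C%:E)%E.
  move=> C0; under eq_integral do rewrite EFinM.
  rewrite ge0_integralZl//=; first by rewrite integral_normal_pdf mule1.
  - exact: measurable_EFin_normal_pdf.
  - by move=> x _; rewrite lee_fin normal_pdf_ge0.
have mC k C : measurable_fun setT (fun x : measurableTypeR R => (C * normal_pdf k 1 x)%:E).
  by apply/measurable_EFinP/measurable_funM => //; exact: measurable_normal_pdf.
rewrite EFinD -(iA m B)// -(iA y (A * e)) ?mulr_ge0// -ge0_integralD//=.
- apply: ge0_le_integral => //=.
  + by move=> x _; rewrite lee_fin mulr_ge0 ?normal_pdf_ge0.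
  + exact: measurable_mul_normal_pdf.
  + by apply: emeasurable_funD; exact: mC.
  + by move=> x _; rewrite -EFinD lee_fin.
- by move=> x _; rewrite lee_fin mulr_ge0 ?normal_pdf_ge0.
- by move=> x _; rewrite lee_fin !mulr_ge0 ?normal_pdf_ge0.
Qed.

End shifted_normal.

(** * Functions of disjoint blocks of independent variables *)

Section independence.
Context {R : realType} {disp : measure_display} {Om : measurableType disp}.
Variable P : probability Om R.
Local Notation RT := (measurableTypeR R).

Lemma finite_measure_unique_rectangles d1 d2 (T1 : measurableType d1) (T2 : measurableType d2)
    (m1 m2 : {measure set (T1 * T2) -> \bar R}) :
  (m1 setT < +oo)%E ->
  (forall A B, measurable A -> measurable B -> m1 (A `*` B) = m2 (A `*` B)) ->
  forall X, measurable X -> m1 X = m2 X.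
Proof.
move=> m1T m12 X mX.
pose C := [set A `*` B | A in measurable & B in measurable] : set (set (T1 * T2)).
apply: (measure_unique C (fun=> setT)) => //.
- by rewrite /C -measurable_prod_measurableType.
- move=> _ _ [A1 mA1 [B1 mB1 <-]] [A2 mA2 [B2 mB2 <-]]; rewrite -setXI.
  by exists (A1 `&` A2); [exact: measurableI|exists (B1 `&` B2) => //; exact: measurableI].
- by move=> _; exists setT => //; exists setT => //; rewrite setXTT.
- by apply/seteqP; split => // x _; exists 0%N.
- by move=> _ [A mA [B mB <-]]; exact: m12.
Qed.

Section fold.
Variables (I : finType) (Y : I -> {mfun Om >-> RT}) (f : I -> R -> R -> R) (c0 : R).
Hypothesis mf : forall i, measurable_fun setT (fun z : RT * RT => f i z.1 z.2 : RT).
Hypothesis indepY : mutually_independent P Y.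

Definition cyl (J : {set I}) (A : I -> set RT) : set Om :=
  \bigcap_(i in [set i | i \in J]) (Y i @^-1` A i).

(** One fold covers both uses of independence: the linear forms that make up a window statistic
    and the products of exponentials of scores. *)
Definition foldv (s : seq I) (w : Om) : RT := foldr (fun i y => f i (Y i w) y) c0 s.

Lemma measurable_foldv s : measurable_fun setT (foldv s).
Proof.
elim: s => [|i s IH]; first exact: measurable_cst.
rewrite (_ : foldv (i :: s) = (fun z : RT * RT => f i z.1 z.2 : RT) \o (fun w => (Y i w, foldv s w)))//.
by apply: measurableT_comp => //; exact: measurable_fun_pair.
Qed.

Lemma measurable_cyl (J : {set I}) (A : I -> set RT) : (forall i, measurable (A i)) -> measurable (cyl J A).
Proof.
move=> mA; apply: fin_bigcap_measurable => [|i _]; first exact: finite_finpred.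
by rewrite -[X in measurable X]setTI; exact: measurable_funP.
Qed.

(** Only the independence of $B$ from the cylinders over $D$ is carried along, which determines
    it for every measurable function of $(Y_i)_{i\in D}$. *)
Definition indep_event (D : {set I}) (B : set Om) :=
  measurable B /\ forall (J : {set I}) (A : I -> set RT), J \subset D -> (forall i, measurable (A i)) ->
    P (B `&` cyl J A) = (P B * \prod_(i in J) P (Y i @^-1` A i))%E.

Lemma indep_eventT : indep_event [set: I]%SET setT.
Proof.
by split => // J A _ mA; rewrite setTI probability_setT mul1e indepY.
Qed.

Lemma cylU1 (J : {set I}) A i (A1 : set RT) : i \notin J ->
  Y i @^-1` A1 `&` cyl J A = cyl (i |: J) (fun k => if k == i then A1 else A k).
Proof.
move=> iJ; apply/seteqP; split => [w [Yi cJ] k /=|w c].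
  by rewrite !inE; case: eqP => [->//|_] /= kJ; exact: cJ.
split; first by have := c i; rewrite /= setU11 eqxx; exact.
move=> k /= kJ; have := c k; rewrite /= in_setU1 kJ orbT (_ : k == i = false); first exact.
by apply: contraNF iJ => /eqP <-.
Qed.

(** By induction, the law of $(Y_i,\mathrm{fold}(s))$ restricted to an event of the given form is
    on rectangles, hence everywhere, a multiple of the unrestricted law; in particular on the
    event that $f_i$ maps this pair into $C$. *)
Lemma foldv_indep (D : {set I}) (B : set Om) (s : seq I) (J : {set I}) (A : I -> set RT)
    (C : set RT) : indep_event D B -> uniq s -> {subset s <= D} ->
  J \subset D -> (forall i, i \in s -> i \notin J) -> (forall i, measurable (A i)) -> measurable C ->
  P (B `&` (foldv s @^-1` C `&` cyl J A)) =
  (P B * P (foldv s @^-1` C) * \prod_(i in J) P (Y i @^-1` A i))%E.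
Proof.
elim: s D B J A C => [|i s IH] D B J A C [mB DB] us sD JD sJ mA mC.
  have [cC|cC] := pselect (C c0).
    rewrite (_ : foldv [::] @^-1` C = setT); last by apply/seteqP; split.
    by rewrite setTI probability_setT mule1 DB.
  rewrite (_ : foldv [::] @^-1` C = set0); last by apply/seteqP; split.
  by rewrite set0I setI0 measure0 mule0 mul0e.
move: us => /= /andP[nis us].
have iJ : i \notin J by apply: sJ; rewrite mem_head.
have mcyl := measurable_cyl J mA.
have mBJ : measurable (B `&` cyl J A) by exact: measurableI.
pose pr w := (Y i w, foldv s w).
have mpr : measurable_fun setT pr by apply: measurable_fun_pair => //; exact: measurable_foldv.
pose k := fine (P B * \prod_(i in J) P (Y i @^-1` A i))%E.
have kE : k%:E = P (B `&` cyl J A).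
  by rewrite /k -DB// fineK// fin_num_measure.
have k0 : 0 <= k by rewrite -lee_fin kE.
pose m1 := (pushforward (mrestr P mBJ) pr : {measure set (RT * RT)%type -> \bar R}).
pose m2 := mscale (NngNum k0) (pushforward P pr).
have m12 : forall E, measurable E -> m1 mpr E = m2 mpr E.
  apply: finite_measure_unique_rectangles.
    change (P (pr @^-1` setT `&` (B `&` cyl J A)) < +oo)%E.
    by rewrite -ge0_fin_numE// fin_num_measure//; apply: measurableI => //; rewrite preimage_setT.
  move=> A1 A2 mA1 mA2.
  change (P (pr @^-1` (A1 `*` A2) `&` (B `&` cyl J A)) = k%:E * P (pr @^-1` (A1 `*` A2)))%E.
  have sub j : j \in s -> j \notin (i |: J).
    move=> js; rewrite in_setU1 negb_or sJ ?in_cons ?js ?orbT// andbT.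
    by apply: contraNneq nis => <-.
  have mA' j : measurable (if j == i then A1 else A j) by case: ifP.
  have -> : pr @^-1` (A1 `*` A2) `&` (B `&` cyl J A) =
      B `&` (foldv s @^-1` A2 `&` (Y i @^-1` A1 `&` cyl J A)).
    by rewrite (_ : pr @^-1` (A1 `*` A2) = Y i @^-1` A1 `&` foldv s @^-1` A2)//; rewrite !setIA; congr (_ `&` _); rewrite setIC setIA -setIA [X in _ `&` X]setIC setIA.
  rewrite cylU1// (IH D)//; first last.
  - by rewrite finset.subUset finset.sub1set JD sD ?mem_head.
  - by move=> j js; apply: sD; rewrite in_cons js orbT.
  have -> : pr @^-1` (A1 `*` A2) = setT `&` (foldv s @^-1` A2 `&` (Y i @^-1` A1 `&` cyl finset.set0 A)).
    rewrite setTI /cyl (_ : [set j | j \in finset.set0] = set0); last by apply/seteqP; split => j //=; rewrite inE.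
    by rewrite bigcap_set0 setIT setIC.
  rewrite cylU1 ?finset.in_set0// (IH [set: I]%SET)//; first last.
  - by move=> j js; rewrite finset.setU0 inE; apply: contraNneq nis => <-.
  - by move=> j _; rewrite inE.
- exact: indep_eventT.
  rewrite finset.setU0 big_set1 eqxx big_setU1//= eqxx probability_setT mul1e kE DB//.
  rewrite (eq_bigr (fun j => P (Y j @^-1` A j))); last first.
    by move=> j jJ; case: eqP => // ji; rewrite -ji jJ in iJ.
  by rewrite [RHS]muleACA; congr (_ * _)%E; exact: muleC.
have mE : measurable [set z : RT * RT | C (f i z.1 z.2)].
  by rewrite -[X in measurable X]setTI; exact: mf.
have E : (P (foldv (i :: s) @^-1` C `&` (B `&` cyl J A)) = k%:E * P (foldv (i :: s) @^-1` C))%E := m12 _ mE.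
by rewrite setICA E kE DB// muleAC.
Qed.

Lemma indep_event_foldv (D : {set I}) (B : set Om) (s : seq I) (C : set RT) :
  indep_event D B -> uniq s -> {subset s <= D} -> measurable C ->
  indep_event [set i in D | i \notin s]%SET (B `&` foldv s @^-1` C) /\
  P (B `&` foldv s @^-1` C) = (P B * P (foldv s @^-1` C))%E.
Proof.
move=> iB us sD mC.
have mS : measurable (foldv s @^-1` C) by rewrite -[X in measurable X]setTI; exact: measurable_foldv.
have PB : P (B `&` foldv s @^-1` C) = (P B * P (foldv s @^-1` C))%E.
  have := @foldv_indep D B s finset.set0 (fun=> setT) C iB us sD (finset.sub0set _) _ _ mC.
  rewrite big_set0 mule1 => <- //.
    rewrite /cyl (_ : [set j | j \in finset.set0] = set0) ?bigcap_set0 ?setIT//.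
    by apply/seteqP; split => j //=; rewrite inE.
  by move=> i _; rewrite inE.
split => //; split; first by apply: measurableI => //; case: iB.
move=> J A JD mA; rewrite PB -setIA (@foldv_indep D)//.
- by apply: (fintype.subset_trans JD); apply/fintype.subsetP => i; rewrite inE => /andP[].
- by move=> i si; apply: contraTN si => /(fintype.subsetP JD); rewrite inE => /andP[].
Qed.

Lemma indep_foldv_cons i s (A C : set RT) : i \notin s -> uniq s -> measurable A -> measurable C ->
  P (Y i @^-1` A `&` foldv s @^-1` C) = (P (Y i @^-1` A) * P (foldv s @^-1` C))%E.
Proof.
move=> nis us mA mC.
have := @foldv_indep [set: I]%SET setT s [set i]%SET (fun=> A) C indep_eventT us _ _ _ _ mC.
rewrite probability_setT mul1e big_set1 setTI muleC [X in P X]setIC => <- //.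
- congr (P _); congr (_ `&` _); apply/seteqP; split => [w Aw j /=|w]; first by rewrite inE => /eqP ->.
  by apply; rewrite /= inE.
- by move=> j _; rewrite inE.
- by move=> j js; rewrite inE; apply: contraNneq nis => <-.
Qed.

End fold.

Section pair.
Variables U V : {mfun Om >-> RT}.
Hypothesis UV : forall A C : set RT, measurable A -> measurable C ->
  P (U @^-1` A `&` V @^-1` C) = (P (U @^-1` A) * P (V @^-1` C))%E.

Let pr w := (U w, V w).

Let mpr : measurable_fun setT pr.
Proof. exact: measurable_fun_pair. Qed.

Lemma indep_joint_law (E : set (RT * RT)) : measurable E ->
  (distribution P U \x distribution P V)%E E = P (pr @^-1` E).
Proof.
move=> mE.
pose m := (pushforward P pr : {measure set (RT * RT)%type -> \bar R}).
apply: (@product_measure_unique _ _ _ _ _ (distribution P U) (distribution P V) (m mpr)) => // A C mA mC.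
Qed.

Lemma ge0_expectation_indep (g : R -> \bar R) :
  measurable_fun setT g -> (forall x, 0 <= g x)%E -> (forall w, 0 <= V w) ->
  (\int[P]_w (g (U w) * (V w)%:E) = \int[P]_w g (U w) * \int[P]_w (V w)%:E)%E.
Proof.
move=> mg g0 V0.
pose V' (y : RT) : R := Num.max y 0.
have mV' : measurable_fun setT V'.
  by apply: measurable_maxr => //; exact: measurable_cst.
have VV' w : V' (V w) = V w by apply/max_idPl.
have V'0 y : 0 <= V' y by rewrite le_max lexx orbT.
pose k (z : RT * RT) := (g z.1 * (V' z.2)%:E)%E.
have mk : measurable_fun setT k.
  apply: emeasurable_funM; first exact: (measurableT_comp mg (measurable_fst)).
  apply/measurable_EFinP; exact: (measurableT_comp mV' (measurable_snd)).
have k0 z : (0 <= k z)%E by rewrite mule_ge0// lee_fin.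
have E1 : (\int[P]_w (g (U w) * (V w)%:E) = \int[distribution P U \x distribution P V]_z k z)%E.
  under eq_integral do rewrite -VV'.
  pose m := (pushforward P pr : {measure set (RT * RT)%type -> \bar R}).
  rewrite (eq_measure_integral (m mpr)); last by move=> A mA _; exact: indep_joint_law.
  by rewrite /m ge0_integral_pushforward.
rewrite E1 fubini_tonelli1// /fubini_F /k /=.
under eq_integral => x _.
  rewrite ge0_integralZl//=; first over.
  - exact/measurable_EFinP.
  - by move=> y _; rewrite lee_fin.
rewrite ge0_integralZr//=.
- congr (_ * _)%E.
    by rewrite ge0_integral_distribution.
  rewrite ge0_integral_distribution//=; first by apply: eq_integral => w _; rewrite VV'.
  exact/measurable_EFinP.
- by apply: integral_ge0 => y _; rewrite lee_fin.
Qed.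
End pair.

(** The events of the blocks already treated form an event that stays independent of all
    variables outside of these blocks, which is what the induction needs. *)
Lemma mutually_independent_foldv_rows (I : finType) (Y : I -> {mfun Om >-> RT})
    (f : I -> R -> R -> R) (c0 : R) (K : finType) (s : K -> seq I) :
  (forall i, measurable_fun setT (fun z : RT * RT => f i z.1 z.2 : RT)) ->
  mutually_independent P Y ->
  (forall k, uniq (s k)) -> (forall k l i, k != l -> i \in s k -> i \notin s l) ->
  forall (J : {set K}) (A : K -> set RT), (forall k, measurable (A k)) ->
    P (\bigcap_(k in [set k | k \in J]) (foldv Y f c0 (s k) @^-1` A k)) =
    (\prod_(k in J) P (foldv Y f c0 (s k) @^-1` A k))%E.
Proof.
move=> mf iY us dis J A mA.
pose ev (r : seq K) := \bigcap_(k in [set` r]) (foldv Y f c0 (s k) @^-1` A k).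
have main (r : seq K) : uniq r ->
    indep_event Y [set i | all (fun k => i \notin s k) r]%SET (ev r) /\
    P (ev r) = (\prod_(k <- r) P (foldv Y f c0 (s k) @^-1` A k))%E.
  elim: r => [_|k r IH /= /andP[kr ur]].
    rewrite /ev big_nil set_nil bigcap_set0 probability_setT; split => //.
    rewrite (_ : [set i | _]%SET = [set: I]%SET); last by apply/setP => i; rewrite !inE.
    exact: indep_eventT.
  have [ir Pr] := IH ur.
  have sk : {subset s k <= [set i | all (fun k => i \notin s k) r]%SET}.
    move=> i ik; rewrite inE; apply/allP => l lr.
    by apply: dis ik; apply: contraNneq kr => ->.
  have [i1 P1] := indep_event_foldv c0 mf iY ir (us k) sk (mA k).
  have evE : ev (k :: r) = ev r `&` foldv Y f c0 (s k) @^-1` A k.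
    apply/seteqP; split => [w ew|w [ew kw] l /=].
      split => [l lr|]; apply: ew; rewrite /= in_cons ?eqxx//.
      by move: lr => /= ->; rewrite orbT.
    by rewrite in_cons => /orP[/eqP->//|]; exact: ew.
  split; last by rewrite evE P1 Pr big_cons muleC.
  rewrite evE (_ : [set i | _]%SET = [set i in [set i | all (fun k => i \notin s k) r]%SET | i \notin s k]%SET)//.
  by apply/setP => i; rewrite !inE /= andbC.
have [_] := main (enum J) (enum_uniq _).
rewrite big_enum => <-; congr (P _); rewrite /ev.
by apply/seteqP; split => w ew k /= kJ; apply: ew; rewrite /= mem_enum in kJ *.
Qed.
End independence.

(** * Linear statistics of the Gaussian rows *)

Section gaussian_rows.
Context {R : realType} {disp : measure_display} {Om : measurableType disp}.
Variable P : probability Om R.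
Local Notation RT := (measurableTypeR R).

Lemma expectation_prod_indep (I : finType) (Z : I -> {mfun Om >-> RT}) (g : I -> R -> R) (s : seq I) :
  mutually_independent P Z -> uniq s ->
  (forall i, measurable_fun setT (g i)) -> (forall i x, 0 <= g i x) ->
  (\int[P]_w (\prod_(i <- s) g i (Z i w))%:E = \prod_(i <- s) \int[P]_w (g i (Z i w))%:E)%E.
Proof.
move=> iZ us mg g0.
pose f i (x y : R) : R := g i x * y.
have mf i : measurable_fun setT (fun z : RT * RT => f i z.1 z.2 : RT).
  apply: measurable_funM; last exact: measurable_snd.
  exact: (measurableT_comp (mg i) (measurable_fst)).
have fE r w : foldv Z f 1 r w = \prod_(i <- r) g i (Z i w).
  by elim: r => [|i r IH]; rewrite ?big_nil// big_cons -IH.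
elim: s us => [_|i s IH /= /andP[nis us]].
  by rewrite big_nil; under eq_integral do rewrite big_nil; rewrite integral_cst//= probability_setT mule1.
rewrite big_cons -IH//.
have mS : measurable_fun setT (foldv Z f 1 s) by exact: measurable_foldv.
pose V : {mfun Om >-> RT} := HB.pack (foldv Z f 1 s) (isMeasurableFun.Build _ _ _ _ _ mS).
have := @ge0_expectation_indep _ _ _ P (Z i) V _ (fun x => (g i x)%:E) _ _ _.
have VE w : V w = \prod_(i <- s) g i (Z i w) by exact: fE.
under [in X in _ -> X]eq_integral do rewrite big_cons EFinM -VE.
under [in X in _ -> (_ = _ * X)%E]eq_integral do rewrite -VE.
apply.
- by move=> A C mA mC; exact: indep_foldv_cons.
- exact/measurable_EFinP.
- by move=> x; rewrite lee_fin.
- by move=> w; rewrite VE prodr_ge0.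
Qed.

Section linear.
Variables (I : finType) (Y : I -> {mfun Om >-> RT}) (a m : I -> R).
Hypothesis indepY : mutually_independent P Y.
Hypothesis lawY : forall i (A : set RT), measurable A -> distribution P (Y i) A = normal_prob (m i) 1 A.

Let f i (x y : R) : R := a i * x + y.

Let mf i : measurable_fun setT (fun z : RT * RT => f i z.1 z.2 : RT).
Proof.
apply: measurable_funD; last exact: measurable_snd.
by apply: measurable_funM => //; exact: measurable_fst.
Qed.

Lemma foldv_linear s w : foldv Y f 0 s w = \sum_(i <- s) a i * Y i w.
Proof. by elim: s => [|i s IH]; rewrite ?big_nil// big_cons -IH. Qed.

(** The alternative is needed because [normal_prob m 0] is not the point mass at $m$: a linear
    form without any weight has no normal law. *)
Lemma law_linear s : uniq s ->
  (forall i, i \in s -> a i = 0) \/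
  (0 < \sum_(i <- s) a i ^+ 2 /\ forall A, measurable A ->
    P (foldv Y f 0 s @^-1` A) =
    normal_prob (\sum_(i <- s) a i * m i) (Num.sqrt (\sum_(i <- s) a i ^+ 2)) A).
Proof.
elim: s => [_|i s IH /= /andP[nis us]]; first by left.
have mS : measurable_fun setT (foldv Y f 0 s) by exact: measurable_foldv.
have maff (w b : R) : measurable_fun setT (fun x : RT => w * x + b : RT) by apply: measurable_funD.
have step A : measurable A -> P (foldv Y f 0 (i :: s) @^-1` A) =
    (\int[normal_prob (m i) 1]_x P (foldv Y f 0 s @^-1` ((fun y => (a i * x + y)%R) @^-1` A)))%E.
  move=> mA.
  pose V : {mfun Om >-> RT} := HB.pack (foldv Y f 0 s) (isMeasurableFun.Build _ _ _ _ _ mS).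
  have mE : measurable [set z : RT * RT | A (f i z.1 z.2)].
    by rewrite -[X in measurable X]setTI; exact: mf.
  have indep : forall A C : set RT, measurable A -> measurable C ->
      P (Y i @^-1` A `&` V @^-1` C) = (P (Y i @^-1` A) * P (V @^-1` C))%E.
    by move=> B C mB mC; exact: indep_foldv_cons.
  apply: (etrans (esym (indep_joint_law indep mE))).
  rewrite /product_measure1 (eq_measure_integral (normal_prob (m i) 1)); last first.
    by move=> B mB _; exact: lawY.
  apply: eq_integral => x _ /=; congr (P _).
  by apply/seteqP; split => w; rewrite /xsection /= inE.
case: (IH us) => [a0|[s0 lawS]].
  have S0 : foldv Y f 0 s = cst 0.
    by apply/funext => w; rewrite foldv_linear big_seq big1// => j /a0 ->; rewrite mul0r.
  have [ai0|ai0] := eqVneq (a i) 0.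
    by left => j; rewrite in_cons => /orP[/eqP->//|/a0].
  have sum0 : \sum_(j <- s) a j ^+ 2 = 0.
    by rewrite big_seq big1// => j /a0 ->; rewrite expr0n.
  have sum1 : \sum_(j <- s) a j * m j = 0.
    by rewrite big_seq big1// => j /a0 ->; rewrite mul0r.
  right; rewrite !big_cons sum0 sum1 !addr0; split => [|A mA]; first by rewrite exprn_even_gt0.
  rewrite sqrtr_sqr -[`|a i|]mulr1 -[X in normal_prob X]addr0 -normal_prob_affine ?oner_eq0// -lawY; last first.
    by rewrite -[X in measurable X]setTI; exact: (maff (a i) 0).
  have -> : foldv Y f 0 (i :: s) = (fun w => a i * Y i w + 0).
    by apply/funext => w; change (f i (Y i w) (foldv Y f 0 s w) = a i * Y i w + 0); rewrite S0.
  by [].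
right; rewrite !big_cons; split => [|A mA]; first by rewrite ltr_wpDl ?sqr_ge0.
rewrite step//.
under eq_integral => x _.
  rewrite lawS; last first.
    rewrite -[X in measurable X]setTI; have -> : (fun y => a i * x + y) = (fun y : RT => 1 * y + a i * x : RT) by apply/funext => y; rewrite mul1r addrC.
    exact: (maff 1 (a i * x)).
  over.
have sg : Num.sqrt (\sum_(j <- s) a j ^+ 2) != 0 by rewrite gt_eqF// sqrtr_gt0.
have H := normal_prob_mix (m i) (a i) (\sum_(j <- s) a j * m j) sg mA.
rewrite (sqr_sqrtr (ltW s0)) in H.
rewrite [a i * m i + _]addrC [a i ^+ 2 + _]addrC -H.
apply: eq_integral => x _.
have := normal_prob_affine (\sum_(j <- s) a j * m j) (a i * x) sg (oner_neq0 R) mA.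
rewrite normr1 !mul1r => <-; congr (normal_prob _ _ _).
by apply/seteqP; split => y /=; rewrite mul1r addrC.
Qed.
End linear.

End gaussian_rows.

Section model.
Context {R : realType} {disp : measure_display} {Om : measurableType disp}.
Local Notation RT := (measurableTypeR R).
Local Notation mu := (@lebesgue_measure R).

(** For a linear statistic with unit weight vector, the values along the rows are independent
    with laws $N(\sum_t a_t\mu^n_t, 1)$, so that expectations of products over the rows become
    one-dimensional Gaussian integrals. *)
Lemma gaussian_model_expectation (N T : nat) (P : 'M[R]_(N, T) -> probability Om R)
    (X : 'I_N -> 'I_T -> {mfun Om >-> RT}) (m : 'M[R]_(N, T)) (a : 'I_T -> R)
    (g : 'I_N -> R -> R) :
  gaussian_model P X -> \sum_t a t ^+ 2 = 1 ->
  (forall n, measurable_fun setT (g n)) -> (forall n x, 0 <= g n x) ->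
  (\int[P m]_w (\prod_n g n (\sum_t a t * X n t w))%:E =
   \prod_n \int[mu]_x (g n x * normal_pdf (\sum_t a t * m n t) 1 x)%:E)%E.
Proof.
move=> /(_ m) [law ind] a1 mg g0.
pose I := ('I_N * 'I_T)%type.
pose Y (i : I) := X i.1 i.2.
pose f (i : I) (x y : R) : R := a i.2 * x + y.
pose s (n : 'I_N) := [seq (n, t) | t <- enum 'I_T].
have us n : uniq (s n) by rewrite map_inj_uniq ?enum_uniq// => t1 t2 [].
have mf i : measurable_fun setT (fun z : RT * RT => f i z.1 z.2 : RT).
  apply: measurable_funD; last exact: measurable_snd.
  by apply: measurable_funM => //; exact: measurable_fst.
have mS n : measurable_fun setT (foldv Y f 0 (s n)) by exact: measurable_foldv.
pose Z n : {mfun Om >-> RT} := HB.pack (foldv Y f 0 (s n)) (isMeasurableFun.Build _ _ _ _ _ (mS n)).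
have sumE (b : 'I_T -> R) n : \sum_(i <- s n) b i.2 = \sum_t b t.
  by rewrite big_map big_enum.
have ZE n w : Z n w = \sum_t a t * X n t w.
  by rewrite /Z /= (foldv_linear Y (fun i : I => a i.2)) big_map big_enum.
have indZ : mutually_independent (P m) Z.
  move=> J A mA; apply: (@mutually_independent_foldv_rows _ _ _ (P m) I Y f 0 'I_N s mf ind us _ J A mA).
  move=> k l i kl /mapP[t _ ->]; apply/negP => /mapP[t' _ [E _]].
  by rewrite E eqxx in kl.
have lawZ n A : measurable A -> distribution (P m) (Z n) A = normal_prob (\sum_t a t * m n t) 1 A.
  move=> mA.
  have lawY (i : I) (B : set RT) : measurable B -> distribution (P m) (Y i) B = normal_prob (m i.1 i.2) 1 B.
    by move=> mB; exact: law.
  have [a0|[_ /(_ A mA)]] := @law_linear _ _ _ (P m) I Y (fun i : I => a i.2) (fun i => m i.1 i.2) ind lawY (s n) (us n).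
    have /eqP := oner_neq0 R; rewrite -a1 big1// => t _.
    by rewrite (a0 (n, t)) ?expr0n// map_f// mem_enum.
  rewrite /distribution /pushforward (sumE (fun t => a t ^+ 2)) a1 sqrtr1 => ->.
  by rewrite big_map big_enum.
under eq_integral.
  move=> w _; rewrite (_ : \prod_n _ = \prod_(n <- enum 'I_N) g n (Z n w)); last first.
    by rewrite big_enum; apply: eq_bigr => n _; rewrite ZE.
  over.
rewrite (expectation_prod_indep indZ (enum_uniq _) mg g0) big_enum /=.
apply: eq_bigr => n _.
have mgE : measurable_fun setT (fun x : RT => (g n x)%:E : \bar R) by apply/measurable_EFinP; exact: mg.
have g0E x : (0 <= (g n x)%:E)%E by rewrite lee_fin.
have H := @ge0_integral_distribution _ _ _ _ _ (P m) (Z n) (fun x : RT => (g n x)%:E) mgE g0E.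
transitivity (\int[distribution (P m) (Z n)]_y (g n y)%:E)%E; first exact: esym H.
rewrite (eq_measure_integral (normal_prob (\sum_t a t * m n t) 1)); last by move=> A mA _; exact: lawZ.
by rewrite ge0_integral_normal_prob.
Qed.
End model.

(** * The window statistics and the change-points *)

Section zstat_linear.
Context {R : realType}.
Variables (N T : nat).
Implicit Types (x : 'M[R]_(N, T)) (n : 'I_N) (s t u : nat).

Lemma entry_ord x n (i : 'I_T) : entry x n i.+1 = x n i.
Proof. by rewrite /entry /= valK. Qed.

Lemma sum_entry x n s t : (t <= T)%N ->
  \sum_(s.+1 <= v < t.+1) entry x n v = \sum_(i < T) (s <= i < t)%N%:R * x n i.
Proof.
move=> tT; rewrite big_add1 /= big_geq_mkord (big_ord_widen_cond T (fun i => s <= i)%N (fun i => entry x n i.+1))//.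
rewrite big_mkcond; apply: eq_bigr => i _; rewrite entry_ord.
by case: (_ && _); rewrite ?mul1r ?mul0r.
Qed.

Definition zweight s t u (i : 'I_T) : R :=
  ((t <= i < u)%N%:R / (u - t)%:R - (s <= i < t)%N%:R / (t - s)%:R) /
  Num.sqrt ((u - t)%:R^-1 + (t - s)%:R^-1).

Lemma zstat_linear x n s t u : (s < t < u)%N -> (u <= T)%N ->
  zstat x n s t u = \sum_i zweight s t u i * x n i.
Proof.
move=> /andP[st tu] uT; have tT : (t <= T)%N := leq_trans (ltnW tu) uT.
rewrite /zstat /segment_mean !sum_entry// !mulr_suml -sumrB mulr_suml.
by apply: eq_bigr => i _; rewrite /zweight; ring.
Qed.

Lemma sum_zweight2 s t u : (s < t < u)%N -> (u <= T)%N ->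
  \sum_i zweight s t u i ^+ 2 = 1.
Proof.
move=> /andP[st tu] uT; have tT : (t <= T)%N := leq_trans (ltnW tu) uT.
have ut0 : (0 : R) < (u - t)%:R by rewrite ltr0n subn_gt0.
have ts0 : (0 : R) < (t - s)%:R by rewrite ltr0n subn_gt0.
have v0 : 0 < (u - t)%:R^-1 + (t - s)%:R^-1 :> R by rewrite addr_gt0 ?invr_gt0.
have cnt a b : (a <= b <= T)%N -> \sum_(i < T) (a <= i < b)%N%:R = (b - a)%:R :> R.
  move=> /andP[ab bT].
  rewrite -natr_sum; congr _%:R; rewrite -[RHS]muln1 -sum_nat_const_nat big_geq_mkord.
  rewrite (big_ord_widen_cond T (fun i => a <= i)%N (fun=> 1%N))// [RHS]big_mkcond.
  by apply: eq_bigr => i _; case: (_ && _).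
rewrite (eq_bigr (fun i : 'I_T => ((t <= i < u)%N%:R / (u - t)%:R ^+ 2 + (s <= i < t)%N%:R / (t - s)%:R ^+ 2) /
    ((u - t)%:R^-1 + (t - s)%:R^-1))); last first.
  move=> i _; rewrite /zweight expr_div_n sqr_sqrtr ?(ltW v0)//; congr (_ / _).
  have [ti|it] := leqP t i; first by rewrite !andbF /= !mul0r subr0 addr0; case: (i < u)%N; rewrite ?mul1r ?mul0r ?expr0n// exprVn.
  by rewrite /= !mul0r sub0r add0r sqrrN; case: (s <= i)%N; rewrite ?mul1r ?mul0r ?expr0n// exprVn.
rewrite -mulr_suml big_split /= -!mulr_suml !cnt ?(ltnW st) ?(ltnW tu)//.
have e (y : R) : 0 < y -> y / y ^+ 2 = y^-1 by move=> y0; field; rewrite gt_eqF.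
by rewrite !e// divff// gt_eqF.
Qed.
End zstat_linear.

Section windows.
Context {R : realType}.
Variables (N T : nat).
Implicit Types (m : 'M[R]_(N, T)) (n : 'I_N).

Lemma mem_change_points m t :
  t \in change_points m = [&& 1 <= t, t < T & [exists n, entry m n t != entry m n t.+1]]%N.
Proof.
rewrite mem_filter mem_iota andbC -andbA; case: (leqP 1 t) => //= t1; congr (_ && _).
by lia.
Qed.

Lemma sorted_tau m : sorted ltn (0%N :: change_points m).
Proof.
rewrite /= path_sortedE; last exact: ltn_trans.
apply/andP; split; first by apply/allP => t; rewrite mem_change_points => /andP[].
apply: sorted_filter; first exact: ltn_trans.
exact: iota_ltn_sorted.
Qed.

Lemma entry_const_noncp m n v w : (1 <= v <= w)%N -> (w <= T)%N ->
  (forall t, (v <= t < w)%N -> t \notin change_points m) -> entry m n v = entry m n w.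
Proof.
move=> /andP[v1 vw] wT ncp; elim: w vw wT ncp => [|w IH]; first by case: v v1.
rewrite leq_eqVlt => /predU1P[->//|]; rewrite ltnS => vw wT ncp.
rewrite IH ?(ltnW wT)//; last by move=> t /andP[vt tw]; apply: ncp; rewrite vt ltnS ltnW.
apply/eqP; have := ncp w; rewrite vw ltnSn => /(_ isT); rewrite mem_change_points.
by rewrite (leq_trans v1 vw) wT /= => /existsPn/(_ n); rewrite negbK.
Qed.

Lemma Omega0_entry m n v w : m \in Omega0 N T -> (1 <= v <= T)%N -> (1 <= w <= T)%N ->
  entry m n v = entry m n w.
Proof.
rewrite inE /Omega0 /nb_changes /= => /size0nil cp0.
wlog vw : v w / (v <= w)%N.
  by move=> H v1 w1; have [/H|/ltnW/H H'] := leqP v w; [exact|rewrite H'].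
move=> /andP[v1 _] /andP[_ wT]; apply: entry_const_noncp => //; first by rewrite v1.
by move=> t _; rewrite cp0.
Qed.

Lemma notin_between m i t : (i <= nb_changes m)%N -> (tau m i < t < tau m i.+1)%N ->
  t \notin change_points m.
Proof.
move=> ic /andP[it ti]; apply/negP => tcp.
set c := 0%N :: change_points m.
have tc : t \in c by rewrite in_cons tcp orbT.
have ta : nth T c (index t c) = t by exact: nth_index.
have asz : (index t c < size c)%N by rewrite index_mem.
have ia : (i < index t c)%N.
  rewrite ltnNge; apply/negP => ai.
  have := sorted_leq_nth leq_trans leqnn T (sub_sorted ltnW (sorted_tau m)).
  move=> /(_ (index t c) i); rewrite !inE asz /= ltnS ic => /(_ isT isT ai).
  by rewrite ta leqNgt it.
have := sorted_leq_nth leq_trans leqnn T (sub_sorted ltnW (sorted_tau m)).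
move=> /(_ i.+1 (index t c)); rewrite !inE asz (leq_ltn_trans ia asz) => /(_ isT isT ia).
by rewrite ta leqNgt ti.
Qed.

Lemma tau_gt0 m i : (1 <= i <= (nb_changes m).+1)%N -> (0 < T)%N -> (0 < tau m i <= T)%N.
Proof.
move=> /andP[i1 ic] T0; move: ic; rewrite leq_eqVlt => /predU1P[->|].
  by rewrite /tau nth_default ?T0 ?leqnn//=.
rewrite ltnS => ic.
have : tau m i \in change_points m.
  by rewrite /tau; case: i i1 ic => // i _ ic; exact: mem_nth.
by rewrite mem_change_points => /and3P[-> /ltnW ->].
Qed.

Lemma tau_entry m n i v w : (0 < T)%N -> (i <= nb_changes m)%N ->
  (tau m i < v <= tau m i.+1)%N -> (tau m i < w <= tau m i.+1)%N ->
  entry m n v = entry m n w.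
Proof.
move=> T0 ic; wlog vw : v w / (v <= w)%N.
  by move=> H v1 w1; have [/H|/ltnW/H H'] := leqP v w; [exact|rewrite H'].
move=> /andP[v1 _] /andP[_ wT].
apply: entry_const_noncp.
- by rewrite vw (leq_ltn_trans _ v1).
- by apply: leq_trans wT _; have /andP[] := @tau_gt0 m i.+1 ic T0.
- move=> t /andP[vt tw]; apply: (@notin_between m i) => //.
  by rewrite (leq_trans v1 vt) (leq_trans tw wT).
Qed.

Lemma segment_mean_const m n s t e : (s < t)%N ->
  (forall v, (s < v <= t)%N -> entry m n v = e) -> segment_mean m n s t = e.
Proof.
move=> st me; rewrite /segment_mean (eq_big_nat _ _ (F2 := fun=> e)); last by move=> v; rewrite ltnS; exact: me.
rewrite sumr_const_nat subSS -[_ *+ _]mulr_natr mulfK// pnatr_eq0 -lt0n subn_gt0//.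
Qed.

Lemma zstat_Omega0 m n s t u : m \in Omega0 N T -> (s < t < u)%N -> (u <= T)%N ->
  zstat m n s t u = 0.
Proof.
move=> m0 /andP[st tu] uT.
rewrite /zstat !(@segment_mean_const m n _ _ (entry m n u))// ?subrr ?mul0r//.
  by move=> v /andP[sv vt]; apply: Omega0_entry => //; lia.
by move=> v /andP[sv vt]; apply: Omega0_entry => //; lia.
Qed.

(** The left half of such a window lies in the old segment, and at most $d$ of the $h$ times of
    its right half do: the jump is seen up to the factor $1-d/h$. *)
Lemma zstat_signal m n j h d t (Delta : R) : (1 <= j <= nb_changes m)%N ->
  (t <= tau m j)%N -> (tau m j - t <= d)%N -> (d <= h)%N -> (0 < h)%N ->
  (tau m j.-1 + h <= t)%N -> (t + h <= tau m j.+1)%N ->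
  0 <= Delta -> Delta <= `|entry m n (tau m j).+1 - entry m n (tau m j)| ->
  Delta * (1 - d%:R / h%:R) * Num.sqrt (h%:R / 2) <= `|zstat m n (t - h) t (t + h)|.
Proof.
move=> /andP[j1 jc] tj jd dh h0 jt tj1 D0 DD.
have T0 : (0 < T)%N.
  have : tau m j \in change_points m by rewrite /tau; case: (j) j1 jc => // i _; exact: mem_nth.
  by rewrite mem_change_points; lia.
have hR : 0 < h%:R :> R by rewrite ltr0n.
set old := entry m n (tau m j); set new := entry m n (tau m j).+1.
have e1 v : (t - h < v <= tau m j)%N -> entry m n v = old.
  move=> vj; apply: (@tau_entry m n j.-1) => //; rewrite ?prednK//; lia.
have e2 v : (tau m j < v <= tau m j.+1)%N -> entry m n v = new.
  by move=> vj; apply: (@tau_entry m n j) => //; rewrite ?ltnSn//=; lia.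
have ht : (h <= t)%N by lia.
have s1 : segment_mean m n (t - h) t = old.
  apply: segment_mean_const => [|v vt]; first lia.
  by apply: e1; lia.
pose r := (tau m j - t)%N.
have rh : (r <= h)%N by rewrite /r; lia.
have s2 : segment_mean m n t (t + h) = old + (new - old) * (1 - r%:R / h%:R).
  rewrite /segment_mean (@big_cat_nat _ _ _ (tau m j).+1)//=; [|lia..].
  rewrite (eq_big_nat _ _ (F2 := fun=> old)); last by move=> v vt; apply: e1; lia.
  rewrite [X in _ + X](eq_big_nat _ _ (F2 := fun=> new)); last by move=> v vt; apply: e2; lia.
  rewrite !sumr_const_nat -[old *+ _]mulr_natr -[new *+ _]mulr_natr.
  rewrite (_ : (t + h).+1 - (tau m j).+1 = h - r)%N; last by rewrite /r; lia.
  rewrite (_ : (tau m j).+1 - t.+1 = r)%N; last by rewrite /r; lia.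
  rewrite (_ : t + h - t = h)%N; last lia.
  rewrite (natrB _ rh); move: (r%:R : R) (h%:R : R) hR (old) (new) => a b b0 o e.
  by field; rewrite gt_eqF.
rewrite /zstat s1 s2 addrAC subrr add0r.
rewrite (_ : t + h - t = h)%N; last lia.
rewrite (_ : t - (t - h) = h)%N; last lia.
have -> : Num.sqrt (h%:R^-1 + h%:R^-1) = (Num.sqrt (h%:R / 2))^-1 :> R.
  rewrite -sqrtrV ?divr_ge0//; congr Num.sqrt; by field; rewrite gt_eqF.
rewrite invrK !normrM (ger0_norm (sqrtr_ge0 _)) ler_wpM2r ?sqrtr_ge0//.
have dr : r%:R / h%:R <= d%:R / h%:R :> R by rewrite ler_pM2r ?invr_gt0// ler_nat.
have d1 : d%:R / h%:R <= 1 :> R by rewrite ler_pdivrMr// mul1r ler_nat.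
have r1 : 0 <= 1 - r%:R / h%:R :> R by lra.
rewrite (ger0_norm r1) ler_pM//; lra.
Qed.
End windows.

(** * Exponential bounds for the two error probabilities *)

Section chernoff.
Context {R : realType} {disp : measure_display} {Om : measurableType disp}.
Variable P : probability Om R.

Lemma exp_markov (Y : Om -> R) (E : set Om) (k : R) : measurable_fun setT Y -> measurable E ->
  (forall w, 0 <= Y w) -> (forall w, E w -> expR k <= Y w) ->
  (P E <= (expR (- k))%:E * \int[P]_w (Y w)%:E)%E.
Proof.
move=> mY mE Y0 EY.
have : ((expR k)%:E * P E <= \int[P]_w (Y w)%:E)%E.
  rewrite -[X in P X](setIT E) -integral_indic// -ge0_integralZl//=; last first.
  - exact/measurable_EFinP.
  apply: ge0_le_integral => //=.
  - by apply/measurable_EFinP; apply: measurable_funM.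
  - exact/measurable_EFinP.
  - move=> w _; rewrite -EFinM lee_fin indicE; case: (boolP (w \in E)) => [|_]; last by rewrite mulr0.
    by rewrite inE mulr1; exact: EY.
move=> /(lee_wpmul2l (_ : 0 <= (expR (- k))%:E)%E); rewrite lee_fin expR_ge0 => /(_ isT).
by rewrite muleA -EFinM -expRD addNr expR0 mul1e.
Qed.
End chernoff.

Section decision.
Context {R : realType} {disp : measure_display} {Om : measurableType disp}.
Local Notation RT := (measurableTypeR R).
Variables (N T : nat) (X : 'I_N -> 'I_T -> {mfun Om >-> RT}).
Variables (l1 l2 : R).

Lemma scoreE p : score N l1 l2 p =
  ln (likratio (l1 * ln N%:R / N%:R) (l2 / Num.sqrt (N%:R * ln N%:R)) p).
Proof. by []. Qed.

Lemma measurable_score_pval : measurable_fun setT (fun x : R => score N l1 l2 (pval x)).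
Proof.
have c : continuous (likratio (l1 * ln N%:R / N%:R) (l2 / Num.sqrt (N%:R * ln N%:R)) \o (pval : R -> R)).
  move=> x; apply: continuous_comp; first exact: continuous_pval.
  by apply: continuous_likratio; rewrite pval_gt0 pval_lt2.
exact: (measurableT_comp (@measurable_ln R) (continuous_measurable_fun c)).
Qed.

Lemma zstat_data n s t u w : (s < t < u)%N -> (u <= T)%N ->
  zstat (data X w) n s t u = \sum_i zweight s t u i * X n i w.
Proof.
by move=> stu uT; rewrite zstat_linear//; apply: eq_bigr => i _; rewrite mxE.
Qed.

Lemma measurable_sum_zweight n s t u :
  measurable_fun setT (fun w => \sum_(i < T) zweight s t u i * X n i w).
Proof.
apply: measurable_sum => i; apply: measurable_funM => //. exact: (measurable_funP (X n i)).
Qed.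

Lemma measurable_penalized s t u : (s < t < u)%N -> (u <= T)%N ->
  measurable_fun setT (fun w => penalized_score l1 l2 (data X w) s t u).
Proof.
move=> stu uT; apply: measurable_funB => //.
apply: measurable_sum => n.
rewrite (_ : (fun _ => _) = (fun x => score N l1 l2 (pval x)) \o (fun w => \sum_(i < T) zweight s t u i * X n i w)).
  by apply: measurableT_comp (measurable_score_pval) (measurable_sum_zweight _ _ _ _).
by apply/funext => w /=; rewrite /pvalue zstat_data.
Qed.

Variables (h d : nat -> nat).
Hypothesis hpos : forall i, (1 <= i)%N -> (0 < h i)%N.
Hypothesis dpos : forall i, (1 <= i)%N -> (0 < d i)%N.

Lemma window_valid i k : (1 <= i)%N -> (1 <= k <= (T - 1) %/ d i)%N ->
  ((k * d i - h i < k * d i < minn (k * d i + h i) T) /\ (minn (k * d i + h i) T <= T))%N.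
Proof.
move=> i1 /andP[k1 kT]; have := hpos i1; have := dpos i1 => d0 h0.
have : (k * d i <= T - 1)%N by rewrite -leq_divRL.
have : (0 < k * d i)%N by rewrite muln_gt0 k1.
by move=> kd0 kdT; split; lia.
Qed.

Lemma measurable_declares c :
  measurable [set w | declares_change h d l1 l2 c (data X w)].
Proof.
pose E i k := [set w | [/\ (1 <= i <= last_scale h d T)%N, (1 <= k <= (T - 1) %/ d i)%N
   & c <= penalized_score l1 l2 (data X w) (k * d i - h i) (k * d i) (minn (k * d i + h i) T)]].
rewrite (_ : [set w | _] = \bigcup_i \bigcup_k E i k); last first.
  apply/seteqP; split => [w [i [k ?]]|w [i _ [k _ ?]]]; last by exists i, k.
  by exists i => //; exists k.
apply: bigcupT_measurable => i; apply: bigcupT_measurable => k.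
have [ik|ik] := boolP ((1 <= i <= last_scale h d T) && (1 <= k <= (T - 1) %/ d i))%N; last first.
  rewrite (_ : E i k = set0)//; apply/seteqP; split => // w [a b _].
  by rewrite a b in ik.
have /andP[/andP[i1 _] kk] := ik.
have [stu uT] := window_valid i1 kk.
rewrite (_ : E i k = setT `&` (fun w => penalized_score l1 l2 (data X w) (k * d i - h i) (k * d i) (minn (k * d i + h i) T)) @^-1` `[c, +oo[%classic).
  exact: measurable_penalized.
apply/seteqP; split => [w [_ _ /=]|w /= [_]]; rewrite /= in_itv /= andbT => //.
by move=> cw; case/andP: ik => ? ?; split.
Qed.

End decision.

Section errors.
Context {R : realType} {disp : measure_display} {Om : measurableType disp}.
Local Notation RT := (measurableTypeR R).
Local Notation mu := (@lebesgue_measure R).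
Variables (N T : nat) (P : 'M[R]_(N, T) -> probability Om R).
Variables (X : 'I_N -> 'I_T -> {mfun Om >-> RT}).
Hypothesis hX : gaussian_model P X.
Variables (l1 l2 : R).
Local Notation sc p := (score N l1 l2 p).
Local Notation a := (l1 * ln N%:R / N%:R).
Local Notation b := (l2 / Num.sqrt (N%:R * ln N%:R)).
Hypotheses (a0 : 0 <= a) (b0 : 0 <= b) (ab1 : a / 2 + 2 * b < 1).

Lemma expR_score x : expR (sc (pval x)) = likratio a b (pval x).
Proof.
rewrite scoreE lnK// posrE.
have x02 : 0 < pval x < 2 by rewrite pval_gt0 pval_lt2.
apply: lt_le_trans (likratio_ge b a0 x02).
rewrite ltr_wpDr//; first by rewrite mulr_ge0// invr_ge0 sqrtr_ge0.
by move: ab1; set A := a; set B := b; lra.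
Qed.

Lemma measurable_expR_score (th : R) : measurable_fun setT (fun x : R => expR (th * sc (pval x))).
Proof.
apply: measurableT_comp => //; apply: measurable_funM => //; exact: measurable_score_pval.
Qed.

(** The values of the window statistic along the rows are independent with laws $N(m_n,1)$, where
    $m_n$ is the same statistic of the means, so the exponential moment is a product. *)
Lemma window_chernoff (th k : R) m s t u (E : set Om) : (s < t < u)%N -> (u <= T)%N ->
  measurable E ->
  (forall w, E w -> k <= th * \sum_(n < N) sc (pvalue (data (X) w) n s t u)) ->
  (P m E <= (expR (- k))%:E *
    \prod_n \int[mu]_x (expR (th * sc (pval x)) * normal_pdf (zstat m n s t u) 1 x)%:E)%E.
Proof.
move=> stu uT mE kE.
pose Y w := \prod_n expR (th * sc (pval (\sum_(i < T) zweight s t u i * X n i w))).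
have YE w : Y w = expR (th * \sum_(n < N) sc (pvalue (data X w) n s t u)).
  rewrite mulr_sumr expR_sum; apply: eq_bigr => n _.
  by rewrite /pvalue zstat_data.
have mY : measurable_fun setT Y.
  apply: measurable_prod => n _; apply: (measurableT_comp (measurable_expR_score th)).
  exact: measurable_sum_zweight.
apply: le_trans (exp_markov (P m) mY mE _ _) _.
- by move=> w; rewrite YE expR_ge0.
- by move=> w Ew; rewrite YE ler_expR; exact: kE.
have H := @gaussian_model_expectation _ _ _ N T P X m (zweight s t u)
  (fun n x => expR (th * sc (pval x))) hX (@sum_zweight2 R T s t u stu uT)
  (fun=> measurable_expR_score th) (fun _ _ => expR_ge0 _).
rewrite [X in (_ * X)%E]H lee_wpmul2l ?lee_fin ?expR_ge0//.
by under [in leRHS]eq_bigr do rewrite zstat_linear//.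
Qed.

(** The penalty turns the probability of one window into a multiple of $h_i/T$; with at most
    $T/d_i$ windows at scale $i$, the union bound costs $\sum_ih_i/d_i$ and no power of $T$. *)
Lemma penalty_bound s t u (hh : R) : (0 < T)%N -> (s < t < u)%N ->
  (t - s)%:R <= hh -> (u - t)%:R <= hh ->
  expR (- ln (T%:R / 4 * ((t - s)%:R^-1 + (u - t)%:R^-1))) <= 2 * hh / T%:R :> R.
Proof.
move=> T0 /andP[st tu] h1 h2.
have T0R : 0 < T%:R :> R by rewrite ltr0n.
have x0 : 0 < (t - s)%:R :> R by rewrite ltr0n subn_gt0.
have y0 : 0 < (u - t)%:R :> R by rewrite ltr0n subn_gt0.
have hh0 : 0 < hh by apply: lt_le_trans h1.
have k0 : 0 < T%:R / 4 * ((t - s)%:R^-1 + (u - t)%:R^-1) :> R.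
  by rewrite mulr_gt0 ?divr_gt0// addr_gt0 ?invr_gt0.
have k1 : 0 < (2 * hh / T%:R)^-1 by rewrite invr_gt0 divr_gt0// mulr_gt0.
rewrite expRN lnK ?posrE// -[leRHS]invrK lef_pV2 ?posrE//.
have : hh^-1 <= (t - s)%:R^-1 :> R by rewrite lef_pV2 ?posrE.
have : hh^-1 <= (u - t)%:R^-1 :> R by rewrite lef_pV2 ?posrE.
rewrite (_ : (2 * hh / T%:R)^-1 = T%:R / 4 * (hh^-1 + hh^-1)); last by field; rewrite !gt_eqF.
by move=> i2 i1; rewrite ler_wpM2l ?divr_ge0// lerD.
Qed.

Variables (h d : nat -> nat) (c : R).
Hypothesis hpos : forall i, (1 <= i)%N -> (0 < h i)%N.
Hypothesis dpos : forall i, (1 <= i)%N -> (0 < d i)%N.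

Let exceeds i k w := c <= penalized_score l1 l2 (data X w) (k * d i - h i) (k * d i) (minn (k * d i + h i) T).

Let measurable_exceeds i k : (1 <= i)%N -> (1 <= k <= (T - 1) %/ d i)%N -> measurable [set w | exceeds i k w].
Proof.
move=> i1 kk; have [stu uT] := window_valid hpos dpos i1 kk.
rewrite (_ : [set w | exceeds i k w] = setT `&` (fun w => penalized_score l1 l2 (data X w) (k * d i - h i) (k * d i) (minn (k * d i + h i) T)) @^-1` `[c, +oo[%classic).
  exact: measurable_penalized.
by apply/seteqP; split => w; rewrite /exceeds /= in_itv /= andbT => // -[].
Qed.

(** Without signal every window statistic is standard normal, and the exponential moments of the
    scores at power $1$ are exactly $1$; what remains is the union bound over the windows. *)
Lemma type1_error_le m : m \in Omega0 N T ->
  (P m [set w | declares_change h d l1 l2 c (data X w)] <=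
   (2 * expR (- c) * scale_sum h d T)%:E)%E.
Proof.
move=> m0.
pose K i := ((T - 1) %/ d i)%N.
pose F i k := [set w | exceeds i.+1 k.+1 w].
pose G i := \big[setU/set0]_(k < K i.+1) F i k.
set L := last_scale h d T.
have mF i k : (k < K i.+1)%N -> measurable (F i k) by move=> kK; exact: measurable_exceeds.
have mG i : measurable (G i).
  by apply: bigsetU_measurable => k _; exact: mF.
have sub : [set w | declares_change h d l1 l2 c (data X w)] `<=` \big[setU/set0]_(i < L) G i.
  move=> w [[|i] [k]] [/andP[// _ iL] kK cw].
  case: k kK cw => [//|k] /andP[_ kK] cw.
  rewrite -bigcup_mkord; exists i => //=.
  by rewrite /G -bigcup_mkord; exists k.
have one i k : (k < K i.+1)%N -> (P m (F i k) <= (2 * expR (- c) * (h i.+1)%:R / T%:R)%:E)%E.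
  move=> kK; have kk : (1 <= k.+1 <= (T - 1) %/ d i.+1)%N by [].
  have [stu uT] := window_valid hpos dpos (ltn0Sn i) kk.
  set s := (k.+1 * d i.+1 - h i.+1)%N in stu *.
  set t := (k.+1 * d i.+1)%N in stu *.
  set u := minn _ _ in stu uT *.
  pose pen := ln (T%:R / 4 * ((t - s)%:R^-1 + (u - t)%:R^-1)) : R.
  apply: le_trans (@window_chernoff 1 (c + pen) m s t u (F i k) stu uT (mF _ _ kK) _) _.
    by move=> w; rewrite mul1r /F /= /exceeds /penalized_score -/s -/t -/u -/pen lerBrDr.
  rewrite big1 ?mule1; last first.
    move=> n _; rewrite zstat_Omega0//.
    under eq_integral do rewrite mul1r expR_score.
    by apply: integral_likratio => //; apply: ltW.
  rewrite lee_fin opprD expRD -!mulrA [in leRHS]mulrCA ler_wpM2l ?expR_ge0// mulrA.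
  apply: penalty_bound => //; rewrite ?ler_nat /s /u; lia.
have Gb i : (P m (G i) <= (2 * expR (- c) * ((h i.+1)%:R / (d i.+1)%:R))%:E)%E.
  apply: (le_trans (@Boole_inequality _ _ _ (P m) (F i) (K i.+1) (mF i))).
  apply: (@le_trans _ _ (\sum_(k < K i.+1) (2 * expR (- c) * (h i.+1)%:R / T%:R)%:E)%E).
    by apply: lee_sum => k _; exact: one.
  rewrite sumEFin lee_fin sumr_const card_ord -[_ *+ _]mulr_natr.
  have [T0|T0] := posnP T.
    by rewrite /K T0 div0n mulr0 !mulr_ge0 ?expR_ge0.
  have d0 : 0 < (d i.+1)%:R :> R by rewrite ltr0n dpos.
  rewrite [leRHS]mulrA -[leLHS]mulrA ler_wpM2l ?mulr_ge0 ?expR_ge0//.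
  rewrite mulrC ler_pdivrMr ?ltr0n// ler_pdivlMl// -natrM ler_nat mulnC.
  by apply: leq_trans (leq_trunc_div _ _) _; rewrite leq_subr.
apply: (@le_trans _ _ (P m (\big[setU/set0]_(i < L) G i))).
  apply: le_measure => //; rewrite inE; first exact: measurable_declares.
  by apply: bigsetU_measurable => i _; exact: mG.
apply: (le_trans (@Boole_inequality _ _ _ (P m) G L (fun i _ => mG i))).
apply: (@le_trans _ _ (\sum_(i < L) (2 * expR (- c) * ((h i.+1)%:R / (d i.+1)%:R))%:E)%E).
  by apply: lee_sum => i _; exact: Gb.
by rewrite sumEFin lee_fin -mulr_sumr /scale_sum big_add1 /= big_mkord.
Qed.

Local Notation EE th x0 := (\int[mu]_x (expR (th * sc (pval x)) * normal_pdf x0 1 x)%:E)%E.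

(** One favourable window suffices: $V$ rows have a signal and contribute $r$, and the bound $B$
    covers the other rows whatever their means are. *)
Lemma type2_error_le (th m0 r B pen : R) (V : nat) (m : 'M[R]_(N, T)) i k :
  (1 <= i <= last_scale h d T)%N -> (1 <= k <= (T - 1) %/ d i)%N ->
  0 <= th -> 0 <= r -> 1 <= B ->
  (forall y, (EE (- th) y <= B%:E)%E) ->
  (forall y, m0 <= `|y| -> (EE (- th) y <= r%:E)%E) ->
  (V <= #|[set n : 'I_N | (m0 <= `|zstat m n (k * d i - h i)%N (k * d i)%N (minn (k * d i + h i) T)|)%R]%SET|)%N ->
  ln (T%:R / 4 * ((k * d i - (k * d i - h i))%:R^-1 + (minn (k * d i + h i) T - k * d i)%:R^-1)) <= pen ->
  (P m (~` [set w | declares_change h d l1 l2 c (data X w)]) <=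
   (expR (th * (c + pen)) * (r ^+ V * B ^+ N))%:E)%E.
Proof.
move=> iL kk th0 r0 B1 EB Er VS.
have i1 : (1 <= i)%N by case/andP: iL.
have [stu uT] := window_valid hpos dpos i1 kk.
set s := (k * d i - h i)%N in stu VS *.
set t := (k * d i)%N in stu VS *.
set u := minn _ _ in stu uT VS *.
set pen0 := ln _ => penle.
have mD := measurable_declares X l1 l2 hpos dpos c.
apply: (@le_trans _ _ (P m [set w | ~ exceeds i k w])).
  apply: le_measure; rewrite ?inE//.
  - exact: measurableC.
  - by rewrite (_ : [set w | _] = ~` [set w | exceeds i k w])//; apply: measurableC; exact: measurable_exceeds.
  - by move=> w nD /= li; apply: nD; exists i, k; split.
apply: le_trans (@window_chernoff (- th) (- (th * (c + pen))) m s t u _ stu uT _ _) _.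
- by rewrite (_ : [set w | _] = ~` [set w | exceeds i k w])//; apply: measurableC; exact: measurable_exceeds.
- move=> w /= /negP; rewrite -ltNge /penalized_score -/s -/t -/u -/pen0 ltrBlDr => /ltW Sc.
  by rewrite mulNr lerN2 ler_wpM2l//; apply: le_trans Sc _; rewrite lerD2l.
rewrite opprK EFinM lee_wpmul2l ?lee_fin ?expR_ge0//.
have /card_geqP[q [uq sq qS]] := VS.
pose S : {set 'I_N} := [set n in q]%SET.
have cS : #|S| = V by rewrite cardsE (card_uniqP uq).
have E0 th' y : (0 <= EE th' y)%E.
  by apply: integral_ge0 => x _; rewrite lee_fin mulr_ge0 ?expR_ge0 ?normal_pdf_ge0.
have B0 : 0 <= B by apply: le_trans B1.
have prodle (Q : pred 'I_N) (e : R) : 0 <= e -> (forall n, Q n -> (EE (- th) (zstat m n s t u) <= e%:E)%E) ->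
    (0 <= \prod_(n | Q n) EE (- th) (zstat m n s t u) <= (e ^+ #|Q|)%:E)%E.
  move=> e0 Qe; rewrite -prodr_const.
  elim/big_rec2: _ => [|n x y Qn /andP[x0 xy]]; first by rewrite lee_fin ler01 lexx.
  by rewrite mule_ge0//= EFinM lee_pmul// Qe.
rewrite (bigID (mem S)) /=.
have ES n : n \in S -> (EE (- th) (zstat m n s t u) <= r%:E)%E.
  by rewrite inE => /qS; rewrite inE => /Er.
have /andP[p0 p1] := prodle (mem S) r r0 ES.
have /andP[p2 p3] := prodle (predC (mem S)) B B0 (fun n _ => EB _).
rewrite [(r ^+ V * _)%R%:E]EFinM -cS; apply: lee_pmul => //.
apply: le_trans p3 _; rewrite lee_fin ler_weXn2l//.
by apply: leq_trans (max_card _) _; rewrite card_ord.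
Qed.

End errors.

(** * Exponential moments of the scores *)

Section score_moments.
Context {R : realType}.
Local Notation mu := (@lebesgue_measure R).
Variables (N : nat) (l1 l2 a b : R).
Local Notation sc p := (score N l1 l2 p).
Hypotheses (aE : a = l1 * ln N%:R / N%:R) (bE : b = l2 / Num.sqrt (N%:R * ln N%:R)).
Hypotheses (a0 : 0 < a) (b0 : 0 < b) (ab : a / 2 + 2 * b <= 2^-1).
Local Notation EE th y := (\int[mu]_x (expR (th * sc (pval x)) * normal_pdf y 1 x)%:E)%E.

Let u := a / 2 + 2 * b.
Let v : R := 1 - u.
(* $g$ bounds the exponential of minus the score, by dropping the nonnegative $f_1$ term. *)
Let g (x : R) : R := (v + b / Num.sqrt (pval x))^-1.

Let u0 : 0 < u. Proof. by rewrite /u; move: a0 b0; lra. Qed.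
Let u2 : u <= 2^-1. Proof. exact: ab. Qed.
Let v2 : 2^-1 <= v. Proof. by rewrite /v; move: u2; lra. Qed.
Let v0 : 0 < v. Proof. by move: v2; lra. Qed.
Let v1 : v < 1. Proof. by rewrite /v; move: u0; lra. Qed.
Let sp (x : R) : 0 < Num.sqrt (pval x). Proof. by rewrite sqrtr_gt0 pval_gt0. Qed.
Let y0 (x : R) : 0 < b / Num.sqrt (pval x). Proof. by rewrite divr_gt0. Qed.
Let vy0 (x : R) : 0 < v + b / Num.sqrt (pval x). Proof. by rewrite addr_gt0. Qed.

Lemma expR_score_coef (x : R) : expR (sc (pval x)) = likratio a b (pval x).
Proof.
by rewrite aE bE; apply: expR_score; rewrite -?aE -?bE ?ltW//; apply: le_lt_trans u2 _; lra.
Qed.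

Let g_ge0 (x : R) : 0 <= g x. Proof. by rewrite invr_ge0 ltW. Qed.

Let g_le (x y : R) : `|x| <= `|y| -> g y <= g x.
Proof.
move=> xy; rewrite /g lef_pV2 ?posrE// lerD2l ler_pM2l// lef_pV2 ?posrE//.
by rewrite ler_wsqrtr// le_pval.
Qed.

Let measurable_g : measurable_fun setT (fun x : measurableTypeR R => g x).
Proof.
apply: continuous_measurable_fun => x; apply: cvgV; first by rewrite gt_eqF.
apply: cvgD; first exact: cvg_cst.
apply: cvgM; first exact: cvg_cst.
apply: cvgV; first by rewrite gt_eqF.
by apply: continuous_comp; [exact: continuous_pval|exact: sqrt_continuous].
Qed.

Let inv_score (x : R) : expR (- sc (pval x)) <= g x.
Proof.
rewrite expRN expR_score_coef /g lef_pV2 ?posrE//; last first.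
  by apply: lt_le_trans (likratio_ge b (ltW a0) _); rewrite ?pval_gt0 ?pval_lt2//; have := vy0 x; rewrite /v /u opprD addrA.
have := @likratio_ge R a b (ltW a0) (pval x); rewrite pval_gt0 pval_lt2 => /(_ isT).
by rewrite /v /u opprD addrA.
Qed.

Let g_le_inv (x : R) : g x <= v^-1.
Proof. by rewrite /g lef_pV2 ?posrE// lerDl ltW. Qed.

Lemma expR_convex (th y : R) : 0 <= th <= 1 -> expR (th * y) <= 1 - th + th * expR y.
Proof.
move=> /andP[th0 th1].
have e1 : expR (th * y) * expR ((1 - th) * y) = expR y by rewrite -expRD; congr expR; ring.
have e2 := expRxMexpNx_1 (th * y).
have -> : 1 - th + th * expR y = expR (th * y) * (th * expR ((1 - th) * y) + (1 - th) * expR (- (th * y))).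
  rewrite mulrDr mulrCA e1 [X in _ = _ + X]mulrCA e2; ring.
rewrite ler_peMr ?expR_ge0//.
have := expR_ge1Dx ((1 - th) * y); have := expR_ge1Dx (- (th * y)); nra.
Qed.

Let tilt_le (th x : R) : 0 <= th <= 1 -> expR (- th * sc (pval x)) <= 1 - th + th * g x.
Proof.
move=> th01; rewrite mulNr -mulrN; apply: le_trans (expR_convex _ th01) _.
by case/andP: th01 => th0 _; rewrite lerD2l ler_wpM2l.
Qed.

(** Bound for the excess over $1$ of the mean of $g$ without signal. In $1/v-2b/v^2+\cdots$ with
    $v=1-a/2-2b$ the terms linear in $b$ cancel; this is what makes the many rows without
    signal harmless, since $b$ alone is much larger than $\log T/N$. *)
Definition null_excess : R := a / 2 + a ^+ 2 + 16 * b ^+ 2 + 16 * b ^+ 2 * ln (1 + b^-1).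

Lemma null_excess_ge0 : 0 <= null_excess.
Proof.
have b2 : 0 <= 16 * b ^+ 2 by rewrite mulr_ge0 ?sqr_ge0.
have lnb : 0 <= ln (1 + b^-1) by rewrite ln_ge0// lerDl invr_ge0 ltW.
by rewrite /null_excess !addr_ge0 ?sqr_ge0// ?divr_ge0 ?mulr_ge0// ltW.
Qed.

Let null_integral y : (\int[mu]_x (g x * normal_pdf y 1 x)%:E <= (1 + null_excess)%:E)%E.
Proof.
apply: le_trans (normal_shift_le y measurable_g g_ge0 g_le) _.
have := integral_reciprocal v0 b0; rewrite -/g => ->; rewrite lee_fin /null_excess.
have iv : v^-1 <= 1 + u + 2 * u ^+ 2.
  rewrite -[leLHS]mul1r ler_pdivrMr// /v; have := u0; have := u2; nra.
have i2 : 2 * b <= 2 * b / v ^+ 2.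
  rewrite ler_pdivlMr ?exprn_gt0// ler_piMr ?mulr_ge0 ?(ltW b0)//.
  by rewrite exprn_ile1// ltW.
have lnn : ln (1 + v / b) <= ln (1 + b^-1).
  by rewrite ler_ln ?posrE ?addr_gt0 ?divr_gt0 ?invr_gt0// lerD2l ler_pdivrMr// mulVf ?gt_eqF// ltW.
have ln0 : 0 <= ln (1 + v / b) by rewrite ln_ge0// lerDl divr_ge0// ltW.
have i3 : 2 * b ^+ 2 / v ^+ 3 <= 16 * b ^+ 2.
  rewrite ler_pdivrMr ?exprn_gt0//.
  have : 1 <= 8 * v ^+ 3 by have := v2; nra.
  have := sqr_ge0 b; nra.
have i4 : 2 * b ^+ 2 / v ^+ 3 * ln (1 + v / b) <= 16 * b ^+ 2 * ln (1 + b^-1).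
  apply: ler_pM => //; apply: divr_ge0; first by apply: mulr_ge0 => //; exact: sqr_ge0.
  by apply: exprn_ge0; exact: ltW.
have iu : 2 * u ^+ 2 <= a ^+ 2 + 16 * b ^+ 2.
  by rewrite /u; have := sqr_ge0 (a / 2 - 2 * b); nra.
by move: iv i2 i4 iu; rewrite {1}/u; lra.
Qed.

Let mE th : measurable_fun setT (fun x : measurableTypeR R => expR (th * sc (pval x))).
Proof. exact: measurable_expR_score. Qed.

(** The mean of $g$ is largest for mean $0$ by association; powers below $1$ follow from the
    convexity of the exponential. *)
Lemma null_moment th y : 0 <= th <= 1 -> (EE (- th) y <= (expR (th * null_excess))%:E)%E.
Proof.
move=> th01; have [th0 th1] := andP th01.
apply: (@le_trans _ _ (\int[mu]_x ((1 - th) * normal_pdf y 1 x + th * (g x * normal_pdf y 1 x))%:E)%E).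
  apply: ge0_le_integral => //=.
  - by move=> x _; rewrite lee_fin mulr_ge0 ?expR_ge0 ?normal_pdf_ge0.
  - by apply: measurable_mul_normal_pdf; exact: mE.
  - apply/measurable_EFinP; apply: measurable_funD; apply: measurable_funM => //.
      exact: measurable_normal_pdf.
    by apply: measurable_funM => //; exact: measurable_normal_pdf.
  - by move=> x _; rewrite lee_fin mulrA -mulrDl ler_wpM2r ?normal_pdf_ge0// tilt_le.
under eq_integral do rewrite EFinD !EFinM.
rewrite ge0_integralD//=.
- rewrite ge0_integralZl//=; last 3 first.
  + exact: measurable_EFin_normal_pdf.
  + by move=> x _; rewrite lee_fin normal_pdf_ge0.
  + by rewrite lee_fin subr_ge0.
  rewrite integral_normal_pdf mule1.
  rewrite ge0_integralZl//=; last 2 first.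
  + by under eq_fun do rewrite -EFinM; exact: measurable_mul_normal_pdf.
  + by move=> x _; rewrite -EFinM lee_fin mulr_ge0 ?normal_pdf_ge0.
  apply: (@le_trans _ _ ((1 - th)%:E + th%:E * (1 + null_excess)%:E)%E).
    rewrite leeD2l// lee_wpmul2l ?lee_fin//.
    by under eq_integral do rewrite -EFinM; exact: null_integral.
  rewrite -EFinM -EFinD lee_fin (_ : _ + _ = 1 + th * null_excess); last by ring.
  exact: expR_ge1Dx.
- by move=> x _; rewrite -EFinM lee_fin mulr_ge0 ?normal_pdf_ge0// subr_ge0.
- apply: emeasurable_funM => //; exact: measurable_EFin_normal_pdf.
- by move=> x _; rewrite -!EFinM lee_fin !mulr_ge0 ?normal_pdf_ge0.
- apply: emeasurable_funM => //; under eq_fun do rewrite -EFinM; exact: measurable_mul_normal_pdf.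
Qed.

Let tiltN (th x : R) : expR (th * sc (pval (- x))) = expR (th * sc (pval x)).
Proof. by rewrite pvalN. Qed.

(** Beyond the level $z$ the $f_2$ term $bp^{-1/2}$ of the likelihood ratio is at least $x_1$, and
    a statistic with mean at least $m_0$ exceeds $z$ with probability at least
    $\varphi(z-m_0+1)$. *)
Lemma moderate_signal_moment m0 z x1 y : 0 <= m0 <= z -> m0 <= `|y| ->
  0 <= x1 <= 1 -> x1 <= b * expR (z ^+ 2 / 4) / Num.sqrt 2 ->
  (EE (- 1) y <= (expR (2 * u - normal_pdf 0 1 (z - m0 + 1) * x1 / 2))%:E)%E.
Proof.
move=> m0z my /andP[x10 x11] x1le.
set q := normal_pdf 0 1 _.
have q0 : 0 <= q := normal_pdf_ge0 _ _ _.
have vx0 : 0 < v + x1 by rewrite ltr_wpDr.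
have fA x : expR (- 1 * sc (pval x)) <= v^-1.
  by rewrite mulN1r; apply: le_trans (inv_score x) (g_le_inv x).
have fB x : z <= `|x| -> expR (- 1 * sc (pval x)) <= (v + x1)^-1.
  move=> zx; rewrite mulN1r; apply: le_trans (inv_score x) _.
  rewrite /g lef_pV2 ?posrE// lerD2l; apply: le_trans x1le _.
  rewrite -mulrA ler_pM2l// -[leLHS]invrK lef_pV2 ?posrE// ?invr_gt0 ?divr_gt0 ?expR_gt0 ?sqrtr_gt0//.
  rewrite invf_div.
  have -> : Num.sqrt 2 / expR (z ^+ 2 / 4) = Num.sqrt (2 * expR (- z ^+ 2 / 2)).
    rewrite sqrtrM//; congr (_ * _); rewrite -expRN -[LHS]ger0_norm ?expR_ge0// -sqrtr_sqr.
    by rewrite -expRM_natl; congr (Num.sqrt (expR _)); field.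
  rewrite ler_wsqrtr//; apply: le_trans (pval_tail x) _.
  rewrite ler_wpM2l// ler_expR.
  have : z ^+ 2 <= x ^+ 2.
    by rewrite -[leRHS]ger0_norm ?sqr_ge0// normrX ler_sqr ?nnegrE//; case/andP: m0z => ? ?; apply: le_trans; [|eassumption].
  lra.
have BA : (v + x1)^-1 <= v^-1 by rewrite lef_pV2 ?posrE// lerDl.
apply: le_trans (normal_shift_tail_gain (mE _) (fun x => expR_ge0 _) (tiltN _) fA fB BA m0z my) _.
rewrite lee_fin -/q; apply: le_trans (expR_ge1Dx _).
have h1 : v^-1 <= 1 + 2 * u.
  by rewrite -[leLHS]mul1r ler_pdivrMr// /v; have := u0; have := u2; nra.
have h2 : x1 / 2 <= v^-1 - (v + x1)^-1.
  rewrite (_ : v^-1 - (v + x1)^-1 = x1 / (v * (v + x1))); last first.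
    by field; rewrite !gt_eqF.
  rewrite ler_wpM2l// lef_pV2 ?posrE ?mulr_gt0//.
  by have := v0; have := v1; nra.
have := ler_wpM2r q0 h2; lra.
Qed.

(** By the $f_1$ term alone the score is at least $\log a-\log(p(2-\log p)^2)$. As
    $p(2-\log p)^2$ is at most a constant times $p^{1-\delta}$ and $p\le2e^{-x^2/2}$, this is
    $(1-\delta)x^2/2+\log a$ up to a constant. The power $\theta\le\delta^2$ is small enough for
    the event $|x|<(1-\delta)m_0$, of probability about $e^{-\delta^2m_0^2/2}$, not to matter. *)
Lemma strong_signal_moment m0 del th y : 0 < del < 1 -> 0 <= th <= del ^+ 2 -> 0 <= m0 -> m0 <= `|y| ->
  (EE (- th) y <= (3 * expR (th * (ln (4 * expR (2 * del) / del ^+ 2) - ln a - (1 - del) ^+ 3 * m0 ^+ 2 / 2)))%:E)%E.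
Proof.
move=> /andP[d0 d1] /andP[th0 thd] m00 my.
have th1 : th <= 1 by nra.
have a1 : a <= 1 by have := u2; have := b0; rewrite /u; lra.
set K := 4 * expR (2 * del) / del ^+ 2.
have K1 : 1 <= K.
  rewrite /K ler_pdivlMr ?exprn_gt0// mul1r.
  have : 1 <= expR (2 * del) by rewrite -expR0 ler_expR mulr_ge0// ltW.
  nra.
have K0 : 0 < K by apply: lt_le_trans K1.
have lK : 0 <= ln K by rewrite ln_ge0.
have la : ln a <= 0 by rewrite ln_le0.
have key x : - sc (pval x) <= ln K - ln a - (1 - del) * (x ^+ 2 / 2).
  set p := pval x; have p0 : 0 < p := pval_gt0 x; have p1 : p <= 1 := pval_le1 x.
  pose q := - ln p; have q0 : 0 <= q by rewrite oppr_ge0 ln_le0.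
  have s1 : ln a - ln p - 2 * ln (2 + q) <= sc p.
    rewrite -ler_expR expR_score_coef.
    have -> : expR (ln a - ln p - 2 * ln (2 + q)) = a * (p * (2 - ln p) ^+ 2)^-1.
      rewrite !expRB expRM_natl !lnK ?posrE//; last by rewrite ltr_wpDr.
      by rewrite /q [in RHS](invfM p) [RHS]mulrA.
    have B0 : 0 <= b * (Num.sqrt p)^-1 by rewrite ltW// y0.
    rewrite likratioE -/p; move: B0 v0; rewrite /v /u.
    set A := a * (p * _)^-1; set B := b * _; lra.
  have s2 : 2 * ln (2 + q) <= ln (2 * expR (2 * del) / del ^+ 2) + del * q.
    rewrite -ler_expR expRM_natl expRD !lnK ?posrE ?divr_gt0 ?mulr_gt0 ?expR_gt0 ?exprn_gt0//; last by rewrite ltr_wpDr.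
    have -> : 2 * expR (2 * del) / del ^+ 2 * expR (del * q) = 2 * expR (del * (2 + q)) / del ^+ 2.
      by rewrite mulrDr expRD [del * 2]mulrC; field; rewrite gt_eqF.
    rewrite ler_pdivlMr ?exprn_gt0// -exprMn.
    have := @expR_ge1Dxn R (del * (2 + q)) 1; rewrite mulr_ge0 ?addr_ge0 ?(ltW d0)// => /(_ isT).
    by rewrite (_ : 2`!%:R = 2 :> R)// [(2 + q) * del]mulrC; lra.
  have s3 : ln p <= ln 2 - x ^+ 2 / 2.
    rewrite -[_ - _]expRK expRB lnK ?posrE// ler_ln ?posrE ?divr_gt0 ?expR_gt0//.
    by apply: le_trans (pval_tail x) _; rewrite mulNr expRN.
  have -> : ln K = ln (2 * expR (2 * del) / del ^+ 2) + ln 2.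
    rewrite -lnM ?posrE ?divr_gt0 ?mulr_gt0 ?expR_gt0 ?exprn_gt0//; congr ln; rewrite /K; by field; rewrite gt_eqF.
  have ln2 : 0 <= del * ln 2 by rewrite mulr_ge0 ?(ltW d0)// ln_ge0// ler1n.
  have := ler_wpM2l (_ : 0 <= 1 - del) s3; rewrite subr_ge0 (ltW d1) => /(_ isT).
  by move: s1 s2; rewrite /q; lra.
set e := (1 - del) ^+ 3 * m0 ^+ 2 / 2.
have fA x : expR (- th * sc (pval x)) <= 2.
  apply: le_trans (@tilt_le th x _) _; first by rewrite th0.
  have : g x <= 2.
    by apply: le_trans (g_le_inv x) _; rewrite -[leRHS]invrK lef_pV2 ?posrE.
  nra.
have fB x : (1 - del) * m0 <= `|x| -> expR (- th * sc (pval x)) <= expR (th * (ln K - ln a - e)).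
  move=> mx; rewrite ler_expR mulNr -mulrN ler_wpM2l//; apply: le_trans (key x) _.
  rewrite lerB// /e.
  have : ((1 - del) * m0) ^+ 2 <= x ^+ 2.
    rewrite -[leRHS]ger0_norm ?sqr_ge0// normrX ler_sqr ?nnegrE// mulr_ge0// subr_ge0 ltW//.
  rewrite exprMn => mx2.
  have := ler_wpM2l (_ : 0 <= 1 - del) mx2; rewrite subr_ge0 (ltW d1) => /(_ isT).
  rewrite exprS; lra.
have y0m : 0 <= (1 - del) * m0 <= m0 by apply/andP; split; nra.
apply: le_trans (normal_shift_tail_split (mE _) (fun x => expR_ge0 _) (tiltN _) fA fB (expR_ge0 _) y0m my) _.
rewrite lee_fin.
have : expR (- (m0 - (1 - del) * m0) ^+ 2 / 2) <= expR (th * (ln K - ln a - e)).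
  rewrite ler_expR.
  have : 0 <= th * (ln K - ln a) by rewrite mulr_ge0// subr_ge0 (le_trans la).
  have : th * e <= del ^+ 2 * (m0 ^+ 2 / 2).
    apply: ler_pM => //; first by rewrite /e divr_ge0// mulr_ge0 ?sqr_ge0// exprn_ge0// subr_ge0 ltW.
    rewrite /e ler_wpM2r// ler_piMl ?sqr_ge0// exprn_ile1// ?subr_ge0 ?(ltW d1)// lerBlDr lerDl ltW//.
  rewrite (_ : (m0 - (1 - del) * m0) = del * m0); last by ring.
  rewrite exprMn; lra.
lra.
Qed.

End score_moments.

(** * A window adapted to a long gap between change-points *)

Section window_selection.
Context {R : realType}.
Variables (h d : nat -> nat).
Hypotheses (h1 : (1 <= h 1)%N) (hinc : forall i, (1 <= i)%N -> (h i < h i.+1)%N).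
Hypotheses (d1 : (1 <= d 1)%N) (dinc : forall i, (1 <= i)%N -> (d i < d i.+1)%N).
Hypothesis hd : forall i, (1 <= i)%N -> (d i <= h i)%N.

Lemma h_ge i : (1 <= i)%N -> (i <= h i)%N.
Proof. by elim: i => // -[//|i] IH _; apply: leq_ltn_trans (IH isT) (hinc _). Qed.

Lemma d_ge i : (1 <= i)%N -> (i <= d i)%N.
Proof. by elim: i => // -[//|i] IH _; apply: leq_ltn_trans (IH isT) (dinc _). Qed.

Lemma last_scale_ge T i : (1 <= i)%N -> (h i + d i <= T)%N -> (i <= last_scale h d T)%N.
Proof.
move=> i1 iT; rewrite /last_scale; apply: (@leq_bigmax_seq _ _ (fun i => h i + d i <= T)%N id) => //.
rewrite mem_index_iota i1 ltnS; apply: leq_trans iT; apply: leq_trans (h_ge i1) _.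
exact: leq_addr.
Qed.

(** Take the last scale with $h_i+d_i\le H$: as $h_{i+1}/h_i\to1$ and $d_i=o(h_i)$, its windows
    nearly fill the gap. *)
Lemma exists_scale (e : R) : 0 < e < 1 ->
  (h i.+1)%:R / (h i)%:R @[i --> \oo] --> (1 : R) ->
  (fun i => (d i)%:R : R) =o_\oo (fun i => (h i)%:R : R) ->
  \forall H \near +oo%R, exists i, [/\ (1 <= i)%N, (h i + d i)%:R <= H &
     (1 - e) * H <= (h i)%:R * (1 - (d i)%:R / (h i)%:R) ^+ 2].
Proof.
move=> /andP[e0 e1] hr hdo.
pose e' := e / 8.
have e'0 : 0 < e' by rewrite /e' divr_gt0.
have H1 : \forall i \near \oo, (h i.+1)%:R <= (1 + e') * (h i)%:R :> R.
  have /cvgrPdist_le/(_ e' e'0) := hr.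
  apply: filter_app; near=> i => hi.
  have hi0 : 0 < (h i)%:R :> R.
    rewrite ltr0n; apply: leq_trans (h_ge _) => //; near: i; exact: nbhs_infty_gt.
  rewrite -ler_pdivrMr//; move: hi; rewrite distrC ler_norml; lra.
have H2 : \forall i \near \oo, (d i)%:R <= e' * (h i)%:R :> R.
  have /eqoP/(_ e' e'0) := hdo.
  by apply: filterS => i; rewrite !ger0_norm.
have [M _ HM] : \forall i \near \oo, (h i.+1)%:R <= (1 + e') * (h i)%:R :> R /\ (d i)%:R <= e' * (h i)%:R :> R.
  by apply: filterI.
near=> H.
pose n0 := maxn M 1.
have nH : (h n0 + d n0)%:R <= H by near: H; apply: nbhs_pinfty_ge; exact: num_real.
have H0 : 0 <= H by apply: le_trans nH.
pose p i := (n0 <= i)%N && ((h i + d i)%:R <= H).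
have p0 : exists i, p i by exists n0; rewrite /p leqnn.
have pb i : p i -> (i <= Num.bound H)%N.
  move=> /andP[ni iH]; have i1 : (1 <= i)%N by apply: leq_trans ni; rewrite leq_maxr.
  rewrite -(ler_nat R); apply: le_trans (ltW (archi_boundP H0)); apply: le_trans iH; rewrite ler_nat.
  by apply: leq_trans (h_ge i1) (leq_addr _ _).
have [i /andP[ni iH] imax] := ex_maxnP p0 pb.
have i1 : (1 <= i)%N by apply: leq_trans ni; rewrite leq_maxr.
have Mi : (M <= i)%N by apply: leq_trans ni; rewrite leq_maxl.
exists i; split => //.
have H'lt : H < (h i.+1 + d i.+1)%:R.
  rewrite ltNge; apply/negP => iH'; by have := imax i.+1; rewrite /p iH' (leq_trans ni (leqnSn i)) ltnn => /(_ isT).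
have [A1 A2] := HM _ Mi.
have [_ A3] := HM i.+1 (leqW Mi).
have hi0 : 0 < (h i)%:R :> R by rewrite ltr0n (leq_trans _ (h_ge i1)).
move: H'lt; rewrite natrD => H'lt.
have B1 : H <= (1 + e') * ((1 + e') * (h i)%:R) by nra.
have B2 : (d i)%:R / (h i)%:R <= e' by rewrite ler_pdivrMr.
have e'1 : e' <= 8^-1 by rewrite /e'; lra.
have B3 : (1 - e') ^+ 2 <= (1 - (d i)%:R / (h i)%:R) ^+ 2.
  by rewrite ler_sqr ?nnegrE; lra.
have B4 : (1 - e) * ((1 + e') * (1 + e')) <= (1 - e') ^+ 2.
  rewrite (_ : e = 8 * e'); last by rewrite /e'; field.
  nra.
apply: (@le_trans _ _ ((h i)%:R * (1 - e') ^+ 2)); last by rewrite ler_wpM2l.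
apply: (@le_trans _ _ ((1 - e) * ((1 + e') * ((1 + e') * (h i)%:R)))); first by rewrite ler_wpM2l//; lra.
by rewrite [leRHS]mulrC [leLHS](_ : _ = (1 - e) * ((1 + e') * (1 + e')) * (h i)%:R) ?ler_wpM2r//; ring.
Unshelve. all: by end_near. Qed.

(** At scale $i$ use the last grid point $kd_i$ before the change-point: it is less than $d_i$
    away, so the window stays inside the two adjacent segments. *)
Lemma window_of_Omega1 N T (Delta H : R) (V : nat) (m : 'M[R]_(N, T)) i :
  m \in Omega1 Delta V H -> 0 <= Delta -> (1 <= i)%N -> (h i + d i)%:R <= H ->
  exists k, [/\ (1 <= i <= last_scale h d T)%N, (1 <= k <= (T - 1) %/ d i)%N,
    (V <= #|[set n : 'I_N | (Delta * (1 - (d i)%:R / (h i)%:R) * Num.sqrt ((h i)%:R / 2) <=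
        `|zstat m n (k * d i - h i)%N (k * d i)%N (minn (k * d i + h i) T)|)%R]%SET|)%N &
    ln (T%:R / 4 * ((k * d i - (k * d i - h i))%:R^-1 + (minn (k * d i + h i) T - k * d i)%:R^-1)) <=
    ln (T%:R / (2 * (h i)%:R)) :> R].
Proof.
rewrite inE /Omega1 /= => -[j [/andP[j1 jc] jH jV]] D0 i1 iH.
have hi0 : (0 < h i)%N by apply: leq_trans (h_ge i1).
have di0 : (0 < d i)%N by apply: leq_trans (d_ge i1).
have tcp : tau m j \in change_points m.
  by rewrite /tau; case: (j) j1 jc => // j' _; exact: mem_nth.
move: tcp; rewrite mem_change_points => /and3P[t1 tT _].
have T0 : (0 < T)%N by lia.
have /andP[_ t2T] := @tau_gt0 _ _ _ m j.+1 jc T0.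
have : (h i + d i <= minn (tau m j - tau m j.-1) (tau m j.+1 - tau m j))%N.
  by rewrite -(ler_nat R); exact: le_trans jH.
rewrite leq_min => /andP[g1 g2].
pose k := (tau m j %/ d i)%N; pose t := (k * d i)%N.
have tj : (t <= tau m j)%N by exact: leq_trunc_div.
have tj' : (tau m j < t + d i)%N by rewrite /t addnC -mulSn ltn_ceil.
have ml : (minn (t + h i) T = t + h i)%N by apply/minn_idPl; lia.
exists k; rewrite -/t ml; split.
- by rewrite i1 last_scale_ge//; lia.
- by rewrite divn_gt0// leq_div2r; lia.
- apply: leq_trans jV _; rewrite /nb_jumps; apply: subset_leq_card; apply/fintype.subsetP => n.
  by rewrite !inE => Dn; apply: (@zstat_signal _ _ _ m n j) => //; rewrite ?j1 ?hd//; lia.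
- rewrite (_ : t - (t - h i) = h i)%N; last lia.
  rewrite (_ : t + h i - t = h i)%N; last lia.
  rewrite le_eqVlt; apply/orP; left; apply/eqP; congr ln.
  by field; rewrite pnatr_eq0 -lt0n.
Qed.
End window_selection.

(** * Orders of magnitude of the score coefficients *)

Section asymptotics.
Context {R : realType}.
Variables (zeta : R) (T : nat -> nat).
Hypothesis hzeta : 0 < zeta < 1.
Hypothesis hTzeta : asymp_equiv (fun N => ln (T N)%:R) (fun N => N%:R `^ zeta : R).
Local Notation L N := (ln N%:R : R).
Local Notation A N := (ln (T N)%:R : R).

Lemma near_ln_ge (C : R) : \forall N \near \oo, C <= L N.
Proof.
near=> N; rewrite -[C]expRK ler_ln ?posrE ?expR_gt0//.
  by near: N; exact: nbhs_infty_ger.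
rewrite ltr0n; near: N; exact: nbhs_infty_gt.
Unshelve. all: by end_near. Qed.

Lemma near_sqrt_ln_le (t : R) : 0 < t -> \forall N \near \oo, Num.sqrt (L N) <= t * L N.
Proof.
move=> t0; near=> N.
have L1 : (t ^+ 2)^-1 <= L N by near: N; exact: near_ln_ge.
have L0 : 0 < L N by apply: lt_le_trans L1; rewrite invr_gt0 exprn_gt0.
rewrite -[leRHS]ger0_norm ?mulr_ge0 ?(ltW L0) ?(ltW t0)// -sqrtr_sqr ler_wsqrtr//.
rewrite exprMn expr2 mulrA ler_peMl// ?(ltW L0)// mulrC.
by rewrite -[leLHS](mulVf (_ : t ^+ 2 != 0)) ?ler_pM2r ?exprn_gt0// gt_eqF// exprn_gt0.
Unshelve. all: by end_near. Qed.

Lemma expR_ge_sqr (x : R) : 0 <= x -> x ^+ 2 / 2 <= expR x.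
Proof. by move=> x0; have := @expR_ge1Dxn R x 1 x0; rewrite (_ : 2`!%:R = 2 :> R)//; lra. Qed.

Lemma natr_expR_ln (N : nat) : (0 < N)%N -> N%:R = expR (L N).
Proof. by move=> N0; rewrite lnK// posrE ltr0n. Qed.

Lemma near_lnT : \forall N \near \oo, expR (zeta * L N - 1) <= A N <= expR (zeta * L N + 1).
Proof.
have half : (0 : R) < 2^-1 by [].
have /cvgrPdist_le/(_ _ half) := hTzeta.
apply: filter_app; near=> N.
have N0 : (0 < N)%N by near: N; exact: nbhs_infty_gt.
have -> : N%:R `^ zeta = expR (zeta * L N).
  by rewrite /powR pnatr_eq0 (gtn_eqF N0).
set E := expR (zeta * L N); have E0 : 0 < E by exact: expR_gt0.
rewrite ler_norml => /andP[h1 h2].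
have e1 : 2 <= expR 1 :> R by have := expR_ge1Dx (1 : R); lra.
have e2 : expR (- 1) <= 2^-1 :> R by rewrite expRN lef_pV2 ?posrE ?expR_gt0.
rewrite !expRD -/E.
have AE : A N = A N / E * E by rewrite divfK// gt_eqF.
set q := A N / E in h1 h2 AE; rewrite AE; nra.
Unshelve. all: by end_near. Qed.

Lemma near_ln_lnT (t : R) : 0 < t -> \forall N \near \oo,
  [/\ (2 <= N)%N, t^-1 <= L N & expR (zeta * L N - 1) <= A N <= expR (zeta * L N + 1)].
Proof.
move=> t0; near=> N; split.
- by near: N; exact: nbhs_infty_ge.
- by near: N; exact: near_ln_ge.
- by near: N; exact: near_lnT.
Unshelve. all: by end_near. Qed.

Lemma near_ln_le_lnT (e : R) : 0 < e -> \forall N \near \oo, L N <= e * A N.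
Proof.
move=> e0; have /andP[z0 z1] := hzeta.
pose t := Num.min (zeta / 2) (e * zeta ^+ 2 / 8).
have t0 : 0 < t by rewrite /t lt_min !(divr_gt0, mulr_gt0, exprn_gt0).
have t1 : t <= zeta / 2 by rewrite /t ge_min lexx.
have t2 : t <= e * zeta ^+ 2 / 8 by rewrite /t ge_min lexx orbT.
have := near_ln_lnT t0; apply: filterS => N [_ tL /andP[AL _]].
set l := L N in tL AL *.
have lt1 : 1 <= t * l by rewrite -(ler_pM2l (_ : 0 < t^-1)) ?invr_gt0// mulr1 mulKf// gt_eqF.
have l0 : 0 < l by apply: lt_le_trans tL; rewrite invr_gt0.
have h1 : 2 <= zeta * l by have := ler_wpM2r (ltW l0) t1; lra.
have h2 : 8 <= e * zeta ^+ 2 * l by have := ler_wpM2r (ltW l0) t2; lra.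
apply: le_trans (ler_wpM2l (ltW e0) AL).
apply: (@le_trans _ _ (e * ((zeta * l - 1) ^+ 2 / 2))); last first.
  by rewrite ler_wpM2l ?(ltW e0)// expR_ge_sqr//; lra.
apply: (@le_trans _ _ (e * ((zeta * l / 2) ^+ 2 / 2))).
  have := ler_wpM2r (ltW l0) h2; lra.
rewrite ler_wpM2l ?(ltW e0)// ler_wpM2r// ler_sqr ?nnegrE; lra.
Qed.

Variables (lambda1 : R) (lambda2 : nat -> R).
Hypothesis l10 : 0 < lambda1.
Hypothesis hlambda2 : forall N, lambda2 N = Num.sqrt (A N / ln (A N)).

Definition coef1 N : R := lambda1 * L N / N%:R.
Definition coef2 N : R := lambda2 N / Num.sqrt (N%:R * L N).

(** $b_N^2=\log T/(N\log N\log\log T)$ is of order $N^{\zeta-1}/(\log N)^2$, because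
    $\log\log T\sim\zeta\log N$. *)
Lemma near_coef2 : \forall N \near \oo,
  [/\ 0 < coef2 N, coef2 N ^+ 2 <= 2 / zeta * (A N / (N%:R * L N ^+ 2)) &
      expR (((zeta - 1) * L N - 1) / 2) / L N <= coef2 N].
Proof.
have /andP[z0 z1] := hzeta.
pose t := Num.min (zeta / 4) ((1 - zeta) / 2).
have t0 : 0 < t by rewrite /t lt_min !divr_gt0// subr_gt0.
have t1 : t <= zeta / 4 by rewrite /t ge_min lexx.
have t2 : t <= (1 - zeta) / 2 by rewrite /t ge_min lexx orbT.
have := near_ln_lnT t0; apply: filterS => N [N2 tL /andP[AL AU]].
have N0 : 0 < N%:R :> R by rewrite ltr0n (leq_trans _ N2).
have NE := natr_expR_ln (leq_trans (ltn0Sn _) N2).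
set l := L N in tL AL AU NE *.
have lt1 : 1 <= t * l by rewrite -(ler_pM2l (_ : 0 < t^-1)) ?invr_gt0// mulr1 mulKf// gt_eqF.
have l0 : 0 < l by apply: lt_le_trans tL; rewrite invr_gt0.
have h1 : 4 <= zeta * l by have := ler_wpM2r (ltW l0) t1; lra.
have h2 : 2 <= (1 - zeta) * l by have := ler_wpM2r (ltW l0) t2; lra.
have A0 : 0 < A N by apply: lt_le_trans AL; exact: expR_gt0.
have lAl : zeta * l - 1 <= ln (A N) by rewrite -ler_expR lnK.
have lAu : ln (A N) <= zeta * l + 1 by rewrite -ler_expR lnK.
have lA0 : 0 < ln (A N) by lra.
have c2 : coef2 N ^+ 2 = A N / (N%:R * l * ln (A N)).
  rewrite /coef2 -/l hlambda2 expr_div_n !sqr_sqrtr; last 2 first.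
  - by rewrite mulr_ge0// ltW.
  - by rewrite divr_ge0// ltW.
  by field; rewrite !gt_eqF.
have c0 : 0 < coef2 N.
  by rewrite /coef2 hlambda2 divr_gt0// sqrtr_gt0 ?divr_gt0// mulr_gt0.
split => //.
- rewrite c2.
  have -> : A N / (N%:R * l * ln (A N)) = A N / (N%:R * l) * (ln (A N))^-1 by rewrite invfM mulrA.
  have -> : 2 / zeta * (A N / (N%:R * l ^+ 2)) = A N / (N%:R * l) * (zeta * l / 2)^-1.
    by field; rewrite !gt_eqF.
  apply: ler_wpM2l; first by rewrite divr_ge0 ?(ltW A0)// mulr_ge0// ltW.
  rewrite lef_pV2 ?posrE//; first by lra.
  by rewrite divr_gt0// mulr_gt0.
- set E := expR _; have E0 : 0 <= E / l by rewrite divr_ge0 ?expR_ge0// ltW.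
  rewrite -(@ler_pXn2r _ 2)// ?nnegrE ?(ltW c0)// c2 expr_div_n -expRM_natl.
  rewrite (_ : _ * (_ / 2) = (zeta * l - 1) - l); last by field.
  rewrite expRB -NE.
  have -> : expR (zeta * l - 1) / N%:R / l ^+ 2 = expR (zeta * l - 1) * l^-1 * (N%:R * l)^-1.
    by field; rewrite !gt_eqF.
  have -> : A N / (N%:R * l * ln (A N)) = A N * (ln (A N))^-1 * (N%:R * l)^-1.
    by field; rewrite !gt_eqF.
  apply: ler_wpM2r; first by rewrite invr_ge0 mulr_ge0// ltW.
  apply: ler_pM => //; rewrite ?expR_ge0 ?invr_ge0 ?(ltW l0)//.
  by rewrite lef_pV2 ?posrE//; lra.
Qed.

Lemma near_coef_bounds (e : R) : 0 < e -> \forall N \near \oo,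
  [/\ 0 < coef1 N, 0 < coef2 N, coef2 N <= expR ((zeta - 1) * L N / 2),
      coef1 N <= e & coef2 N <= e].
Proof.
move=> e0; have /andP[z0 z1] := hzeta.
pose t := Num.min (zeta / 4) (Num.min (e / (2 * lambda1)) ((1 - zeta) * e ^+ 2 / 4)).
have t0 : 0 < t by rewrite /t !lt_min !divr_gt0 ?mulr_gt0 ?exprn_gt0 ?subr_gt0.
have t1 : t <= zeta / 4 by rewrite /t ge_min lexx.
have t2 : t <= e / (2 * lambda1) by rewrite /t !ge_min lexx orbT.
have t3 : t <= (1 - zeta) * e ^+ 2 / 4 by rewrite /t !ge_min lexx !orbT.
near=> N.
have [//|N2 tL /andP[AL AU]] := near (near_ln_lnT t0) N.
have [//|b0 bU bL] := near near_coef2 N.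
have N0 : 0 < N%:R :> R by rewrite ltr0n (leq_trans _ N2).
have NE := natr_expR_ln (leq_trans (ltn0Sn _) N2).
have l1 : expR 1 <= L N by near: N; exact: near_ln_ge.
have l2 : 2 + 2 / (1 - zeta) + 4 / (e ^+ 2 * (1 - zeta) ^+ 2) <= L N by near: N; exact: near_ln_ge.
rewrite /coef1; set b := coef2 N in b0 bU bL *; set l := L N in l1 l2 tL AL AU NE bU bL *.
have lt1 : 1 <= t * l by rewrite -(ler_pM2l (_ : 0 < t^-1)) ?invr_gt0// mulr1 mulKf// gt_eqF.
have E1 : 1 + 1 <= expR 1 :> R by exact: expR_ge1Dx.
have l0 : 0 < l by lra.
have h1 : 4 <= zeta * l by have := ler_wpM2r (ltW l0) t1; lra.
have h2 : 2 * lambda1 <= e * l.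
  have := ler_wpM2r (ltW l0) t2.
  have -> : e / (2 * lambda1) * l = e * l / (2 * lambda1) by rewrite mulrAC.
  by move=> /(le_trans lt1); rewrite ler_pdivlMr ?mulr_gt0// mul1r.
have NL : l ^+ 2 / 2 <= N%:R by rewrite NE expR_ge_sqr// ltW.
have bE : b ^+ 2 <= expR ((zeta - 1) * l).
  apply: (le_trans bU).
  have -> : (zeta - 1) * l = zeta * l + 1 - l - 1 by ring.
  rewrite expRB expRB -NE.
  have -> : 2 / zeta * (A N / (N%:R * l ^+ 2)) = A N / N%:R * (2 / (zeta * l ^+ 2)).
    by field; rewrite !gt_eqF.
  apply: ler_pM.
  - by rewrite divr_ge0 ?(ltW N0)// (le_trans _ AL)// expR_ge0.
  - by rewrite divr_ge0// mulr_ge0 ?exprn_ge0// ltW.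
  - by rewrite ler_wpM2r// invr_ge0 ltW.
  - rewrite -[leRHS]mul1r ler_pdivrMr ?mulr_gt0 ?exprn_gt0// mul1r mulrC ler_pdivlMr ?expR_gt0//.
    have : 0 <= (zeta * l - 4) * l + 4 * (l - expR 1) by rewrite addr_ge0 ?mulr_ge0 ?subr_ge0// ltW.
    rewrite expr2; lra.
have bE' : b <= expR ((zeta - 1) * l / 2).
  rewrite -(@ler_pXn2r _ 2)// ?nnegrE ?expR_ge0 ?(ltW b0)//.
  by rewrite -expRM_natl mulrC divfK.
split=> //.
- by rewrite divr_gt0// mulr_gt0.
- rewrite ler_pdivrMr//; apply: le_trans (ler_wpM2l (ltW e0) NL).
  by have := ler_wpM2r (ltW l0) h2; rewrite expr2; lra.
- have h3 : 4 <= (1 - zeta) * l * e ^+ 2.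
    by have := ler_wpM2r (ltW l0) t3; lra.
  have h4 : 2 <= (1 - zeta) * l.
    have : 2 / (1 - zeta) <= l.
      apply: le_trans l2; rewrite -addrA addrCA lerDl addr_ge0// divr_ge0// mulr_ge0 ?sqr_ge0//.
    by rewrite ler_pdivrMr ?subr_gt0// mulrC.
  rewrite -(@ler_pXn2r _ 2)// ?nnegrE ?(ltW b0) ?(ltW e0)//; apply: (le_trans bE).
  have -> : (zeta - 1) * l = - ((1 - zeta) * l) by ring.
  rewrite expRN -[leRHS]invrK lef_pV2 ?posrE ?expR_gt0 ?invr_gt0 ?exprn_gt0//.
  apply: (@le_trans _ _ ((1 - zeta) * l)).
    by rewrite -[leLHS]mul1r ler_pdivrMr ?exprn_gt0//; lra.
  by have := expR_ge1Dx ((1 - zeta) * l); lra.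
Unshelve. all: by end_near. Qed.

(** With $a=\lambda_1\log N/N$ the first term costs $\lambda_1\log N/2$ in total, and
    $Nb^2\log(1/b)$ is of order $\log T/\log N$: both are $o(\log T)$. *)
Lemma near_null_excess (e : R) : 0 < e -> \forall N \near \oo,
  N%:R * null_excess (coef1 N) (coef2 N) <= e * A N.
Proof.
move=> e0; have /andP[z0 z1] := hzeta.
pose e' := e / (2 * (lambda1 / 2 + 1)).
have l1h : 0 < lambda1 / 2 + 1 by have := l10; lra.
have e'0 : 0 < e' by rewrite /e' divr_gt0// mulr_gt0.
near=> N.
have [//|b0 bU bL] := near near_coef2 N.
have N0' : (0 < N)%N by near: N; exact: nbhs_infty_gt.
have N0 : 0 < N%:R :> R by rewrite ltr0n.
have NE := natr_expR_ln N0'.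
have l1 : 2 <= L N by near: N; exact: near_ln_ge.
have l2 : 2 * lambda1 ^+ 2 <= L N by near: N; exact: near_ln_ge.
have l3 : 256 / (zeta * e) <= L N by near: N; exact: near_ln_ge.
have l4 : L N <= e' * A N by near: N; exact: near_ln_le_lnT.
rewrite /coef1 /null_excess; set b := coef2 N in b0 bU bL *; set l := L N in l1 l2 l3 l4 NE bU bL *.
have l0 : 0 < l by lra.
have A0 : 0 < A N by rewrite -(pmulr_rgt0 _ e'0); apply: lt_le_trans l4.
have NL : l ^+ 2 / 2 <= N%:R by rewrite NE expR_ge_sqr// ltW.
have lnb : ln (1 + b^-1) <= 3 * l.
  rewrite -[leRHS]expRK ler_ln ?posrE ?expR_gt0 ?addr_gt0 ?invr_gt0//.
  have bi : b^-1 <= expR (2 * l).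
    rewrite -[leRHS]invrK lef_pV2 ?posrE ?invr_gt0 ?expR_gt0//; apply: le_trans bL.
    have -> : 2 * l = l + l by ring.
    rewrite expRD invfM -expRN; apply: ler_pM => //; rewrite ?expR_ge0 ?invr_ge0 ?expR_ge0//.
      by rewrite ler_expR; have := mulr_gt0 z0 l0; lra.
    rewrite expRN lef_pV2 ?posrE ?expR_gt0//; have := expR_ge1Dx l; lra.
  have -> : 3 * l = l + 2 * l by ring.
  rewrite expRD; have : 1 <= expR (2 * l) by have := expR_ge1Dx (2 * l); lra.
  have := expR_ge1Dx l; set E := expR (2 * l) in bi *; set F := expR l; nra.
have lnb0 : 0 <= ln (1 + b^-1) by rewrite ln_ge0// lerDl invr_ge0 ltW.
have Nb : N%:R * b ^+ 2 <= 2 / zeta * (A N / l ^+ 2).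
  apply: le_trans (ler_wpM2l (ltW N0) bU) _.
  by rewrite le_eqVlt; apply/orP; left; apply/eqP; field; rewrite !gt_eqF.
have Nb0 : 0 <= N%:R * b ^+ 2 by rewrite mulr_ge0 ?sqr_ge0// ltW.
have -> : N%:R * (lambda1 * l / N%:R / 2 + (lambda1 * l / N%:R) ^+ 2 + 16 * b ^+ 2 +
  16 * b ^+ 2 * ln (1 + b^-1)) =
  lambda1 * l / 2 + lambda1 ^+ 2 * (l ^+ 2 / N%:R) + 16 * (N%:R * b ^+ 2) * (1 + ln (1 + b^-1)).
  by field; rewrite gt_eqF.
have p1 : lambda1 ^+ 2 * (l ^+ 2 / N%:R) <= lambda1 ^+ 2 * 2.
  rewrite ler_wpM2l ?sqr_ge0// ler_pdivrMr//; lra.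
have p2 : 16 * (N%:R * b ^+ 2) * (1 + ln (1 + b^-1)) <= 16 * (2 / zeta * (A N / l ^+ 2)) * (4 * l).
  apply: ler_pM => //; [by rewrite mulr_ge0 | by rewrite addr_ge0 | by rewrite ler_wpM2l// | lra].
have p3 : 16 * (2 / zeta * (A N / l ^+ 2)) * (4 * l) <= e / 2 * A N.
  have -> : 16 * (2 / zeta * (A N / l ^+ 2)) * (4 * l) = 128 / (zeta * l) * A N.
    by field; rewrite !gt_eqF.
  rewrite ler_wpM2r ?(ltW A0)// ler_pdivrMr ?mulr_gt0//.
  by move: l3; rewrite ler_pdivrMr ?mulr_gt0//; lra.
have p4 : (lambda1 / 2 + 1) * l <= e / 2 * A N.
  apply: le_trans (ler_wpM2l (ltW l1h) l4) _; rewrite mulrA ler_wpM2r ?(ltW A0)//.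
  rewrite /e'; move: l1h; move: (lambda1 / 2 + 1) => k k0.
  by rewrite le_eqVlt; apply/orP; left; apply/eqP; field; rewrite gt_eqF.
lra.
Unshelve. all: by end_near. Qed.

End asymptotics.

(** * The gain from truncated dense signals *)

Section dense_asymptotics.
Context {R : realType}.
Variables (zeta : R) (T : nat -> nat).
Hypothesis hzeta : 0 < zeta < 1.
Hypothesis hTzeta : asymp_equiv (fun N => ln (T N)%:R) (fun N => N%:R `^ zeta : R).
Variables (lambda1 : R) (lambda2 : nat -> R).
Hypothesis l10 : 0 < lambda1.
Hypothesis hlambda2 : forall N, lambda2 N = Num.sqrt (ln (T N)%:R / ln (ln (T N)%:R)).
Local Notation L N := (ln N%:R : R).
Local Notation A N := (ln (T N)%:R : R).
Local Notation ca N := (coef1 lambda1 N).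
Local Notation cb N := (coef2 lambda2 N).

Lemma near_sqr_ln_le_expR (C t : R) : 0 < t -> \forall N \near \oo, C * L N ^+ 2 <= expR (t * L N).
Proof.
move=> t0; near=> N.
have L0 : 1 <= L N by near: N; exact: near_ln_ge.
have LC : 6 * C / t ^+ 3 <= L N by near: N; exact: near_ln_ge.
have t3 : 0 < t ^+ 3 by rewrite exprn_gt0.
move: LC; rewrite ler_pdivrMr// => LC.
have tL : 0 <= t * L N by rewrite mulr_ge0 ?(ltW t0)//; lra.
apply: (@le_trans _ _ ((t * L N) ^+ 3 / 6)); last first.
  by have := @expR_ge1Dxn R (t * L N) 2 tL; rewrite (_ : 3`!%:R = 6 :> R)//; lra.
have -> : (t * L N) ^+ 3 / 6 = (L N * t ^+ 3) * L N ^+ 2 / 6 by ring.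
have := ler_wpM2r (sqr_ge0 (L N)) LC; lra.
Unshelve. all: by end_near. Qed.

Lemma near_coef1_le_coef2 : \forall N \near \oo, ca N <= cb N.
Proof.
have /andP[z0 z1] := hzeta.
have B := near_coef2 hzeta hTzeta hlambda2.
have tt : 0 < (1 + zeta) / 2 by lra.
have S := near_sqr_ln_le_expR (lambda1 * expR 2^-1) tt.
near=> N.
have [//|_ _ bL] := near B N.
have S' : lambda1 * expR 2^-1 * L N ^+ 2 <= expR ((1 + zeta) / 2 * L N) by near: N.
have L0 : 1 <= L N by near: N; exact: near_ln_ge.
have N0' : (0 < N)%N by near: N; exact: nbhs_infty_gt.
have L0' : 0 < L N by lra.
apply: le_trans bL; rewrite /coef1 (natr_expR_ln N0') ler_pdivlMr// expRK.
rewrite mulrAC ler_pdivrMr ?expR_gt0// -expRD.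
have -> : ((zeta - 1) * L N - 1) / 2 + L N = (1 + zeta) / 2 * L N - 2^-1 by field.
rewrite expRB ler_pdivlMr ?expR_gt0//; apply: le_trans S'.
by rewrite le_eqVlt; apply/orP; left; apply/eqP; ring.
Unshelve. all: by end_near. Qed.

Lemma normal_pdf_center0 (x : R) : normal_pdf 0 1 x = normal_pdf 0 1 0 * expR (- (x ^+ 2 / 2)).
Proof.
rewrite !normal_pdfE ?oner_neq0// /normal_fun !subr0 expr0n/= oppr0 mul0r expR0 mulr1.
by congr (_ * expR _); rewrite expr1n mulr2n; field.
Qed.

Variables (beta s q : R) (V : nat -> nat).
Hypothesis sq : 0 < q <= s.
Hypothesis sw : s ^+ 2 <= 1 - zeta.
Hypothesis sg : beta - (1 - zeta) / 2 < s ^+ 2 / 2 - (s - q) ^+ 2.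
Hypothesis beta0 : (1 - zeta) / 2 < beta.
Hypothesis hV : asymp_equiv (fun N => (V N)%:R) (fun N => N%:R `^ (1 - beta) : R).

Lemma near_V_ge : \forall N \near \oo, expR ((1 - beta) * L N) / 2 <= (V N)%:R.
Proof.
have half : (0 : R) < 2^-1 by [].
have /cvgrPdist_le/(_ _ half) := hV.
apply: filter_app; near=> N.
have N0 : (0 < N)%N by near: N; exact: nbhs_infty_gt.
have -> : N%:R `^ (1 - beta) = expR ((1 - beta) * L N).
  by rewrite /powR pnatr_eq0 (gtn_eqF N0).
set E := expR _; have E0 : 0 < E by exact: expR_gt0.
rewrite ler_norml => /andP[h1 h2].
by rewrite mulrC -ler_pdivlMr//; lra.
Unshelve. all: by end_near. Qed.

(** With signal $q\sqrt{2\log N}$ and truncation level $s\sqrt{2\log N}$: the probability of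
    exceeding the level, times the size of the $f_2$ term there. Its exponent in $N$ relative to
    $b$ is $s^2/2-(s-q)^2$. *)
Definition trunc_gain N : R :=
  normal_pdf 0 1 ((s - q) * Num.sqrt (2 * L N) + 1) * (cb N * expR (s ^+ 2 * L N / 2) / Num.sqrt 2).

Lemma near_trunc_gain_ge : \forall N \near \oo,
  cb N * expR ((beta - (1 - zeta) / 2 + (s ^+ 2 / 2 - (s - q) ^+ 2)) / 2 * L N) <= trunc_gain N.
Proof.
have /andP[z0 z1] := hzeta; have /andP[q0 qs] := sq.
have e8 : (0 : R) < 8^-1 by [].
have B := near_coef_bounds hzeta hTzeta l10 hlambda2 e8.
pose eta := s ^+ 2 / 2 - (s - q) ^+ 2 - (beta - (1 - zeta) / 2).
have eta0 : 0 < eta by rewrite /eta subr_gt0.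
have s1 : s <= 1 by have := sw; rewrite expr2; nra.
pose k0 : R := normal_pdf 0 1 0 / Num.sqrt 2.
have k00 : 0 < k0 by rewrite /k0 divr_gt0 ?sqrtr_gt0// normal_pdf_gt0.
have t0 : 0 < eta / 8 by rewrite divr_gt0.
near=> N.
have [//|_ b0 _ _ _] := near B N.
have L1 : 1 <= L N by near: N; exact: near_ln_ge.
have Lk : (2^-1 - ln k0) / (eta / 4) <= L N by near: N; exact: near_ln_ge.
have sL : Num.sqrt (L N) <= eta / 8 * L N by near: N; exact: near_sqrt_ln_le.
rewrite /trunc_gain normal_pdf_center0.
have -> : normal_pdf 0 1 0 * expR (- (((s - q) * Num.sqrt (2 * L N) + 1) ^+ 2 / 2)) *
  (cb N * expR (s ^+ 2 * L N / 2) / Num.sqrt 2) =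
  cb N * (k0 * (expR (- (((s - q) * Num.sqrt (2 * L N) + 1) ^+ 2 / 2)) * expR (s ^+ 2 * L N / 2))).
  by rewrite /k0; ring.
rewrite ler_wpM2l ?(ltW b0)// -expRD -[k0]lnK ?posrE// -expRD ler_expR.
have yy : Num.sqrt (2 * L N) ^+ 2 = 2 * L N by rewrite sqr_sqrtr//; lra.
have yL : Num.sqrt (2 * L N) <= 2 * Num.sqrt (L N).
  by rewrite -(@ler_pXn2r _ 2)// ?nnegrE ?mulr_ge0 ?sqrtr_ge0// yy exprMn sqr_sqrtr; lra.
have y0 : 0 <= Num.sqrt (2 * L N) by exact: sqrtr_ge0.
set y := Num.sqrt (2 * L N) in yy yL y0 *.
have sy : (s - q) * y <= 1 * y by rewrite ler_wpM2r//; lra.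
rewrite (_ : ((s - q) * y + 1) ^+ 2 = (s - q) ^+ 2 * y ^+ 2 + 2 * ((s - q) * y) + 1); last by ring.
rewrite yy; move: Lk; rewrite ler_pdivrMr ?divr_gt0// => Lk.
move: Lk sL; rewrite /eta; lra.
Unshelve. all: by end_near. Qed.

(** $Vb\approx N^{1-\beta-(1-\zeta)/2}$, so $V$ rows gain a power of $N$ more than
    $\log T\approx N^\zeta$ as soon as the exponent of the gain exceeds
    $\beta-(1-\zeta)/2$. *)
Lemma near_dense_signal_gain : \forall N \near \oo,
  4 * A N <= (V N)%:R * (trunc_gain N / 2 - 2 * (ca N / 2 + 2 * cb N)).
Proof.
have /andP[z0 z1] := hzeta; have /andP[q0 qs] := sq.
have B := near_coef2 hzeta hTzeta hlambda2.
have VN := near_V_ge; have TP := near_trunc_gain_ge; have ab := near_coef1_le_coef2.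
have A1 := near_lnT hTzeta.
pose eta := s ^+ 2 / 2 - (s - q) ^+ 2 - (beta - (1 - zeta) / 2).
have eta0 : 0 < eta by rewrite /eta subr_gt0.
have eta2 : 0 < eta / 2 by rewrite divr_gt0.
pose g := (beta - (1 - zeta) / 2 + (s ^+ 2 / 2 - (s - q) ^+ 2)) / 2.
have g0 : 0 < g by move: eta0 beta0; rewrite /g /eta; move: ((s - q) ^+ 2) (s ^+ 2) => u v; lra.
have S := near_sqr_ln_le_expR (32 * expR (3 / 2)) eta2.
near=> N.
have [//|b0 _ bL] := near B N.
have VN' : expR ((1 - beta) * L N) / 2 <= (V N)%:R by near: N.
have TP' : cb N * expR (g * L N) <= trunc_gain N by near: N.
have ab' : ca N <= cb N by near: N.
have /andP[AL AU] : expR (zeta * L N - 1) <= A N <= expR (zeta * L N + 1) by near: N.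
have S' : 32 * expR (3 / 2) * L N ^+ 2 <= expR (eta / 2 * L N) by near: N.
have L1 : 1 <= L N by near: N; exact: near_ln_ge.
have L20 : 20 / g <= L N by near: N; exact: near_ln_ge.
have L0 : 0 < L N by lra.
have gL : 20 <= expR (g * L N).
  by move: L20; rewrite ler_pdivrMr//; have := expR_ge1Dx (g * L N); lra.
have half : cb N * expR (g * L N) / 4 <= trunc_gain N / 2 - 2 * (ca N / 2 + 2 * cb N).
  have := ler_wpM2l (ltW b0) gL; lra.
have V0 : 0 <= (V N)%:R :> R by [].
apply: le_trans (ler_wpM2l V0 half).
apply: (@le_trans _ _ (expR ((1 - beta) * L N) / 2 * (expR (((zeta - 1) * L N - 1) / 2) / L N * expR (g * L N) / 4))); last first.
  have p0 : 0 <= expR (((zeta - 1) * L N - 1) / 2) / L N by rewrite divr_ge0 ?expR_ge0// ltW.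
  apply: ler_pM VN' _; first by rewrite divr_ge0 ?expR_ge0.
    by rewrite divr_ge0// mulr_ge0 ?expR_ge0.
  by rewrite ler_wpM2r// ler_wpM2r ?expR_ge0.
have -> : expR ((1 - beta) * L N) / 2 * (expR (((zeta - 1) * L N - 1) / 2) / L N * expR (g * L N) / 4) =
  expR ((1 - beta) * L N + ((zeta - 1) * L N - 1) / 2 + g * L N) / L N / 8.
  by rewrite !expRD; field; rewrite gt_eqF.
have -> : (1 - beta) * L N + ((zeta - 1) * L N - 1) / 2 + g * L N = (zeta * L N + 1) + eta / 2 * L N - 3 / 2.
  by rewrite /g /eta; field.
rewrite expRB expRD ler_pdivlMr// ler_pdivlMr// ler_pdivlMr ?expR_gt0//.
have -> : 4 * A N * 8 * L N * expR (3 / 2) = A N * (32 * expR (3 / 2) * L N) by ring.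
have A0 : 0 <= A N by apply: le_trans AL; exact: expR_ge0.
apply: ler_pM => //; first by rewrite mulr_ge0 ?mulr_ge0 ?expR_ge0 ?(ltW L0).
apply: le_trans S'; rewrite ler_wpM2l ?mulr_ge0 ?expR_ge0//.
by rewrite expr2 ler_peMl// ltW.
Unshelve. all: by end_near. Qed.

End dense_asymptotics.
(** This explains $\rho_Z$. The exponent $s^2/2-(s-q)^2$ is maximal, equal to $q^2$, at $s=2q$;
    but only levels with $s^2\le1-\zeta$ are useful, beyond which the $f_2$ term is no longer
    small. The condition that the best admissible exponent exceeds $\beta-(1-\zeta)/2$ is
    $q^2>\rho_Z(\beta,\zeta)$, and the two branches of $\rho_Z$ correspond to $s=2q$ and to
    $s=\sqrt{1-\zeta}$. At $\beta=3(1-\zeta)/4$ the strict inequality requires the second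
    choice, although $\rho_Z$ is defined by the first branch. *)
Lemma exists_truncation (R : realType) (zeta beta eps : R) : zeta < 1 -> 0 < eps ->
  (1 - zeta) / 2 < beta < 1 - zeta -> exists s q : R,
  [/\ 0 < q <= s, s ^+ 2 <= 1 - zeta, q ^+ 2 <= (1 + eps) * rhoZ beta zeta &
      beta - (1 - zeta) / 2 < s ^+ 2 / 2 - (s - q) ^+ 2].
Proof.
move=> z1 eps0 /andP[b1 b2]; set w := 1 - zeta in b1 b2 *.
have w0 : 0 < w by rewrite /w; lra.
have [bw|bw] := ltP beta (3 * w / 4).
  have -> : rhoZ beta zeta = beta - w / 2 by rewrite /rhoZ -/w ltW.
  set rho := beta - w / 2; have r0 : 0 < rho by rewrite /rho; lra.
  pose Q := Num.min ((1 + eps) * rho) (w / 4).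
  have Q1 : Q <= (1 + eps) * rho by rewrite /Q ge_min lexx.
  have Q2 : Q <= w / 4 by rewrite /Q ge_min lexx orbT.
  have Q3 : rho < Q.
    rewrite /Q lt_min; apply/andP; split; last by rewrite /rho; lra.
    by have := mulr_gt0 eps0 r0; lra.
  have Q0 : 0 < Q by apply: lt_trans Q3.
  have qE : Num.sqrt Q ^+ 2 = Q by rewrite sqr_sqrtr// ltW.
  have q0 : 0 < Num.sqrt Q by rewrite sqrtr_gt0.
  exists (2 * Num.sqrt Q), (Num.sqrt Q).
  rewrite (_ : 2 * Num.sqrt Q - Num.sqrt Q = Num.sqrt Q); last by ring.
  rewrite exprMn qE; split; [by apply/andP; split=> //; lra|lra|lra|lra].
have rE : rhoZ beta zeta = (Num.sqrt w - Num.sqrt (w - beta)) ^+ 2.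
  rewrite /rhoZ -/w; case: ifPn => // bw'.
  have bE : beta = 3 * w / 4 by apply/eqP; rewrite eq_le bw bw'.
  rewrite (_ : w - beta = (Num.sqrt w / 2) ^+ 2); last by rewrite expr_div_n sqr_sqrtr ?(ltW w0)// bE; field.
  rewrite sqrtr_sqr ger0_norm ?divr_ge0 ?sqrtr_ge0//.
  rewrite (_ : Num.sqrt w - Num.sqrt w / 2 = Num.sqrt w / 2); last by field.
  by rewrite expr_div_n sqr_sqrtr ?(ltW w0)// bE; field.
set S := Num.sqrt w in rE *; set r := Num.sqrt (w - beta) in rE *.
have r0 : 0 < r by rewrite sqrtr_gt0 subr_gt0.
have rS : r < S by rewrite /r /S ltr_sqrt//; lra.
have rr : r ^+ 2 = w - beta by rewrite sqr_sqrtr// subr_ge0 ltW.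
have SS : S ^+ 2 = w by rewrite sqr_sqrtr// ltW.
pose c := Num.sqrt (1 + eps).
have c1 : 1 < c by rewrite -[ltLHS]sqrtr1 ltr_sqrt; lra.
have cc : c ^+ 2 = 1 + eps by rewrite sqr_sqrtr//; lra.
pose q := Num.min (c * (S - r)) S.
have q1 : q <= c * (S - r) by rewrite /q ge_min lexx.
have q2 : q <= S by rewrite /q ge_min lexx orbT.
have q3 : S - r < q by rewrite /q lt_min ltr_pMl ?subr_gt0// c1/=; lra.
have q0 : 0 < q by apply: lt_trans q3; rewrite subr_gt0.
exists S, q; split; [by rewrite q0|by rewrite SS| |].
  by rewrite rE -cc -exprMn ler_pXn2r ?nnegrE ?(ltW q0)// (le_trans (ltW q0)).
have : (S - q) ^+ 2 < r ^+ 2 by rewrite ltr_pXn2r ?nnegrE ?subr_ge0 ?(ltW r0)//; lra.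
lra.
Qed.

(** * Convergence of the risk *)

Section risk.
Context {R : realType}.

Lemma sup_prob_le (disp : measure_display) (Om : measurableType disp) (M : Type)
    (P : M -> probability Om R) (A : set M) (E : set Om) (B : R) : 0 <= B ->
  (forall mu, A mu -> (P mu E <= B%:E)%E) -> 0 <= sup_prob P A E <= B.
Proof.
move=> B0 PB; rewrite /sup_prob; set S := [set _ | _ in _].
have SB y : S y -> 0 <= y <= B.
  move=> [mu Amu <-]; rewrite fine_ge0//=; have := PB _ Amu.
  have : (0 <= P mu E)%E by [].
  by case: (P mu E) => [r| |]//=; rewrite lee_fin.
have [->|/set0P[y Sy]] := eqVneq S set0; first by rewrite sup0 lexx.
have ubS : ubound S B by move=> z /SB/andP[].
apply/andP; split; last by apply: ge_sup => //; exists y.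
by have /andP[y0 _] := SB _ Sy; apply: le_trans y0 _; apply: ub_le_sup => //; exists B.
Qed.

Variables (zeta : R) (T : nat -> nat).
Hypothesis hzeta : 0 < zeta < 1.
Hypothesis hT : T N @[N --> \oo] --> \oo.
Hypothesis hTzeta : asymp_equiv (fun N => ln (T N)%:R) (fun N => N%:R `^ zeta : R).
Variables (disp : nat -> measure_display) (Om : forall N, measurableType (disp N)).
Variables (P : forall N, 'M[R]_(N, T N) -> probability (Om N) R).
Variables (X : forall N, 'I_N -> 'I_(T N) -> {mfun Om N >-> measurableTypeR R}).
Arguments P : clear implicits.
Arguments X : clear implicits.
Hypothesis hX : forall N, gaussian_model (P N) (X N).
Arguments hX : clear implicits.
Variables (h d : nat -> nat) (c : nat -> R).
Hypotheses (h1 : (1 <= h 1)%N) (hinc : forall i, (1 <= i)%N -> (h i < h i.+1)%N).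
Hypotheses (d1 : (1 <= d 1)%N) (dinc : forall i, (1 <= i)%N -> (d i < d i.+1)%N).
Hypothesis hd : forall i, (1 <= i)%N -> (d i <= h i)%N.
Hypothesis hratio : (h i.+1)%:R / (h i)%:R @[i --> \oo] --> (1 : R).
Hypothesis hdo : (fun i => (d i)%:R : R) =o_\oo (fun i => (h i)%:R : R).
Hypothesis hc : c =o_\oo (fun t => ln t%:R : R).
Hypothesis hcsum : c t - ln (scale_sum h d t) @[t --> \oo] --> +oo%R.
Variables (lambda1 : R) (lambda2 : nat -> R).
Hypothesis l10 : 0 < lambda1.
Hypothesis hlambda2 : forall N, lambda2 N = Num.sqrt (ln (T N)%:R / ln (ln (T N)%:R)).
Local Notation L N := (ln N%:R : R).
Local Notation A N := (ln (T N)%:R : R).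
Local Notation ca N := (coef1 lambda1 N).
Local Notation cb N := (coef2 lambda2 N).
Local Notation H1c N := [set w | declares_change h d lambda1 (lambda2 N) (c (T N)) (data (X N) w)].

Let hpos i : (1 <= i)%N -> (0 < h i)%N.
Proof. by move=> i1; apply: leq_trans (h_ge h1 hinc i1). Qed.
Let dpos i : (1 <= i)%N -> (0 < d i)%N.
Proof. by move=> i1; apply: leq_trans (d_ge d1 dinc i1). Qed.

Lemma near_type1_error_le (e : R) : 0 < e ->
  \forall N \near \oo, 0 <= sup_prob (P N) (Omega0 N (T N)) (H1c N) <= e.
Proof.
move=> e0; have e8 : (0 : R) < 8^-1 by [].
have /hT cS0 : \forall t \near \oo, ln (2 / e) <= c t - ln (scale_sum h d t) by exact: cvgry_ge.
near=> N.
have [//|a0 b0 _ aU bU] := near (near_coef_bounds hzeta hTzeta l10 hlambda2 e8) N.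
have cS : ln (2 / e) <= c (T N) - ln (scale_sum h d (T N)).
  by near: N; exact: cS0.
apply: sup_prob_le; first exact: ltW.
move=> mu mu0; have ab1 : ca N / 2 + 2 * cb N < 1 by lra.
have mu1 : mu \in Omega0 N (T N) by rewrite inE.
apply: (le_trans (type1_error_le (hX N) (ltW a0) (ltW b0) ab1 (c (T N)) hpos dpos mu1)).
rewrite lee_fin.
have S0 : 0 <= scale_sum h d (T N) :> R.
  by rewrite /scale_sum sumr_ge0// => i _; rewrite divr_ge0.
have [->|Sn0] := eqVneq (scale_sum h d (T N) : R) 0; first by rewrite mulr0 ltW.
have Sp : 0 < scale_sum h d (T N) :> R by rewrite lt_def Sn0.
rewrite -[scale_sum _ _ _]lnK ?posrE// -mulrA -expRD.
have : expR (- c (T N) + ln (scale_sum h d (T N))) <= e / 2.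
  rewrite -[leRHS]lnK ?posrE ?divr_gt0// ler_expR.
  have -> : e / 2 = (2 / e)^-1 by rewrite invf_div.
  by rewrite lnV ?posrE ?divr_gt0//; lra.
lra.
Unshelve. all: by end_near. Qed.

Lemma near_critical_value (e : R) : 0 < e -> \forall N \near \oo, c (T N) <= e * A N.
Proof.
move=> e0; have /eqoP/(_ _ e0)/hT H := hc.
have /hT T0 := nbhs_infty_gt 0.
near=> N; have : `|c (T N)| <= e * `|ln (T N)%:R| by near: N; exact: H.
have T1 : (1 <= T N)%N by near: N; exact: T0.
by rewrite [X in e * X]ger0_norm ?ln_ge0 ?ler1n// => /(le_trans (ler_norm _)).
Unshelve. all: by end_near. Qed.

Lemma near_window (Delta : nat -> R) (V : nat -> nat) (hmin : nat -> R) (e : R) :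
  0 < e < 1 -> (forall N, 0 <= Delta N) -> hmin N @[N --> \oo] --> +oo%R ->
  \forall N \near \oo, forall m : 'M[R]_(N, T N), Omega1 (Delta N) (V N) (hmin N) m ->
  exists i k, [/\ (1 <= i <= last_scale h d (T N))%N, (1 <= k <= (T N - 1) %/ d i)%N,
    (V N <= #|[set n : 'I_N | (Num.sqrt (Delta N ^+ 2 * (1 - e) * hmin N / 2) <=
        `|zstat m n (k * d i - h i)%N (k * d i)%N (minn (k * d i + h i) (T N))|)%R]%SET|)%N &
    ln ((T N)%:R / 4 * ((k * d i - (k * d i - h i))%:R^-1 + (minn (k * d i + h i) (T N) - k * d i)%:R^-1)) <=
    A N - ln (2 * (1 - e) * hmin N) :> R].
Proof.
move=> e01 D0 hoo; have /andP[e0 e1] := e01.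
have hm : \forall N \near \oo, 0 < hmin N by exact: cvgry_gt.
have /hT T0' := nbhs_infty_gt 0.
have /hoo sc := exists_scale h1 hinc e01 hratio hdo.
near=> N => m mO.
have hm0 : 0 < hmin N by near: N; exact: hm.
have T0 : (0 < T N)%N by near: N; exact: T0'.
have [i [i1 iH iL]] : exists i, [/\ (1 <= i)%N, (h i + d i)%:R <= hmin N &
     (1 - e) * hmin N <= (h i)%:R * (1 - (d i)%:R / (h i)%:R) ^+ 2].
  by near: N; exact: sc.
have mO' : m \in Omega1 (Delta N) (V N) (hmin N) by rewrite inE.
have [k [ii kk VS pen]] := window_of_Omega1 h1 hinc d1 dinc hd mO' (D0 N) i1 iH.
exists i, k; split => //.
- apply: (leq_trans VS); apply: subset_leq_card; apply/fintype.subsetP => n; rewrite !inE.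
  apply: le_trans.
  have hi0 : 0 < (h i)%:R :> R by rewrite ltr0n hpos.
  have q0 : 0 <= 1 - (d i)%:R / (h i)%:R :> R.
    by rewrite subr_ge0 ler_pdivrMr// mul1r ler_nat hd.
  rewrite -[leRHS]ger0_norm ?mulr_ge0 ?sqrtr_ge0// -sqrtr_sqr ler_wsqrtr//.
  rewrite !exprMn sqr_sqrtr ?divr_ge0//.
  by have := ler_wpM2l (sqr_ge0 (Delta N)) iL; set q := 1 - (d i)%:R / _; lra.
- apply: (le_trans pen).
  have hi0 : 0 < (h i)%:R :> R by rewrite ltr0n hpos.
  have hi2 : 0 < 2 * (h i)%:R :> R by rewrite mulr_gt0.
  have e2 : 0 < 2 * (1 - e) * hmin N by rewrite !mulr_gt0 ?subr_gt0.
  rewrite ln_div ?posrE ?ltr0n// lerB// ler_ln ?posrE//.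
  rewrite -mulrA ler_wpM2l//; apply: (le_trans iL).
  rewrite ler_piMr ?(ltW hi0)// exprn_ile1//.
    by rewrite subr_ge0 ler_pdivrMr// mul1r ler_nat hd.
Unshelve. all: by end_near. Qed.

Lemma near_lnT_ge (C : R) : \forall N \near \oo, C <= A N.
Proof.
have lA := near_ln_le_lnT hzeta hTzeta (ltr01 : 0 < 1 :> R).
near=> N; apply: (@le_trans _ _ (L N)); first by near: N; exact: near_ln_ge.
rewrite -[leRHS]mul1r; near: N; exact: lA.
Unshelve. all: by end_near. Qed.

Lemma near_expR_lnT (k e : R) : 0 < k -> 0 < e -> \forall N \near \oo, expR (- (k * A N)) <= e.
Proof.
move=> k0 e0; have := near_lnT_ge (- ln e / k); apply: filterS => N AN.
rewrite -[leRHS]lnK ?posrE// ler_expR lerNl -ler_pdivrMl// mulrC//.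
Qed.

(** Both regimes for $\Delta$ read $\Delta^2=KT^{-(1-\kappa)}$. The chosen window has penalty at
    most $\kappa\log T$, because its length is at least $T^{1-\kappa}$, while the $V$ rows with a
    signal gain $V m_0^2/2\approx\kappa(1+\varepsilon)\log T$; the loss of $V\log N$ from the
    factor $a$ in the likelihood ratio is $o(\log T)$. A small fixed power of the likelihood
    ratio then gives an error of order $T^{-\theta\kappa\varepsilon/4}$. *)
Lemma near_type2_sparse (kappa K eps : R) (Delta : nat -> R) (V : nat -> nat) (hmin : nat -> R) :
  0 < kappa <= 1 -> 0 < K -> 0 < eps -> (forall N, 0 <= Delta N) ->
  (\forall N \near \oo, Delta N ^+ 2 = K * expR (- ((1 - kappa) * A N))) ->
  (\forall N \near \oo, (1 <= V N)%N) ->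
  (forall t : R, 0 < t -> \forall N \near \oo, (V N)%:R * L N <= t * A N) ->
  (forall N, hmin N = 4 * kappa * (1 + eps) * (A N / (Delta N ^+ 2 * (V N)%:R))) ->
  forall e : R, 0 < e ->
  \forall N \near \oo, 0 <= sup_prob (P N) (Omega1 (Delta N) (V N) (hmin N)) (~` H1c N) <= e.
Proof.
move=> /andP[kp0 kp1] K0 eps0 D0 DE V1 VL hE e e0.
have eps1 : 0 < 1 + eps by lra.
(* so small that $(1-\delta)^4(1+\varepsilon)\ge1+\varepsilon/2$ *)
pose del := eps / (8 * (1 + eps)).
have del0 : 0 < del by rewrite /del divr_gt0// mulr_gt0.
have dele : del * (1 + eps) = eps / 8 by rewrite /del; move: eps1; move: (1 + eps) => k k0; field; rewrite gt_eqF.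
have del8 : del <= 8^-1 by rewrite -(ler_pM2r eps1) dele; lra.
have del1 : del < 1 by lra.
have del01 : 0 < del < 1 by rewrite del0.
have dele4 : 1 + eps / 2 <= (1 - del) ^+ 4 * (1 + eps).
  have : 1 - 4 * del <= (1 - del) ^+ 4.
    have : (1 - del) ^+ 4 - (1 - 4 * del) = del ^+ 2 * (2 + (2 - del) ^+ 2) by ring.
    by have : 0 <= del ^+ 2 * (2 + (2 - del) ^+ 2); [rewrite mulr_ge0 ?addr_ge0 ?sqr_ge0 | lra].
  by move=> /(ler_wpM2r (ltW eps1)); lra.
pose th := del ^+ 2.
have th0 : 0 < th by rewrite exprn_gt0.
have th1 : th <= 1 by rewrite /th exprn_ile1// ltW.
pose C0 := 4 * kappa * (1 + eps) / K.
have C00 : 0 < C0 by rewrite /C0 divr_gt0// !mulr_gt0.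
have hge (M : R) : \forall N \near \oo, M * expR ((1 - kappa) * A N) <= hmin N /\ 0 < (V N)%:R :> R.
  near=> N.
  have V1' : (1 <= V N)%N by near: N.
  have v0 : 0 < (V N)%:R :> R by rewrite ltr0n.
  split => //.
  have DE' : Delta N ^+ 2 = K * expR (- ((1 - kappa) * A N)) by near: N.
  have VL' : (V N)%:R * L N <= 1 * A N by near: N; exact: VL.
  have LM : M / C0 <= L N by near: N; exact: near_ln_ge.
  rewrite hE DE' expRN.
  have -> : 4 * kappa * (1 + eps) * (A N / (K / expR ((1 - kappa) * A N) * (V N)%:R)) =
    C0 * (A N / (V N)%:R) * expR ((1 - kappa) * A N).
    rewrite /C0; field; rewrite (gt_eqF v0) (gt_eqF K0) gt_eqF ?expR_gt0//.
  rewrite ler_wpM2r ?expR_ge0// mulrC -ler_pdivrMr//; apply: (le_trans LM).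
  by rewrite ler_pdivlMr// mulrC; lra.
have hoo : hmin N @[N --> \oo] --> +oo%R.
  apply/cvgryPge => M; near=> N.
  have [M0 _] : `|M| * expR ((1 - kappa) * A N) <= hmin N /\ 0 < (V N)%:R :> R by near: N; exact: hge.
  apply: (le_trans (ler_norm M)); apply: le_trans M0; rewrite ler_peMr//.
  rewrite -[leLHS]expR0 ler_expR mulr_ge0 ?subr_ge0//; near: N; exact: near_lnT_ge.
have W := near_window V del01 D0 hoo.
pose e1 := kappa * eps / 16.
have e10 : 0 < e1 by rewrite /e1 divr_gt0// mulr_gt0.
have N1 := near_null_excess hzeta hTzeta l10 hlambda2 e10.
have C1 := near_critical_value e10.
have e8 : (0 : R) < 8^-1 by [].
have B1 := near_coef_bounds hzeta hTzeta l10 hlambda2 e8.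
have VL1 := VL (th * e1 / 2).
have k0 : 0 < th * (kappa * eps / 4) by rewrite mulr_gt0// divr_gt0// mulr_gt0.
have E1 := near_expR_lnT k0 e0.
pose Cd := ln (4 * expR (2 * del) / del ^+ 2).
near=> N.
apply: sup_prob_le; first exact: ltW.
move=> m mO.
have [//|a0 b0 _ aU bU] := near B1 N.
have ab : ca N / 2 + 2 * cb N <= 2^-1 by lra.
have [//|i [k [iL kk VS pen]]] := near W N _ m mO.
have [H1 v0] : 1 / (2 * (1 - del)) * expR ((1 - kappa) * A N) <= hmin N /\ 0 < (V N)%:R :> R by near: N; exact: hge.
have A0 : 0 < A N by apply: (@lt_le_trans _ _ 1) => //; near: N; exact: near_lnT_ge.
have pen' : A N - ln (2 * (1 - del) * hmin N) <= kappa * A N.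
  have : (1 - kappa) * A N <= ln (2 * (1 - del) * hmin N).
    have H2 : expR ((1 - kappa) * A N) <= 2 * (1 - del) * hmin N.
      have g0 : 0 < 2 * (1 - del) by lra.
      by move: H1; rewrite mul1r [leLHS]mulrC ler_pdivrMr// [hmin N * _]mulrC.
    rewrite -[leLHS]expRK ler_ln ?posrE ?expR_gt0//; apply: lt_le_trans H2; exact: expR_gt0.
  lra.
have DE' : Delta N ^+ 2 = K * expR (- ((1 - kappa) * A N)) by near: N.
have DD0 : 0 < Delta N ^+ 2 by rewrite DE' mulr_gt0// expR_gt0.
set m0 := Num.sqrt _ in VS.
have m0E : (V N)%:R * (m0 ^+ 2 / 2) = kappa * (1 - del) * (1 + eps) * A N.
  have hm0 : 0 <= hmin N.
    by apply: le_trans H1; rewrite mulr_ge0 ?expR_ge0// divr_ge0// mulr_ge0// subr_ge0 ltW.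
  rewrite /m0 sqr_sqrtr; last first.
    by rewrite divr_ge0// mulr_ge0// mulr_ge0 ?sqr_ge0// subr_ge0 ltW.
  rewrite hE; move: DD0; move: (Delta N ^+ 2) => DD DD0.
  by field; rewrite !gt_eqF.
have m00 : 0 <= m0 by exact: sqrtr_ge0.
have B1' : 1 <= expR (th * null_excess (ca N) (cb N)).
  by rewrite -[leLHS]expR0 ler_expR mulr_ge0 ?(ltW th0)// null_excess_ge0.
have th01 : 0 <= th <= 1 by rewrite ltW.
have thd : 0 <= th <= del ^+ 2 by rewrite ltW//=.
have P2 := type2_error_le (hX N) (c (T N)) hpos dpos iL kk (ltW th0) _ B1'
  (fun y => null_moment (erefl (ca N)) (erefl (cb N)) a0 b0 ab y th01)
  (fun y my => strong_signal_moment (erefl (ca N)) (erefl (cb N)) a0 b0 ab del01 thd m00 my) VS (le_trans pen pen').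
apply: (le_trans (P2 _)); first by rewrite mulr_ge0 ?expR_ge0.
rewrite lee_fin.
have AE1 : expR (- (th * (kappa * eps / 4) * A N)) <= e by near: N.
apply: le_trans AE1.
rewrite -/Cd -[3 in X in X ^+ _]lnK ?posrE// -expRD -!expRM_natl -!expRD ler_expR.
have N1' : N%:R * null_excess (ca N) (cb N) <= e1 * A N by near: N.
have C1' : c (T N) <= e1 * A N by near: N.
have L1 : 1 <= L N by near: N; exact: near_ln_ge.
have VL' : (V N)%:R * L N <= th * e1 / 2 * A N by near: N; apply: VL1; rewrite divr_gt0// mulr_gt0.
have LC : ln 3 + th * Cd - th * ln lambda1 <= L N by near: N; exact: near_ln_ge.
have N2 : (0 < N)%N by near: N; exact: nbhs_infty_gt.
have la : - ln (ca N) <= L N - ln lambda1.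
  have L0 : 0 < L N := lt_le_trans ltr01 L1.
  rewrite /coef1 ln_div ?posrE ?mulr_gt0 ?ltr0n// lnM ?posrE//.
  by rewrite opprB opprD addrA gerBl ln_ge0.
have tla : ln 3 + th * (Cd - ln (ca N)) <= 2 * L N.
  have thL : th * L N <= 1 * L N by rewrite ler_wpM2r// (le_trans ler01 L1).
  by move: (ler_wpM2l (ltW th0) la) thL LC; lra.
have := ler_wpM2l (ltW v0) tla => Vt.
have thm : (V N)%:R * (th * ((1 - del) ^+ 3 * m0 ^+ 2 / 2)) >= th * (kappa * (1 + eps / 2) * A N).
  have -> : (V N)%:R * (th * ((1 - del) ^+ 3 * m0 ^+ 2 / 2)) = th * ((1 - del) ^+ 3 * ((V N)%:R * (m0 ^+ 2 / 2))) by ring.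
  rewrite m0E ler_wpM2l ?(ltW th0)//.
  have -> : (1 - del) ^+ 3 * (kappa * (1 - del) * (1 + eps) * A N) = kappa * ((1 - del) ^+ 4 * (1 + eps)) * A N by ring.
  by rewrite ler_wpM2r ?(ltW A0)// ler_wpM2l ?(ltW kp0).
have thc := ler_wpM2l (ltW th0) C1'.
have thn := ler_wpM2l (ltW th0) N1'.
have ke : 0 <= th * (kappa * eps * A N) by rewrite (mulr_ge0 (ltW th0) (mulr_ge0 (mulr_ge0 (ltW kp0) (ltW eps0)) (ltW A0))).
move: Vt thm thc thn VL' ke; rewrite /e1; move: (m0 ^+ 2) (null_excess _ _) => M NU; lra.
Unshelve. all: by end_near. Qed.

(** Here $V$ is of larger order than $\log T$, so that the loss of $V\log N$ rules out the
    $f_1$ term. Truncated signals gain $4\log T$ at power $1$, more than the critical value, the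
    penalty and the rows without signal cost, each of which is at most $\log T$. *)
Lemma near_type2_dense (beta K eps : R) (Delta : nat -> R) (V : nat -> nat) (hmin : nat -> R) :
  0 < eps -> (1 - zeta) / 2 < beta < 1 - zeta -> (forall N, 0 <= Delta N) ->
  (\forall N \near \oo, 0 < Delta N ^+ 2 <= K) ->
  asymp_equiv (fun N => (V N)%:R) (fun N => N%:R `^ (1 - beta) : R) ->
  (forall N, hmin N = 4 * (1 + eps) * rhoZ beta zeta * (L N / Delta N ^+ 2)) ->
  forall e : R, 0 < e ->
  \forall N \near \oo, 0 <= sup_prob (P N) (Omega1 (Delta N) (V N) (hmin N)) (~` H1c N) <= e.
Proof.
move=> eps0 hb D0 DK hV hE e e0.
have /andP[z0 z1] := hzeta; have /andP[b1 b2] := hb.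
have eps2 : 0 < eps / 2 by lra.
have [s [q [/andP[q0 qs] sw qr sg]]] := exists_truncation z1 eps2 hb.
have sq : 0 < q <= s by rewrite q0.
have rho0 : 0 < rhoZ beta zeta.
  have : 0 < (1 + eps / 2) * rhoZ beta zeta by apply: lt_le_trans qr; rewrite exprn_gt0.
  by rewrite pmulr_rgt0//; lra.
pose del := Num.min 2^-1 (eps / (8 * (1 + eps))).
have eps1 : 0 < 1 + eps by lra.
have del0 : 0 < del by rewrite /del lt_min invr_gt0 ltr0n /= divr_gt0// mulr_gt0.
have delh : del <= 2^-1 by rewrite /del ge_min lexx.
have dele : del * (1 + eps) <= eps / 8.
  have : del <= eps / (8 * (1 + eps)) by rewrite /del ge_min lexx orbT.
  by rewrite invfM mulrA ler_pdivlMr.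
have del01 : 0 < del < 1 by rewrite del0/=; lra.
have del2 : 1 <= 2 * (1 - del) by lra.
have dele2 : 1 + eps / 2 <= (1 - del) * (1 + eps) by lra.
have hoo : hmin N @[N --> \oo] --> +oo%R.
  apply/cvgryPge => M; near=> N.
  have /andP[DD0 DDK] : 0 < Delta N ^+ 2 <= K by near: N.
  have cr0 : 0 < 4 * (1 + eps) * rhoZ beta zeta by rewrite !mulr_gt0.
  have LM : `|M| * K / (4 * (1 + eps) * rhoZ beta zeta) <= L N by near: N; exact: near_ln_ge.
  rewrite hE mulrA ler_pdivlMr//; apply: (@le_trans _ _ (`|M| * K)).
    by apply: le_trans (ler_wpM2r (ltW DD0) (ler_norm M)) _; rewrite ler_wpM2l.
  by move: LM; rewrite ler_pdivrMr// [leRHS]mulrC.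
have W := near_window V del01 D0 hoo.
have N1 := near_null_excess hzeta hTzeta l10 hlambda2 (ltr01 : 0 < 1 :> R).
have C1 := near_critical_value (ltr01 : 0 < 1 :> R).
have e8 : (0 : R) < 8^-1 by [].
have B1 := near_coef_bounds hzeta hTzeta l10 hlambda2 e8.
have E1 := near_expR_lnT (ltr01 : 0 < 1 :> R) e0.
have TG := near_dense_signal_gain hzeta hTzeta l10 hlambda2 sq sw sg b1 hV.
have h1' : \forall N \near \oo, 1 <= hmin N by exact: cvgry_ge.
near=> N.
apply: sup_prob_le; first exact: ltW.
move=> m mO.
have [//|a0 b0 bU aU bU'] := near B1 N.
have ab : ca N / 2 + 2 * cb N <= 2^-1 by lra.
have [//|i [k [iL kk VS pen]]] := near W N _ m mO.
have hm1 : 1 <= hmin N by near: N.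
have pen' : A N - ln (2 * (1 - del) * hmin N) <= A N.
  rewrite gerBl ln_ge0//; apply: (le_trans hm1); rewrite ler_peMl ?(le_trans ler01 hm1)//.
have /andP[DD0 _] : 0 < Delta N ^+ 2 <= K by near: N.
have L1 : 1 <= L N by near: N; exact: near_ln_ge.
set y := Num.sqrt (2 * L N).
have y0 : 0 <= y by exact: sqrtr_ge0.
have yy : y ^+ 2 = 2 * L N by rewrite sqr_sqrtr//; lra.
have VS' : (V N <= #|[set n : 'I_N | (q * y <=
        `|zstat m n (k * d i - h i)%N (k * d i)%N (minn (k * d i + h i) (T N))|)%R]%SET|)%N.
  apply: (leq_trans VS); apply: subset_leq_card; apply/fintype.subsetP => n; rewrite !inE.
  apply: le_trans.
  have qy0 : 0 <= q * y by rewrite mulr_ge0// ltW.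
  rewrite -[leLHS]ger0_norm// -sqrtr_sqr ler_wsqrtr// exprMn yy hE.
  have -> : Delta N ^+ 2 * (1 - del) * (4 * (1 + eps) * rhoZ beta zeta * (L N / Delta N ^+ 2)) / 2 =
     (1 - del) * (1 + eps) * rhoZ beta zeta * (2 * L N).
    by move: DD0; move: (Delta N ^+ 2) => DD DD0; field; rewrite gt_eqF.
  rewrite ler_wpM2r//; first by rewrite mulr_ge0// (le_trans ler01 L1).
  by apply: (le_trans qr); rewrite ler_wpM2r ?(ltW rho0).
pose x1 := cb N * expR (s ^+ 2 * L N / 2) / Num.sqrt 2.
have x1E : x1 <= cb N * expR ((s * y) ^+ 2 / 4) / Num.sqrt 2.
  rewrite exprMn yy (_ : s ^+ 2 * (2 * L N) / 4 = s ^+ 2 * L N / 2)//; by field.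
have x10 : 0 <= x1 by rewrite divr_ge0 ?sqrtr_ge0// mulr_ge0 ?expR_ge0// ltW.
have x11 : x1 <= 1.
  have s2 : 1 <= Num.sqrt 2 :> R by rewrite -[leLHS]sqrtr1 ler_wsqrtr// ler1n.
  rewrite ler_pdivrMr ?sqrtr_gt0// mul1r; apply: le_trans s2.
  apply: (@le_trans _ _ (expR ((zeta - 1) * L N / 2) * expR ((1 - zeta) * L N / 2))).
    apply: ler_pM bU _; rewrite ?(ltW b0) ?expR_ge0//.
    by rewrite ler_expR ler_wpM2r// ler_wpM2r// (le_trans ler01 L1).
  by rewrite -expRD (_ : _ + _ = 0) ?expR0//; field.
have x101 : 0 <= x1 <= 1 by rewrite x10.
have qysy : 0 <= q * y <= s * y.
  by rewrite mulr_ge0 ?(ltW q0)//= ler_wpM2r.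
have B1' : 1 <= expR (1 * null_excess (ca N) (cb N)).
  by rewrite mul1r -[leLHS]expR0 ler_expR null_excess_ge0.
have th01 : (0 : R) <= 1 <= (1 : R) by rewrite ler01 lexx.
have P2 := type2_error_le (hX N) (c (T N)) hpos dpos iL kk (ler01 : 0 <= 1 :> R) (expR_ge0 _) B1'
  (fun y => null_moment (erefl (ca N)) (erefl (cb N)) a0 b0 ab y th01)
  (fun y my => moderate_signal_moment (erefl (ca N)) (erefl (cb N)) a0 b0 ab qysy my x101 x1E)
  VS' (le_trans pen pen').
apply: (le_trans P2); rewrite lee_fin.
have AE1 : expR (- (1 * A N)) <= e by near: N.
apply: le_trans AE1.
rewrite -!expRM_natl -!expRD ler_expR.
have N1' : N%:R * null_excess (ca N) (cb N) <= 1 * A N by near: N.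
have C1' : c (T N) <= 1 * A N by near: N.
have TG' : 4 * A N <= (V N)%:R * (trunc_gain lambda2 s q N / 2 - 2 * (ca N / 2 + 2 * cb N)) by near: N.
move: TG'; rewrite /trunc_gain -/y -/x1 (_ : (s - q) * y = s * y - q * y); last by ring.
move: N1' C1'; move: (null_excess _ _) (normal_pdf _ _ _) => nu D; lra.
Unshelve. all: by end_near. Qed.
Lemma risk_cvg0 (Delta : nat -> R) (V : nat -> nat) (hmin : nat -> R) :
  (forall e : R, 0 < e -> \forall N \near \oo,
     0 <= sup_prob (P N) (Omega1 (Delta N) (V N) (hmin N)) (~` H1c N) <= e) ->
  sup_prob (P N) (Omega0 N (T N)) (H1c N) +
  sup_prob (P N) (Omega1 (Delta N) (V N) (hmin N)) (~` H1c N) @[N --> \oo] --> (0 : R).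
Proof.
move=> II; apply/cvgrPdist_le => e e0.
have e2 : 0 < e / 2 by rewrite divr_gt0.
have I := near_type1_error_le e2; have {}II := II _ e2.
near=> N.
have /andP[p0 pe] : 0 <= sup_prob (P N) (Omega0 N (T N)) (H1c N) <= e / 2 by near: N.
have /andP[q0 qe] : 0 <= sup_prob (P N) (Omega1 (Delta N) (V N) (hmin N)) (~` H1c N) <= e / 2 by near: N.
rewrite sub0r normrN ger0_norm ?addr_ge0//.
by apply: le_trans (lerD pe qe) _; rewrite -splitr.
Unshelve. all: by end_near. Qed.

End risk.

Lemma littleo_ln_ratio (R : realType) (V : nat -> nat) (A B : nat -> R) (C : R) :
  (fun N => (V N)%:R : R) =o_\oo (fun N => B N / ln N%:R : R) -> 0 < C ->
  (\forall N \near \oo, 0 <= B N <= C * A N) ->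
  forall t : R, 0 < t -> \forall N \near \oo, (V N)%:R * ln N%:R <= t * A N.
Proof.
move=> /eqoP VB C0 BA t t0.
have tC : 0 < t / C by rewrite divr_gt0.
have VB' := VB _ tC.
near=> N.
have L0 : 0 < ln N%:R :> R.
  by apply: (@lt_le_trans _ _ 1) => //; near: N; exact: near_ln_ge.
have /andP[B0 BC] : 0 <= B N <= C * A N by near: N.
have : `|(V N)%:R| <= t / C * `|B N / ln N%:R| by near: N.
rewrite ger0_norm// ger0_norm ?divr_ge0 ?(ltW L0)// mulrA ler_pdivlMr// => /le_trans; apply.
by rewrite -mulrA ler_wpM2l ?(ltW t0)// mulrC ler_pdivrMr// mulrC.
Unshelve. all: by end_near. Qed.
Theorem theorem3 (R : realType)
  (zeta eps : R) (hzeta : 0 < zeta < 1) (heps : 0 < eps)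
  (T : nat -> nat) (hT : T N @[N --> \oo] --> \oo)
  (hTzeta : asymp_equiv (fun N => ln (T N)%:R) (fun N => N%:R `^ zeta))
  (* statistical model *)
  (disp : nat -> measure_display) (Om : forall N, measurableType (disp N))
  (P : forall N, 'M[R]_(N, T N) -> probability (Om N) R)
  (X : forall N, 'I_N -> 'I_(T N) -> {mfun Om N >-> measurableTypeR R})
  (hX : forall N, gaussian_model (P N) (X N))
  (* parameters of the algorithm *)
  (h d : nat -> nat) (c : nat -> R)
  (h1 : (1 <= h 1)%N) (hinc : forall i, (1 <= i)%N -> (h i < h i.+1)%N)
  (d1 : (1 <= d 1)%N) (dinc : forall i, (1 <= i)%N -> (d i < d i.+1)%N)
  (hd : forall i, (1 <= i)%N -> (d i <= h i)%N)
  (hratio : (h i.+1)%:R / (h i)%:R @[i --> \oo] --> (1 : R))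
  (hdo : (fun i => (d i)%:R : R) =o_\oo (fun i => (h i)%:R : R))
  (hsum : (fun t => ln (scale_sum h d t) : R) =o_\oo (fun t => ln t%:R : R))
  (hc : c =o_\oo (fun t => ln t%:R : R))
  (hcsum : c t - ln (scale_sum h d t) @[t --> \oo] --> +oo)
  (lambda1 : R) (hlambda1 : 0 < lambda1)
  (lambda2 : nat -> R)
  (hlambda2 : forall N,
     lambda2 N = Num.sqrt (ln (T N)%:R / ln (ln (T N)%:R)))
  (* alternative hypothesis *)
  (Delta : nat -> R) (V : nat -> nat) (hmin : nat -> R)
  (hV : forall N, (1 <= N)%N -> (1 <= V N)%N)
  (hcond :
     (* (a) *)
     (exists Delta0 : R,
        [/\ 0 < Delta0,
            forall N, Delta N = Delta0
          & ((fun N => (V N)%:R : R) =o_\oo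
                 (fun N => ln (T N)%:R / ln N%:R : R) /\
             forall N, hmin N = 4 * (1 + eps) *
               (ln (T N)%:R / (Delta N ^+ 2 * (V N)%:R)))
            \/
            (exists beta : R,
               [/\ (1 - zeta) / 2 < beta < 1 - zeta,
                   asymp_equiv (fun N => (V N)%:R) (fun N => N%:R `^ (1 - beta))
                 & forall N, hmin N = 4 * (1 + eps) * rhoZ beta zeta *
                     (ln N%:R / Delta N ^+ 2)])])
     \/
     (* (b) *)
     (exists eta : R,
        [/\ 0 < eta < 1 / 2,
            forall N, Delta N = (T N)%:R `^ (- eta)
          & ((fun N => (V N)%:R : R) =o_\oo
                 (fun N => N%:R `^ zeta / ln N%:R : R) /\
             forall N, hmin N = 4 * (1 - 2 * eta) * (1 + eps) *
               (ln (T N)%:R / (Delta N ^+ 2 * (V N)%:R)))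
            \/
            (exists beta : R,
               [/\ (1 - zeta) / 2 < beta < 1 - zeta,
                   asymp_equiv (fun N => (V N)%:R) (fun N => N%:R `^ (1 - beta))
                 & forall N, hmin N = 4 * (1 + eps) * rhoZ beta zeta *
                     (ln N%:R / Delta N ^+ 2)])])) :
  let H1_concluded N : set (Om N) :=
    [set w | declares_change h d lambda1 (lambda2 N) (c (T N)) (data (X N) w)] in
  sup_prob (P N) (Omega0 N (T N)) (H1_concluded N)
  + sup_prob (P N) (Omega1 (Delta N) (V N) (hmin N)) (~` H1_concluded N)
    @[N --> \oo] --> (0 : R).
Proof.
move=> H1_concluded.
apply: (risk_cvg0 hzeta hT hTzeta hX h1 hinc d1 dinc hcsum hlambda1 hlambda2).
have V1 : \forall N \near \oo, (1 <= V N)%N.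
  by near=> N; apply: hV; near: N; exact: nbhs_infty_gt.
have /hT TP := nbhs_infty_gt 0.
have A0 := near_lnT_ge hzeta hTzeta 0.
have NA : \forall N \near \oo, (0 : R) <= N%:R `^ zeta <= 2 * ln (T N)%:R.
  have half : (0 : R) < 2^-1 by [].
  have /cvgrPdist_le/(_ _ half) := hTzeta.
  apply: filter_app; near=> N.
  have E0 : 0 < N%:R `^ zeta :> R.
    by rewrite powR_gt0// ltr0n; near: N; exact: nbhs_infty_gt.
  rewrite ler_norml => /andP[_ h2]; rewrite (ltW E0)/=.
  have : 2^-1 <= ln (T N)%:R / N%:R `^ zeta by lra.
  by rewrite ler_pdivlMr//; lra.
have sparse := near_type2_sparse hzeta hT hTzeta hX h1 hinc d1 dinc hd hratio hdo hc hlambda1 hlambda2.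
have dense := near_type2_dense hzeta hT hTzeta hX h1 hinc d1 dinc hd hratio hdo hc hlambda1 hlambda2.
case: hcond => [[D0 [D00 DE [[Vo hE]|[beta [hb hVb hE]]]]]|[eta [/andP[eta0 eta1] DE [[Vo hE]|[beta [hb hVb hE]]]]]].
- have K0 : 0 < D0 ^+ 2 by rewrite exprn_gt0.
  have k1 : (0 : R) < 1 <= (1 : R) by rewrite ltr01 lexx.
  apply: (sparse 1 (D0 ^+ 2) eps Delta V hmin k1 K0 heps _ _ V1).
  + by move=> N; rewrite DE ltW.
  + by near=> N; rewrite DE subrr mul0r oppr0 expR0 mulr1.
  + apply: (littleo_ln_ratio Vo (ltr01 : 0 < 1 :> R)).
    by apply: filterS A0 => N AN; rewrite AN mul1r lexx.
  + by move=> N; rewrite hE mulr1.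
- apply: (dense beta (D0 ^+ 2) eps Delta V hmin heps hb _ _ hVb hE).
  + by move=> N; rewrite DE ltW.
  + by near=> N; rewrite DE exprn_gt0/=.
- have k1 : 0 < 1 - 2 * eta <= 1 by apply/andP; split; lra.
  apply: (sparse (1 - 2 * eta) 1 eps Delta V hmin k1 ltr01 heps _ _ V1 _ hE).
  + by move=> N; rewrite DE powR_ge0.
  + near=> N; have T0 : (0 < T N)%N by near: N.
    rewrite DE /powR pnatr_eq0 (gtn_eqF T0) -expRM_natl mul1r; congr expR; ring.
  + exact: (littleo_ln_ratio Vo (ltr0n _ 2)).
- apply: (dense beta 1 eps Delta V hmin heps hb _ _ hVb hE).
  + by move=> N; rewrite DE powR_ge0.
  + near=> N; have T0 : (0 < T N)%N by near: N.
    rewrite DE exprn_gt0 ?powR_gt0 ?ltr0n//= exprn_ile1 ?powR_ge0//.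
    rewrite /powR pnatr_eq0 (gtn_eqF T0) -[leRHS]expR0 ler_expR mulNr oppr_le0 mulr_ge0 ?(ltW eta0)//.
    by near: N.
Unshelve. all: by end_near. Qed.
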